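(* Let $n\ge 8$, $p\in[1,2]$, let $N\ge 1$ and $m\ge 1$ be integers and $t>0$. Let RDFDS (defined in the context) be applied with these parameters to the problem $\min_{x\in\mathbb{R}^n} f(x)$, where $f(x)=\mathbb{E}_\xi[F(x,\xi)]$, let $x^*$ be an arbitrary minimizer of $f$ on $\mathbb{R}^n$, and let $\Theta_p$ be such that $V[x_0](x^* )\le\Theta_p$. Then $$\mathbb{E}[f(\bar x_N)]-f(x^* )\le\frac{384\,n\rho_nL_2\Theta_p}{N}+\frac{2\sigma^2}{L_2m}+\Big(\frac{n}{6L_2}+\frac{N}{3L_2\rho_n}\Big)\Big(\frac{L_2^2t^2}{2}+\frac{8\Delta^2}{t^2}\Big)+\frac{8\sqrt{2n\Theta_p}}{N}\Big(\frac{L_2t}{2}+\frac{2\Delta}{t}\Big),$$ where $\mathbb{E}$ is the expectation over all random directions and all samples of $\xi$ used by the algorithm.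
   Context: Problem. $\xi$ is a random vector with distribution $P$ on $\mathcal{X}$; $f(x)=\mathbb{E}_\xi[F(x,\xi)]$ is a closed convex function on $\mathbb{R}^n$ having a minimizer ($F(\cdot,\xi)$ itself need not be convex). Almost surely in $\xi$, $F(\cdot,\xi)$ has a gradient $g(x,\xi)$ with $\|g(x,\xi)-g(y,\xi)\|_2\le L(\xi)\|x-y\|_2$ for all $x,y$. The constant $L_2>0$ satisfies $\sqrt{\mathbb{E}_\xi L(\xi)^2}\le L_2$; consequently $\mathbb{E}_\xi g(x,\xi)=\nabla f(x)$ and $\nabla f$ is $L_2$-Lipschitz in $\|\cdot\|_2$. For all $x$, $\mathbb{E}_\xi\|g(x,\xi)-\nabla f(x)\|_2^2\le\sigma^2$. Oracle. Given a pair of points $(x,y)$, an oracle call returns $(\widetilde f(x,\xi),\widetilde f(y,\xi))$ for one sample $\xi\sim P$ (the same for both points), where $\widetilde f(x,\xi)=F(x,\xi)+\eta(x,\xi)$ and $|\eta(x,\xi)|\le\Delta$ for all $x\in\mathbb{R}^n$, a.s. in $\xi$. All functions are measurable, so that expectations make sense. Proximal setup. $\|x\|_p$ is the $\ell_p$ norm, $q\in[2,\infty]$ with $\frac1p+\frac1q=1$. The prox-function $d:\mathbb{R}^n\to\mathbb{R}$ is continuous, differentiable and $1$-strongly convex w.r.t. $\|\cdot\|_p$, i.e. $d(y)-d(x)-\langle\nabla d(x),y-x\rangle\ge\frac12\|y-x\|_p^2$ for all $x,y$, with $\min d=0$. $V[z](x)=d(x)-d(z)-\langle\nabla d(z),x-z\rangle$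 is the Bregman divergence. $\rho_n=\min\{q-1,\,16\ln n-8\}\,n^{2/q-1}$ (for $q=\infty$, $2/q=0$ and $q-1=\infty$). Gradient approximation. For $e$ in the unit Euclidean sphere and samples $\xi_1,\dots,\xi_m$, $\widetilde\nabla^m f^t(x)=\frac1m\sum_{i=1}^m\frac{\widetilde f(x+te,\xi_i)-\widetilde f(x,\xi_i)}{t}\,e$. RDFDS. Input $x_0\in\mathbb{R}^n$, $N,m\ge1$, $t>0$, stepsize $\alpha=\frac{1}{48n\rho_nL_2}$. For $k=0,\dots,N-1$: draw $e_{k+1}$ uniformly from the unit Euclidean sphere of $\mathbb{R}^n$ and $m$ independent copies $\xi_1^{k+1},\dots,\xi_m^{k+1}$ of $\xi$, all independent of each other and of previous iterations; compute $\widetilde\nabla^m f^t(x_k)$ with $e=e_{k+1}$ and $\xi_i=\xi_i^{k+1}$; set $x_{k+1}=\arg\min_{x\in\mathbb{R}^n}\{\alpha n\langle\widetilde\nabla^m f^t(x_k),x-x_k\rangle+V[x_k](x)\}$. Output $\bar x_N=\frac1N\sum_{k=0}^{N-1}x_k$. *)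

(* Defs.v *)
From HB Require Import structures.
From mathcomp Require Export all_boot all_order all_algebra.
From mathcomp Require Export all_classical all_reals all_analysis.
Export Order.TTheory GRing.Theory Num.Theory numFieldNormedType.Exports.

Set Implicit Arguments.
Unset Strict Implicit.
Unset Printing Implicit Defensive.

Local Open Scope classical_set_scope.
Local Open Scope ring_scope.

(* R^n with its Borel sigma-algebra. *)
Notation borel_space R n := (g_sigma_algebraType (@open 'rV[R]_n)).

Section euclidean.
Context {R : realType} {n : nat}.
Implicit Types (u v x y z : 'rV[R]_n) (h d : 'rV[R]_n -> R).

Definition dotp u v : R := \sum_(j < n) u 0 j * v 0 j.

(* Euclidean norm; the library's norm on row vectors is the sup norm, used
   below only through its topology. *)
Definition norm2 u : R := Num.sqrt (dotp u u).

Definition normp (p : R) u : R := (\sum_(j < n) `|u 0 j| `^ p) `^ p^-1.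

Definition grad h x : 'rV[R]_n :=
  \row_(j < n) 'd (h : 'rV[R]_n -> R^o) x (delta_mx 0 j).

Definition has_grad h x v : Prop :=
  differentiable (h : 'rV[R]_n -> R^o) x /\ grad h x = v.

Definition is_minimizer h x : Prop := forall y, h x <= h y.

Definition closed_function h : Prop :=
  closed [set z : 'rV[R]_n * R | h z.1 <= z.2].

Definition prox_function (p : R) d : Prop :=
  [/\ continuous d,
      forall x, differentiable (d : 'rV[R]_n -> R^o) x,
      forall x y,
        normp p (y - x) ^+ 2 / 2 <= d y - d x - dotp (grad d x) (y - x) &
      (exists x, d x = 0) /\ forall x, 0 <= d x].

Definition bregman d z x : R := d x - d z - dotp (grad d z) (x - z).

(* The uniform distribution on the unit Euclidean sphere is the unique Borel
   probability measure carried by the sphere and invariant under all orthogonal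
   transformations. *)
Definition uniform_on_sphere (mu : set (borel_space R n) -> \bar R) : Prop :=
  mu [set v : borel_space R n | norm2 v = 1] = 1%E /\
  forall O : 'M[R]_n, O *m O^T = 1%:M ->
  forall A : set (borel_space R n), measurable A ->
    mu [set v : borel_space R n | A (v *m O)] = mu A.

(* For q = +oo, (q^-1)%E = 0 and q - 1 = +oo. *)
Definition rho (q : \bar R) : R :=
  fine (Order.min (q - 1)%E (16 * ln n%:R - 8)%:E)
  * n%:R `^ (2 * fine (q^-1)%E - 1).

End euclidean.

Arguments rho {R} n q.

Section probability.
Context {R : realType} {d : measure_display} {Omega : measurableType d}.
Variable Pr : probability Omega R.

Definition has_law {d'} {T : measurableType d'} (X : Omega -> T)
    (mu : set T -> \bar R) : Prop :=
  measurable_fun setT X /\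
  forall A, measurable A -> Pr (X @^-1` A) = mu A.

Definition sigma_of {d'} {T : measurableType d'} (X : Omega -> T) :
    set (set Omega) :=
  preimage_set_system setT X measurable.

Definition mutually_independent {I : finType} (S : I -> set (set Omega)) :
    Prop :=
  forall (J : {set I}) (A : I -> set Omega), (forall i, i \in J -> S i (A i)) ->
    Pr (\bigcap_(i in [set` J]) A i) = (\prod_(i in J) Pr (A i))%E.

End probability.

Section rdfds.
Context {R : realType} {n : nat} {X : Type}.

Definition grad_estimate (ftil : 'rV[R]_n -> X -> R) (t : R) (m : nat)
    (e : 'rV[R]_n) (xi : 'I_m -> X) (x : 'rV[R]_n) : 'rV[R]_n :=
  m%:R^-1 *:
    \sum_(i < m) ((ftil (x + t *: e) (xi i) - ftil x (xi i)) / t) *: e.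

(* x is a sequence of RDFDS iterates, x 0, ..., x N, for the given draws;
   e k and xi k are the direction and the samples used at step k (indexed k+1
   in the usual presentation of the method). *)
Definition rdfds_run (ftil : 'rV[R]_n -> X -> R) (d : 'rV[R]_n -> R)
    (t alpha : R) (x0 : 'rV[R]_n) (N m : nat)
    (e : 'I_N -> 'rV[R]_n) (xi : 'I_N -> 'I_m -> X) (x : nat -> 'rV[R]_n) :
    Prop :=
  x 0%N = x0 /\
  forall k : 'I_N,
    is_minimizer
      (fun y => alpha * n%:R
                  * dotp (grad_estimate ftil t (e k) (xi k) (x k)) (y - x k)
                + bregman d (x k) y)
      (x k.+1).

End rdfds.

(* Main.v *)
From HB Require Import structures.
Require Import Defs.
From mathcomp Require Import all_boot all_order all_algebra.
From mathcomp Require Import all_classical all_reals all_analysis.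
From mathcomp Require Import perm measurable_realfun.
From mathcomp Require Import ring lra.

(** Let x_opt be the minimizer. One iteration is a mirror descent step along G
    = c e, where e is the random direction and c is the average of the finite
    difference quotients. Strong convexity of the prox-function d gives, with a
    the step size alpha n,
      V[x'](x_opt) + a c <e, x - x_opt> <= V[x](x_opt) + a^2 c^2 |e|_q^2 / 2
    ([mirror_step_bound]; the iterate is [mirror d (grad d x - a G)], a
    Lipschitz function of its argument, which makes it measurable).

    Sphere. The squared dual norm |e|_q^2 is replaced by a polynomial K(e) = A
    + B sum_j e_j^(2k) which dominates it everywhere and whose mean is at most
    3 rho ([dual_norm_poly_bound]): 2k is just above q when q - 1 is below 16
    ln n - 8, and close to 2 ln n otherwise. As K is a polynomial invariant
    under sign changes and permutations of the coordinates, all the moments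
    needed follow from the invariance of the law of e under reflections: E <u,
    e> <v, e> K(e) = <u, v> E K(e) / n ([sphere_bilinear]), and E e_j^(2k) <=
    ((2k-1)/n)^k ([sphere_moment_le]).

    One step from a fixed point x. Write c = <grad f(x), e> + H + b, where H is
    the average noise of the sample gradients along e, centred and of variance
    at most sigma^2 / (n m), and b is the error of the finite differences,
    whose square has mean at most B = L2^2 t^2 / 2 + 8 Delta^2 / t^2. Use c^2
    <= 4 <grad f(x), e>^2 + 4 H^2 + 2 b^2; on the left the term in H vanishes
    in the mean, and the term in b is bounded by Young's inequality with a
    weight lam. As |grad f(x)|^2 <= 2 L2 (f(x) - f(x_opt)) <= 2 L2 <grad f(x),
    x - x_opt>, the choice of alpha leaves three quarters of the decrease
    ([step_decrease]):
      E V[x'](x_opt) + (3/4) alpha (f(x) - f(x_opt)) <= (1 + lam) V[x](x_opt) + C.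

    The run. The iterate x_k depends on the draws before step k, which are
    independent of those of step k; integrating the inequality for a fixed x
    over the law of x_k therefore gives the same inequality between
    expectations ([mean_fresh]). Summing over k with lam = 1/(2N), for which (1
    + lam)^N <= 2, bounds the average of E f(x_k) - f(x_opt), hence E f(xbar) -
    f(x_opt) by convexity ([expected_gap]). What comes out is at most the first
    three terms of the claimed bound, and the fourth is nonnegative. *)

Set Implicit Arguments.
Unset Strict Implicit.
Unset Printing Implicit Defensive.

Local Open Scope classical_set_scope.
Local Open Scope ring_scope.

Lemma eq_ler (R : numDomainType) (x y : R) : x = y -> x <= y.
Proof. by move=> ->. Qed.

(** * The Euclidean pairing and the l_p norms *)

Lemma dotpE (R : realType) n (u v : 'rV[R]_n) :
  dotp u v = \sum_(j < n) u 0 j * v 0 j.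
Proof. by []. Qed.

Lemma norm2E (R : realType) n (u : 'rV[R]_n) : norm2 u = Num.sqrt (dotp u u).
Proof. by []. Qed.

Lemma normpE (R : realType) n p (u : 'rV[R]_n) :
  normp p u = (\sum_(j < n) `|u 0 j| `^ p) `^ p^-1.
Proof. by []. Qed.

(* Conversion between two distinct norms must not unfold real powers down to
   the exponential series. *)
Opaque dotp norm2 normp.

Section dotp_theory.
Context {R : realType} {n : nat}.
Implicit Types (u v w : 'rV[R]_n) (a : R).

Lemma dotpC u v : dotp u v = dotp v u.
Proof. by rewrite !dotpE; apply: eq_bigr => j _; rewrite mulrC. Qed.

Lemma dotpDl u v w : dotp (u + v) w = dotp u w + dotp v w.
Proof. by rewrite !dotpE -big_split; apply: eq_bigr => j _; rewrite mxE mulrDl. Qed.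

Lemma dotpDr u v w : dotp w (u + v) = dotp w u + dotp w v.
Proof. by rewrite dotpC dotpDl !(dotpC _ w). Qed.

Lemma dotpZl a u v : dotp (a *: u) v = a * dotp u v.
Proof. by rewrite !dotpE mulr_sumr; apply: eq_bigr => j _; rewrite mxE mulrA. Qed.

Lemma dotpZr a u v : dotp u (a *: v) = a * dotp u v.
Proof. by rewrite dotpC dotpZl dotpC. Qed.

Lemma dotpNl u v : dotp (- u) v = - dotp u v.
Proof. by rewrite -scaleN1r dotpZl mulN1r. Qed.

Lemma dotpNr u v : dotp u (- v) = - dotp u v.
Proof. by rewrite dotpC dotpNl dotpC. Qed.

Lemma dotpBl u v w : dotp (u - v) w = dotp u w - dotp v w.
Proof. by rewrite dotpDl dotpNl. Qed.

Lemma dotpBr u v w : dotp w (u - v) = dotp w u - dotp w v.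
Proof. by rewrite dotpDr dotpNr. Qed.

Lemma dotp_suml (I : Type) (r : seq I) (h : I -> 'rV[R]_n) v :
  dotp (\sum_(i <- r) h i) v = \sum_(i <- r) dotp (h i) v.
Proof.
elim: r => [|i r ih]; last by rewrite !big_cons dotpDl ih.
by rewrite !big_nil dotpE big1// => j _; rewrite mxE mul0r.
Qed.

Lemma dotp0l v : dotp 0 v = 0.
Proof. by rewrite -(scale0r 0) dotpZl mul0r. Qed.

Lemma dotp0r v : dotp v 0 = 0.
Proof. by rewrite dotpC dotp0l. Qed.

Lemma dotp_ge0 u : 0 <= dotp u u.
Proof. by rewrite dotpE; apply: sumr_ge0 => j _; rewrite -expr2 sqr_ge0. Qed.

Lemma dotp_eq0 u : dotp u u = 0 -> u = 0.
Proof.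
move=> /eqP; rewrite dotpE psumr_eq0; last by move=> j _; rewrite -expr2 sqr_ge0.
move=> /allP u0; apply/rowP => j; rewrite mxE; apply/eqP.
by have := u0 j (mem_index_enum _); rewrite -expr2 sqrf_eq0.
Qed.

Lemma norm2_ge0 u : 0 <= norm2 u.
Proof. by rewrite norm2E sqrtr_ge0. Qed.

Lemma norm2_sqr u : norm2 u ^+ 2 = dotp u u.
Proof. by rewrite norm2E sqr_sqrtr// dotp_ge0. Qed.

Lemma norm2Z a u : norm2 (a *: u) = `|a| * norm2 u.
Proof.
by rewrite norm2E dotpZl dotpZr mulrA -expr2 sqrtrM ?sqr_ge0// sqrtr_sqr.
Qed.

Lemma sqr_dotp_le u v : dotp u v ^+ 2 <= dotp u u * dotp v v.
Proof.
have [v0|v0] := eqVneq (dotp v v) 0.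
  by rewrite (dotp_eq0 v0) !dotp0r expr0n mulr0.
have vp : 0 < dotp v v by rewrite lt_neqAle eq_sym v0 dotp_ge0.
have := dotp_ge0 (dotp v v *: u - dotp u v *: v).
have -> : dotp (dotp v v *: u - dotp u v *: v) (dotp v v *: u - dotp u v *: v)
  = dotp v v * (dotp u u * dotp v v - dotp u v ^+ 2).
  by rewrite !(dotpBl, dotpBr, dotpZl, dotpZr) (dotpC v u); ring.
by rewrite pmulr_rge0// subr_ge0.
Qed.

Lemma normr_dotp_le u v : `|dotp u v| <= norm2 u * norm2 v.
Proof.
rewrite -(@ler_pXn2r _ 2) ?nnegrE ?mulr_ge0 ?norm2_ge0//.
by rewrite exprMn !norm2_sqr real_normK ?num_real// sqr_dotp_le.
Qed.

Lemma sqr_coord_le u j : u 0 j ^+ 2 <= dotp u u.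
Proof.
rewrite dotpE (bigD1 j)//= -expr2 lerDl sumr_ge0// => i _.
by rewrite -expr2 sqr_ge0.
Qed.

Lemma dotp_delta u j : dotp u (delta_mx 0 j) = u 0 j.
Proof.
rewrite dotpE (bigD1 j)//= mxE !eqxx mulr1 big1 ?addr0// => i ij.
by rewrite mxE eqxx (negbTE ij) mulr0.
Qed.

Lemma dotpP u v : (forall w, dotp u w = dotp v w) -> u = v.
Proof. by move=> uv; apply/rowP => j; rewrite -!dotp_delta uv. Qed.

End dotp_theory.

Section normp_theory.
Context {R : realType} {n : nat}.
Implicit Types (u v w : 'rV[R]_n) (p q r : R).

Lemma normp_ge0 p u : 0 <= normp p u. Proof. by rewrite normpE powR_ge0. Qed.

Lemma sum_normp_ge0 p u : 0 <= \sum_(j < n) `|u 0 j| `^ p.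
Proof. by apply: sumr_ge0 => j _; exact: powR_ge0. Qed.

Lemma normp_powR p u : p != 0 ->
  normp p u `^ p = \sum_(j < n) `|u 0 j| `^ p.
Proof.
by move=> p0; rewrite normpE -powRrM mulVf// powRr1// sum_normp_ge0.
Qed.

Lemma normp_eq0 p u : 0 < p -> normp p u = 0 -> u = 0.
Proof.
move=> p0 u0; have : \sum_(j < n) `|u 0 j| `^ p = 0.
  by rewrite -normp_powR ?gt_eqF// u0 powR0// gt_eqF.
move=> /eqP; rewrite psumr_eq0; last by move=> j _; exact: powR_ge0.
move=> /allP h; apply/rowP => j; rewrite mxE; apply/eqP.
have := h j (mem_index_enum _).
by rewrite powR_eq0 normr_eq0 => /andP[].
Qed.

Lemma sum_powR_div p u (c : R) : 0 < c ->
  \sum_(j < n) (`|u 0 j| / c) `^ p = (\sum_(j < n) `|u 0 j| `^ p) / c `^ p.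
Proof.
move=> c0; rewrite mulr_suml; apply: eq_bigr => j _.
rewrite powRM ?normr_ge0 ?invr_ge0 ?(ltW c0)//.
by rewrite -[in LHS]powR_inv1 ?(ltW c0)// -powRrM mulN1r powRN.
Qed.

Lemma sum_powR_normalized p u : 0 < p -> 0 < normp p u ->
  \sum_(j < n) (`|u 0 j| / normp p u) `^ p = 1.
Proof.
move=> p0 u0; rewrite sum_powR_div// normp_powR ?gt_eqF// divff//.
by rewrite -normp_powR ?gt_eqF// powR_gt0.
Qed.

Lemma dotp_le_scaled p q u w (U W : R) : 0 < p -> 0 < q ->
  p^-1 + q^-1 = 1 -> 0 < U -> 0 < W ->
  \sum_(j < n) (`|u 0 j| / U) `^ q = 1 ->
  \sum_(j < n) (`|w 0 j| / W) `^ p = 1 -> dotp u w <= U * W.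
Proof.
move=> p0 q0 pq U0 W0 sumu sumw.
have UW0 : 0 < U * W by exact: mulr_gt0.
rewrite -[leRHS]mulr1 -ler_pdivrMl// dotpE mulr_sumr.
have qp : q^-1 + p^-1 = 1 by rewrite addrC.
apply: (@le_trans _ _ (\sum_(j < n) ((`|u 0 j| / U) `^ q / q
                                   + (`|w 0 j| / W) `^ p / p))).
  apply: ler_sum => j _.
  apply: le_trans (conjugate_powR (divr_ge0 _ (ltW U0)) (divr_ge0 _ (ltW W0)) q0 p0 qp) => //.
  apply: (le_trans (ler_norm _)); rewrite !normrM.
  rewrite (ger0_norm (_ : 0 <= (U * W)^-1)); last by rewrite invr_ge0 ltW.
  by apply: eq_ler; field; rewrite !gt_eqF.
by rewrite big_split/= -!mulr_suml sumu sumw !mul1r addrC pq.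
Qed.

(** Hoelder's inequality for finite sums. *)
Lemma dotp_le_normp p q u w : 0 < p -> 0 < q -> p^-1 + q^-1 = 1 ->
  dotp u w <= normp q u * normp p w.
Proof.
move=> p0 q0 pq.
have [u0|u0] := eqVneq (normp q u) 0.
  by rewrite (normp_eq0 q0 u0) dotp0l mulr_ge0 ?normp_ge0.
have [w0|w0] := eqVneq (normp p w) 0.
  by rewrite (normp_eq0 p0 w0) dotp0r mulr_ge0 ?normp_ge0.
have {}u0 : 0 < normp q u by rewrite lt_neqAle eq_sym u0 normp_ge0.
have {}w0 : 0 < normp p w by rewrite lt_neqAle eq_sym w0 normp_ge0.
exact: (dotp_le_scaled p0 q0 pq u0 w0 (sum_powR_normalized q0 u0)
  (sum_powR_normalized p0 w0)).
Qed.

Lemma normr_coord_le_normp p u j : 0 < p -> `|u 0 j| <= normp p u.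
Proof.
move=> p0; rewrite normpE -[leLHS]powRr1// -(mulfV (lt0r_neq0 p0)) powRrM.
apply: ge0_ler_powR; rewrite ?nnegrE ?powR_ge0 ?sum_normp_ge0 ?invr_ge0//.
  exact: ltW.
by rewrite (bigD1 j)//= lerDl sumr_ge0// => i _; exact: powR_ge0.
Qed.

Lemma le_normp_of_sum_powR p u (c : R) : 0 < p -> 0 < c ->
  \sum_(j < n) (`|u 0 j| / c) `^ p <= 1 -> normp p u <= c.
Proof.
move=> p0 c0; rewrite sum_powR_div// ler_pdivrMr ?powR_gt0// mul1r normpE => h.
have -> : c = c `^ p `^ p^-1 by rewrite -powRrM mulfV ?gt_eqF// powRr1// ltW.
apply: ge0_ler_powR; rewrite ?nnegrE ?powR_ge0 ?sum_normp_ge0 ?invr_ge0//.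
exact: ltW.
Qed.

Lemma normp_nonincr p r u : 0 < p -> p <= r -> normp r u <= normp p u.
Proof.
move=> p0 pr; have r0 : 0 < r := lt_le_trans p0 pr.
have [u0|u0] := eqVneq (normp p u) 0.
  rewrite (normp_eq0 p0 u0) normpE.
  under eq_bigr do rewrite mxE normr0 powR0 ?gt_eqF//.
  by rewrite big1// powR0 ?invr_eq0 ?gt_eqF// normp_ge0.
have {}u0 : 0 < normp p u by rewrite lt_neqAle eq_sym u0 normp_ge0.
apply: le_normp_of_sum_powR => //.
rewrite -(sum_powR_normalized p0 u0); apply: ler_sum => j _.
have h1 : `|u 0 j| / normp p u <= 1.
  by rewrite ler_pdivrMr// mul1r normr_coord_le_normp.
have h0 : 0 <= `|u 0 j| / normp p u by rewrite divr_ge0// ltW.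
move: h0; rewrite le_eqVlt => /predU1P[<-|h0]; first by rewrite !powR0 ?gt_eqF.
by apply: ger_powR => //; rewrite h0.
Qed.

Lemma normp_le_card q r u : 0 < q -> q <= r ->
  normp q u <= n%:R `^ (q^-1 - r^-1) * normp r u.
Proof.
move=> q0 qr; have r0 : 0 < r := lt_le_trans q0 qr.
have [u0|u0] := eqVneq (normp r u) 0.
  rewrite (normp_eq0 r0 u0) {1}normpE.
  under eq_bigr do rewrite mxE normr0 powR0 ?gt_eqF//.
  by rewrite big1// powR0 ?invr_eq0 ?gt_eqF// mulr_ge0 ?powR_ge0.
have {}u0 : 0 < normp r u by rewrite lt_neqAle eq_sym u0 normp_ge0.
have n0 : 0 < n%:R :> R.
  rewrite ltr0n lt0n; apply: contraTneq u0 => n0.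
  rewrite -leNgt normpE big1 ?powR0 ?invr_eq0 ?gt_eqF// => j _.
  by have := leq_ltn_trans (leq0n j) (ltn_ord j); rewrite [X in (_ < X)%N]n0.
have cE : n%:R `^ (r^-1) `^ r = n%:R :> R.
  by rewrite -powRrM mulVf ?gt_eqF// powRr1 ?ltW.
set c := n%:R `^ r^-1 in cE.
have c0 : 0 < c by rewrite powR_gt0.
pose a j := `|u 0 j| / (normp r u / c).
have uc0 : 0 < normp r u / c by rewrite divr_gt0.
have sumr : \sum_(j < n) a j `^ r = n%:R.
  rewrite sum_powR_div// powRM ?invr_ge0 ?normp_ge0 ?(ltW c0)//.
  rewrite normp_powR ?gt_eqF// -(@powR_inv1 _ c) ?(ltW c0)// -powRrM mulN1r powRN cE.
  rewrite invfM mulrA divff ?mul1r ?invrK//.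
  by rewrite -normp_powR ?gt_eqF// powR_gt0.
(* Young's inequality a^q * 1 <= (q/r) a^r + (1 - q/r), summed over j. *)
have aq j : a j `^ q <= q / r * a j `^ r + (1 - q / r).
  move: qr; rewrite le_eqVlt => /predU1P[<-|qr].
    by rewrite divff ?gt_eqF// mul1r subrr addr0.
  have qr1 : q / r < 1 by rewrite ltr_pdivrMr// mul1r.
  have := @conjugate_powR _ (a j `^ q) 1 (r / q) (1 - q / r)^-1 (powR_ge0 _ _) ler01.
  rewrite divr_gt0// invr_gt0 subr_gt0 qr1 => /(_ isT isT).
  rewrite invf_div invrK addrC subrK => /(_ erefl).
  rewrite mulr1 powR1 mul1r -powRrM (_ : q * (r / q) = r); last first.
    by rewrite mulrC divfK ?gt_eqF.
  by move=> h; rewrite mulrC.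
have : \sum_(j < n) a j `^ q <= n%:R.
  apply: le_trans (ler_sum _ (fun j _ => aq j)) _.
  rewrite big_split/= -mulr_sumr sumr sumr_const card_ord -mulr_natl.
  by apply: eq_ler; ring.
rewrite sum_powR_div// ler_pdivrMr ?powR_gt0// => h.
have -> : n%:R `^ (q^-1 - r^-1) * normp r u =
    (n%:R * (normp r u / c) `^ q) `^ q^-1.
  rewrite powRM ?powR_ge0 ?(ltW n0)// -powRrM mulfV ?gt_eqF//.
  rewrite powRr1 ?(ltW uc0)// powRD; last by rewrite (gt_eqF n0) implybT.
  by rewrite powRN -/c; ring.
rewrite [leLHS]normpE; apply: ge0_ler_powR => //.
- by rewrite invr_ge0 ltW.
- by rewrite nnegrE sum_normp_ge0.
- by rewrite nnegrE mulr_ge0 ?powR_ge0// ltW.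
Qed.

Lemma normp2 u : normp 2 u = norm2 u.
Proof.
rewrite normpE powR12_sqrt ?sum_normp_ge0// norm2E; congr Num.sqrt.
apply: eq_bigr => j _; rewrite powR_mulrn// real_normK ?num_real//.
Qed.

Lemma norm2_le_normp p u : 1 <= p <= 2 -> norm2 u <= normp p u.
Proof.
move=> /andP[p1 p2]; rewrite -normp2 normp_nonincr//.
exact: lt_le_trans p1.
Qed.

Lemma normpN p u : normp p (- u) = normp p u.
Proof. by rewrite normpE; under eq_bigr do rewrite mxE normrN. Qed.

End normp_theory.

(** * A polynomial bound for the dual norm *)

Lemma bernoulli (R : realDomainType) (v : R) (k : nat) : 0 <= v ->
  1 + k%:R * (v - 1) <= v ^+ k.
Proof.
move=> v0; elim: k => [|k ih]; first by rewrite mul0r addr0 expr0.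
rewrite exprS; apply: le_trans (ler_wpM2l v0 ih); rewrite -subr_ge0.
have -> : v * (1 + k%:R * (v - 1)) - (1 + k.+1%:R * (v - 1)) =
   k%:R * (v - 1) ^+ 2 by rewrite -natr1; ring.
by rewrite mulr_ge0// sqr_ge0.
Qed.

(** The concave function y^(1/k) lies below its tangent at s^k. *)
Lemma powR_inv_le_tangent (R : realType) (k : nat) (s y : R) : (0 < k)%N ->
  0 < s -> 0 <= y -> y `^ k%:R^-1 <= s * (1 + (y / s ^+ k - 1) / k%:R).
Proof.
move=> k0 s0 y0; have kR : 0 < k%:R :> R by rewrite ltr0n.
rewrite -ler_pdivrMl// [_ * (y `^ _)]mulrC.
have v0 : 0 <= y `^ k%:R^-1 / s by rewrite divr_ge0 ?powR_ge0// ltW.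
have := bernoulli k v0.
rewrite exprMn exprVn -[(y `^ _) ^+ k]powR_mulrn ?powR_ge0// -powRrM.
rewrite mulVf ?gt_eqF// powRr1//.
set v := _ / s => h; rewrite -lerBlDl ler_pdivlMr// lerBrDl mulrC.
exact: h.
Qed.

Lemma sqr_normp_even (R : realType) n (k : nat) (u : 'rV[R]_n) : (0 < k)%N ->
  normp (2 * k)%:R u ^+ 2 = (\sum_(j < n) u 0 j ^+ (2 * k)) `^ k%:R^-1.
Proof.
move=> k0; rewrite normpE -powR_mulrn ?powR_ge0// -powRrM natrM invfM.
rewrite -mulrA mulrCA mulVf// mulr1; congr (_ `^ _); apply: eq_bigr => j _.
by rewrite -natrM powR_mulrn// exprM real_normK ?num_real// -exprM.
Qed.

Lemma dual_bound_of_hoelder (R : realType) (n k : nat) (p C s : R) :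
  (0 < k)%N -> (0 < n)%N -> 0 <= C -> 0 < s ->
  (forall u w : 'rV[R]_n,
     dotp u w <= C * normp (2 * k)%:R u * normp p w) ->
  exists A B : R, [/\ 0 <= A, 0 <= B,
    forall u w : 'rV[R]_n, dotp u w ^+ 2 <=
      (A + B * \sum_(j < n) u 0 j ^+ (2 * k)) * normp p w ^+ 2 &
    A + B * (n%:R * s ^+ k) = C ^+ 2 * n%:R `^ k%:R^-1 * s].
Proof.
move=> k0 n0 C0 s0 H; pose D := C ^+ 2 * n%:R `^ k%:R^-1.
have D0 : 0 <= D by rewrite mulr_ge0 ?sqr_ge0 ?powR_ge0.
have kR : 0 < k%:R :> R by rewrite ltr0n.
have nR : 0 < n%:R :> R by rewrite ltr0n.
have sk : 0 < s ^+ k by rewrite exprn_gt0.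
exists (D * s * (1 - k%:R^-1)), (D * s / (k%:R * n%:R * s ^+ k)); split.
- rewrite mulr_ge0 ?mulr_ge0 ?(ltW s0)// subr_ge0 invf_le1 ?ler1n//.
- by rewrite divr_ge0 ?mulr_ge0 ?(ltW s0) ?(ltW sk).
- have key (dp U W S : R) : 0 <= U -> 0 <= W -> 0 <= S ->
      `|dp| <= C * U * W -> U ^+ 2 = S `^ k%:R^-1 ->
      dp ^+ 2 <= (D * s * (1 - k%:R^-1) + D * s / (k%:R * n%:R * s ^+ k) * S)
        * W ^+ 2.
    move=> U0 W0 S0 dpU US.
    apply: (@le_trans _ _ ((C * U * W) ^+ 2)).
      rewrite -(@real_normK _ dp) ?num_real//.
      by rewrite lerXn2r ?nnegrE ?mulr_ge0.
    rewrite !exprMn US; apply: ler_wpM2r; first exact: sqr_ge0.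
    have -> : S `^ k%:R^-1 = n%:R `^ k%:R^-1 * (S / n%:R) `^ k%:R^-1.
      by rewrite -powRM ?divr_ge0// [n%:R * _]mulrC divfK ?gt_eqF.
    rewrite mulrA -/D.
    apply: le_trans (ler_wpM2l D0 (powR_inv_le_tangent k0 s0 _)) _.
      by rewrite divr_ge0.
    by apply: eq_ler; field; rewrite !gt_eqF.
  move=> u w; apply: (key _ _ _ _ (normp_ge0 _ _) (normp_ge0 _ _) _ _
      (sqr_normp_even u k0)).
    by apply: sumr_ge0 => j _; rewrite exprM exprn_ge0 ?sqr_ge0.
  by rewrite ler_norml H andbT lerNl -dotpNr -(normpN p w) H.
- by rewrite -/D; field; rewrite !gt_eqF.
Qed.

Lemma expR_half_le2 (R : realType) : expR (2^-1 : R) <= 2.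
Proof.
have := @expR_ge1Dx R (- 2^-1); rewrite expRN => h.
rewrite -[leRHS]invrK -lef_pV2 ?posrE ?expR_gt0 ?invr_gt0// invrK.
by apply: le_trans h; lra.
Qed.

Lemma ln8_ge1 (R : realType) : 1 <= ln (8 : R).
Proof.
rewrite -[leLHS]expRK ler_ln ?posrE ?expR_gt0//.
have -> : (1 : R) = 2^-1 + 2^-1 by lra.
rewrite expRD; have := expR_half_le2 R; have := expR_ge0 (2^-1 : R); nra.
Qed.

Lemma sqr_powR (R : realType) (a b : R) : 0 < a -> (a `^ b) ^+ 2 = a `^ (b + b).
Proof. by move=> a0; rewrite powRD ?expr2// (gt_eqF a0) implybT. Qed.

Lemma invr_double_lt1 (R : realFieldType) (k : nat) : (0 < k)%N ->
  (2 * k)%:R^-1 < 1 :> R.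
Proof.
by case: k => // k _; rewrite invf_lt1 ?ltr0n// ltr1n mul2n doubleS.
Qed.

Section dual_norm_poly_bound.
Context {R : realType} {n : nat} (n8 : (8 <= n)%N).
Let n0 : (0 < n)%N. Proof. exact: leq_trans n8. Qed.
Let nR : 0 < n%:R :> R. Proof. by rewrite ltr0n. Qed.

Let ln_ge1 : 1 <= ln (n%:R : R).
Proof.
apply: le_trans (ln8_ge1 R) _; rewrite ler_ln ?posrE//.
by rewrite (ler_nat _ 8).
Qed.

(* For moderate q the exponent 2k is taken just above q. *)
Let dual_norm_small_q (p r : R) : 1 <= p -> 2 <= r -> p^-1 + r^-1 = 1 ->
  exists (k : nat) (A B : R), [/\ (0 < k)%N, 0 <= A, 0 <= B,
    forall u w : 'rV[R]_n, dotp u w ^+ 2 <=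
      (A + B * \sum_(j < n) u 0 j ^+ (2 * k)) * normp p w ^+ 2 &
    A + B * (n%:R * ((2 * k).-1%:R / n%:R) ^+ k)
      <= 3 * ((r - 1) * n%:R `^ (2 * r^-1 - 1))].
Proof.
move=> p1 r2 pr; have r0 : 0 < r by lra.
have p0 : 0 < p by lra.
have r20 : 0 <= r / 2 by lra.
have := truncn_itv r20; move: (Num.truncn _) => k0 /andP[kl ku].
pose k := k0.+1; rewrite -/k in ku.
have kE : k%:R = k0%:R + 1 :> R by rewrite /k -natr1.
have k2E : (2 * k)%:R = 2 * k%:R :> R by rewrite natrM.
have k21 : (2 * k).-1%:R = 2 * k%:R - 1 :> R.
  by rewrite -k2E -subn1 natrB.
have kR : 0 < k%:R :> R by rewrite ltr0n.
pose C : R := n%:R `^ (r^-1 - (2 * k)%:R^-1).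
have s0 : 0 < (2 * k).-1%:R / n%:R :> R by rewrite divr_gt0// k21; lra.
have HC (u w : 'rV[R]_n) : dotp u w <= C * normp (2 * k)%:R u * normp p w :> R.
  apply: le_trans (dotp_le_normp u w p0 r0 pr) _.
  rewrite ler_wpM2r ?normp_ge0// normp_le_card// k2E; lra.
have [A [B [A0 B0 H E]]] :=
  dual_bound_of_hoelder (isT : (0 < k)%N) n0 (powR_ge0 _ _) s0 HC.
exists k, A, B; split => //; rewrite E.
have -> : C ^+ 2 * n%:R `^ k%:R^-1 = n%:R `^ (2 * r^-1).
  rewrite sqr_powR// -powRD; last by rewrite (gt_eqF nR) implybT.
  by congr (_ `^ _); rewrite k2E; field; rewrite !gt_eqF.
rewrite powRB; last by rewrite (gt_eqF nR) implybT.
rewrite powRr1 ?(ltW nR)// k21.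
have c0 : 0 <= n%:R `^ (2 * r^-1) / n%:R :> R by rewrite divr_ge0 ?powR_ge0.
suff : (2 * k%:R - 1) * (n%:R `^ (2 * r^-1) / n%:R)
     <= 3 * (r - 1) * (n%:R `^ (2 * r^-1) / n%:R) :> R.
  by move=> h; apply: le_trans (le_trans h _); apply: eq_ler; ring.
by rewrite ler_wpM2r//; lra.
Qed.

(* For large q an exponent 2k of order ln n suffices, as n^(1/k) is bounded. *)
Let dual_norm_large_q (p c : R) : 1 <= p -> 0 <= c ->
  (forall k : nat, (0 < k)%N -> (2 * k)%:R <= 16 * ln n%:R - 7 :> R ->
    p <= (1 - (2 * k)%:R^-1)^-1) ->
  exists (k : nat) (A B : R), [/\ (0 < k)%N, 0 <= A, 0 <= B,
    forall u w : 'rV[R]_n, dotp u w ^+ 2 <=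
      (A + B * \sum_(j < n) u 0 j ^+ (2 * k)) * normp p w ^+ 2 &
    A + B * (n%:R * ((2 * k).-1%:R / n%:R) ^+ k)
      <= 3 * ((16 * ln n%:R - 8) * n%:R `^ (c - 1))].
Proof.
move=> p1 c0 pk; have p0 : 0 < p by lra.
have l0 := ln_ge1; set l := ln _ in l0 pk *.
have l20 : 0 <= 2 * l by lra.
have := truncn_itv l20; move: (Num.truncn _) => k0 /andP[kl ku].
pose k := k0.+1; rewrite -/k in ku.
have kE : k%:R = k0%:R + 1 :> R by rewrite /k -natr1.
have k2E : (2 * k)%:R = 2 * k%:R :> R by rewrite natrM.
have k21 : (2 * k).-1%:R = 2 * k%:R - 1 :> R.
  by rewrite -k2E -subn1 natrB.
have kR : 0 < k%:R :> R by rewrite ltr0n.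
have s0 : 0 < (2 * k).-1%:R / n%:R :> R by rewrite divr_gt0// k21; lra.
have kl2 : (2 * k)%:R <= 16 * l - 7 :> R by lra.
have HC (u w : 'rV[R]_n) : dotp u w <= 1 * normp (2 * k)%:R u * normp p w :> R.
  rewrite mul1r.
  have k1 : (2 * k)%:R^-1 < 1 :> R by exact: invr_double_lt1.
  apply: le_trans (dotp_le_normp u w (p := (1 - (2 * k)%:R^-1)^-1)
    (q := (2 * k)%:R) _ _ _) _.
  - by rewrite invr_gt0 subr_gt0.
  - by rewrite k2E; lra.
  - by rewrite invrK subrK.
  - apply: ler_wpM2l; first exact: normp_ge0.
    by apply: normp_nonincr => //; exact: pk.
have [A [B [A0 B0 H E]]] :=
  @dual_bound_of_hoelder R n k p 1 _ isT n0 ler01 s0 HC.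
exists k, A, B; split => //; rewrite E expr1n mul1r.
have h1 : n%:R `^ k%:R^-1 <= 2 :> R.
  apply: le_trans (expR_half_le2 R).
  rewrite -[n%:R in leLHS]lnK ?posrE// -/l -expRM ler_expR.
  by rewrite ler_pdivrMr//; lra.
have h2 : n%:R^-1 <= n%:R `^ (c - 1) :> R.
  rewrite -powR_inv1 ?(ltW nR)//; apply: ler_powR; last by lra.
  by rewrite (ler_nat _ 1).
rewrite k21 !mulrA.
apply: (@le_trans _ _ (3 * (16 * l - 8) * n%:R^-1)).
  rewrite ler_wpM2r ?invr_ge0 ?(ltW nR)//.
  apply: (@le_trans _ _ (2 * (2 * k%:R - 1))); last by lra.
  by rewrite ler_wpM2r//; lra.
by apply: ler_wpM2l => //; lra.
Qed.

(** The squared dual norm of u is at most the polynomial A + B * sum_j u_j^(2k),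
    for some exponent 2k and some coefficients A, B; replacing each u_j^(2k) by
    the bound ((2k-1)/n)^k for the moments of the sphere gives at most 3 rho. *)
Lemma dual_norm_poly_bound (p : R) (q : \bar R) :
  1 <= p <= 2 -> (2%:E <= q)%E -> ((p%:E)^-1 + q^-1 = 1)%E ->
  exists (k : nat) (A B : R), [/\ (0 < k)%N, 0 <= A, 0 <= B,
    forall u w : 'rV[R]_n, dotp u w ^+ 2 <=
      (A + B * \sum_(j < n) u 0 j ^+ (2 * k)) * normp p w ^+ 2 &
    A + B * (n%:R * ((2 * k).-1%:R / n%:R) ^+ k) <= 3 * rho n q].
Proof.
move=> /andP[p1 p2] q2; have p0 : p != 0 by rewrite gt_eqF//; lra.
rewrite inver (negbTE p0); case: q q2 => [r|_|//].
- rewrite lee_fin => r2; have r0 : r != 0 by rewrite gt_eqF//; lra.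
  rewrite inver (negbTE r0) -EFinD => -[pr].
  rewrite /rho inver (negbTE r0)/= -EFinB -EFin_min/=.
  have [rl|rl] := lerP (r - 1) (16 * ln n%:R - 8).
    exact: dual_norm_small_q.
  apply: dual_norm_large_q => //; first by rewrite mulr_ge0// invr_ge0; lra.
  move=> k k0 kr; have pE : p = (1 - r^-1)^-1 by rewrite -pr addrK invrK.
  have k2 : 0 < (2 * k)%:R :> R by rewrite ltr0n muln_gt0.
  have r1 : r^-1 < 1 by rewrite invf_lt1; lra.
  have k1 := invr_double_lt1 R k0.
  rewrite pE lef_pV2 ?posrE ?subr_gt0// lerD2l lerN2 lef_pV2 ?posrE//; lra.
- rewrite invey adde0 => -[pr]; have {}pr : p = 1 by rewrite -[p]invrK pr invr1.
  rewrite /rho invey (_ : +oo - 1 = +oo)%E// min_r ?leey//= mulr0.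
  apply: dual_norm_large_q => // k k0 _; rewrite pr.
  have k1 := invr_double_lt1 R k0.
  rewrite invf_ge1 ?subr_gt0// gerBl invr_ge0//.
Qed.

Lemma rho_gt0 (q : \bar R) : (2%:E <= q)%E -> 0 < rho n q.
Proof.
move=> q2; rewrite /rho mulr_gt0 ?powR_gt0//; have l1 := ln_ge1.
case: q q2 => [r| |//]; last by rewrite (_ : +oo - 1 = +oo)%E// min_r ?leey//=; lra.
rewrite lee_fin => r2; rewrite -EFinB -EFin_min/= lt_min; apply/andP; lra.
Qed.

End dual_norm_poly_bound.

(** * Differentiable functions on R^n *)

Section gradient.
Context {R : realType} {n : nat}.
Implicit Types (h : 'rV[R]_n -> R) (x y v : 'rV[R]_n).

Lemma diff_gradE h x v : differentiable (h : 'rV[R]_n -> R^o) x ->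
  'd (h : 'rV[R]_n -> R^o) x v = dotp (grad h x) v.
Proof.
move=> dh; rewrite {1}[v]row_sum_delta linear_sum dotpE; apply: eq_bigr => j _.
by rewrite linearZ mxE mulrC.
Qed.

Lemma is_derive_line h x v (s : R) :
  differentiable (h : 'rV[R]_n -> R^o) (x + s *: v) ->
  is_derive s 1 (fun r => h (x + r *: v) : R^o) (dotp (grad h (x + s *: v)) v).
Proof.
move=> dh; pose k := fun r => h (x + r *: v) : R^o.
have E : (fun r : R => r^-1 *: ((k \o shift s) (r *: 1) - k s)) =
    (fun r => r^-1 *: (((h : _ -> R^o) \o shift (x + s *: v)) (r *: v)
      - h (x + s *: v))).
  apply/funext => r; rewrite /k /=; congr (_ *: (h _ - _)).
  by rewrite /shift/= -[r *: 1]/(r * 1) mulr1 scalerDl addrA addrAC addrC addrA.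
apply: DeriveDef.
- by rewrite /derivable E; exact: diff_derivable.
- rewrite -(diff_gradE v dh) -deriveE// /derive; exact: (congr1 (fun q => lim (q @ 0^')) E).
Qed.

Lemma normr_coord_le x j : `|x 0 j| <= `|x|.
Proof.
rewrite [leRHS]/Num.Def.normr/= mx_normrE.
exact: (@le_bigmax _ _ _ 0 (fun i => `|x i.1 i.2|) (0, j)).
Qed.

Lemma dotp_le_sqr_norm x : dotp x x <= n%:R * `|x| ^+ 2.
Proof.
apply: (@le_trans _ _ (\sum_(j < n) `|x| ^+ 2)); last first.
  by rewrite sumr_const card_ord mulr_natl.
rewrite dotpE; apply: ler_sum => j _.
rewrite -expr2 -real_normK ?num_real// lerXn2r ?nnegrE//.
exact: normr_coord_le.
Qed.

Lemma continuous_dotp v : continuous (dotp v : 'rV[R]_n -> R).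
Proof.
have -> : dotp v = fun x => \sum_(j < n) v 0 j * x 0 j.
  by apply/funext => x; rewrite dotpE.
apply: continuous_big => [|j _ x]; first exact: add_continuous.
apply: (@continuousM _ _ (cst (v 0 j)) (fun y : 'rV[R]_n => y 0 j)).
  exact: cst_continuous.
exact: coord_continuous.
Qed.

(** Fermat's rule, for a function with a linear perturbation. *)
Lemma grad_minimizer h c x :
  (forall y, differentiable (h : 'rV[R]_n -> R^o) y) ->
  is_minimizer (fun y => h y - dotp c y) x -> grad h x = c.
Proof.
move=> dh hx; apply: dotpP => v.
pose k := fun r : R => h (x + r *: v) : R^o.
pose phi : R -> R := (k - dotp c v \*: id : R -> R).
have dphi (r : R) : is_derive r 1 phi (dotp (grad h (x + r *: v)) v - dotp c v).
  have dk : is_derive r 1 k (dotp (grad h (x + r *: v)) v).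
    exact: is_derive_line.
  by apply: is_derive_eq; rewrite /GRing.scale/= mulr1.
have zI : (0 : R) \in `]-1, 1[%R by rewrite in_itv/=; apply/andP; lra.
have le11 : -1 <= 1 :> R by lra.
have d1 : is_derive (0 : R) 1 phi 0.
  apply: (derive1_at_min le11 _ zI); first by move=> t _; have [] := dphi t.
  move=> t _; rewrite -[phi 0]/(h (x + 0 *: v) - dotp c v * 0).
  rewrite -[phi t]/(h (x + t *: v) - dotp c v * t).
  have := hx (x + t *: v); rewrite dotpDr dotpZr scale0r addr0 mulr0 subr0.
  by move: (dotp c x) (dotp c v) => *; lra.
have [_ E0] := dphi 0; have [_ E1] := d1.
have := etrans (esym E0) E1; rewrite scale0r addr0 => /eqP.
by rewrite subr_eq0 => /eqP.
Qed.

(** A function whose gradient is L-Lipschitz is trapped between quadratics. *)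
Lemma descent_lemma h (L : R) :
  (forall x, differentiable (h : 'rV[R]_n -> R^o) x) ->
  (forall x y, norm2 (grad h x - grad h y) <= L * norm2 (x - y)) ->
  forall x y, `|h y - h x - dotp (grad h x) (y - x)|
    <= L / 2 * dotp (y - x) (y - x).
Proof.
move=> dh Lh x y; set v := y - x.
suff key (e : R) : `|e| = 1 ->
    e * (h y - h x - dotp (grad h x) v) <= L / 2 * dotp v v.
  rewrite ler_norml lerNl; apply/andP; split.
    by rewrite -mulN1r key// normrN normr1.
  by rewrite -[leLHS]mul1r key// normr1.
move=> e1; pose a := dotp (grad h x) v; pose b := L / 2 * dotp v v.
pose k := fun r : R => h (x + r *: v) : R^o.
pose phi : R -> R := (e \*: k - (e * a) \*: id - b \*: (id ^+ 2)) : R -> R.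
have dphi (r : R) : is_derive r 1 phi
    (e * (dotp (grad h (x + r *: v)) v - a) - b * (2 * r)).
  have dk : is_derive r 1 k (dotp (grad h (x + r *: v)) v).
    exact: is_derive_line.
  apply: is_derive_eq.
  rewrite /GRing.scale/= expr1; ring.
have cphi : {within `[0, 1], continuous phi}.
  apply: continuous_subspaceT => r; apply/differentiable_continuous.
  by apply/derivable1_diffP; have [] := dphi r.
have [c c01 E] := @MVT_segment R phi _ 0 1 ler01 (fun r _ => dphi r) cphi.
have c0 : 0 <= c by move: c01; rewrite in_itv/= => /andP[].
have phiE r : phi r = e * h (x + r *: v) - e * a * r - b * (r * r) by [].
have phi1 : phi 1 = e * h y - e * a - b.
  by rewrite phiE scale1r /v [x + _]addrC subrK !mulr1.
have phi0 : phi 0 = e * h x.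
  by rewrite phiE scale0r addr0 !mulr0 !subr0.
suff : e * (dotp (grad h (x + c *: v)) v - a) <= b * (2 * c).
  move=> le_b; rewrite !mulrBr -/a -/b; move: E le_b; rewrite phi1 phi0.
  clear -c0; clearbody a b.
  by move: (e * _) (e * _) (e * _) (e * _) => *; lra.
apply: le_trans (ler_norm _) _; rewrite normrM e1 mul1r /a -dotpBl.
apply: le_trans (normr_dotp_le _ _) _.
apply: (@le_trans _ _ (L * norm2 (c *: v) * norm2 v)).
  apply: ler_wpM2r; first exact: norm2_ge0.
  have xc : x + c *: v - x = c *: v by rewrite addrAC subrr add0r.
  by rewrite -[X in _ <= L * norm2 X]xc; exact: Lh.
rewrite norm2Z ger0_norm// /b -norm2_sqr; move: (norm2 v) => V.
by apply: eq_ler; field.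
Qed.

Lemma quadratic_bound_grad h x v (c : R) : 0 <= c ->
  (forall y, `|h y - h x - dotp v (y - x)| <= c * dotp (y - x) (y - x)) ->
  has_grad h x v.
Proof.
move=> c0 hc.
have lv : linear (dotp v : 'rV[R]_n -> R^o).
  by move=> a y z; rewrite dotpDr dotpZr.
pose l := GRing.isLinear.Build _ _ _ _ _ lv.
pose dv : {linear 'rV[R]_n -> R^o} := HB.pack (dotp v : 'rV[R]_n -> R^o) l.
have cdv : continuous dv by exact: continuous_dotp.
have U := @diff_unique R _ _ (h : 'rV[R]_n -> R^o) dv x cdv.
match type of U with ?A -> _ => have o : A end.
  apply/eqaddoP => e /= e0.
  have cn : 0 < c * n%:R + 1 by rewrite ltr_wpDl// mulr_ge0.
  have := @nbhs0_le R 'rV[R]_n (e / (c * n%:R + 1)) (divr_gt0 e0 cn).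
  apply: filterS => y yle.
  have := hc (y + x); rewrite addrK => hy.
  rewrite -[leLHS]/(`|h (y + x) - (h x + dotp v y)|) opprD addrA.
  apply: le_trans hy _; apply: (@le_trans _ _ (c * (n%:R * `|y| ^+ 2))).
    by apply: ler_wpM2l => //; exact: dotp_le_sqr_norm.
  move: yle; rewrite ler_pdivlMr// expr2 => yle.
  have y0 : 0 <= `|y| by exact: normr_ge0.
  move: (`|y|) y0 yle => Y y0 yle.
  have -> : c * (n%:R * (Y * Y)) = (Y * (c * n%:R + 1) - Y) * Y by ring.
  by apply: ler_wpM2r => //; lra.
have dE := U o.
split; first by apply/diff_locallyP; rewrite dE.
by apply/rowP => j; rewrite mxE dE /= dotp_delta.
Qed.

(** The consequences of smoothness and convexity used below: the gradient
    inequality, Jensen's inequality for averages, and the bound of the squared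
    gradient by the optimality gap. *)
Lemma convex_ge_tangent h x v (c : R) :
  convex_function [set: 'rV[R]_n] h -> 0 <= c ->
  (forall y, `|h y - h x - dotp v (y - x)| <= c * dotp (y - x) (y - x)) ->
  forall y, h x + dotp v (y - x) <= h y.
Proof.
move=> hconv c0 hc y; rewrite -lerBrDl; apply/ler_addgt0Pl => e e0.
pose b := c * dotp (y - x) (y - x).
have b0 : 0 <= b by rewrite mulr_ge0// dotp_ge0.
pose s := Num.min 1 (e / (b + 1)).
have b1 : 0 < b + 1 by lra.
have s0 : 0 < s by rewrite lt_min ltr01 divr_gt0.
have s1 : s <= 1 by rewrite ge_min lexx.
have sb : s * b <= e.
  apply: (@le_trans _ _ (e / (b + 1) * b)).
    by apply: ler_wpM2r => //; rewrite ge_min lexx orbT.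
  by rewrite mulrAC ler_pdivrMr//; apply: ler_wpM2l; [exact: ltW|lra].
have hs : h (x + s *: (y - x)) <= s * h y + (1 - s) * h x.
  have := hconv (Itv01 (ltW s0) s1) y x; rewrite !inE => /(_ Logic.I Logic.I).
  have -> : x + s *: (y - x) = s *: y + (1 - s) *: x.
    by rewrite scalerBl scale1r scalerBr addrCA.
  exact.
have := hc (x + s *: (y - x)); rewrite [x + _]addrC addrK !dotpZr dotpZl.
rewrite [_ + x]addrC ler_norml => /andP[hl _].
rewrite -(ler_pM2l s0).
have bE : c * (s * (s * dotp (y - x) (y - x))) = s * (s * b) by rewrite /b; ring.
rewrite bE in hl; have := ler_wpM2l (ltW s0) sb.
move: hl hs; move: (h _) (h x) (h y) (dotp v _) => H hx hy D.
rewrite !mulrDr mulrN mulrBl mul1r; move: (s * (s * b)) (s * hy) (s * hx) (s * D).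
by move=> *; lra.
Qed.

Lemma sqr_grad_le_gap h x v (L h0 : R) : 0 < L -> (forall y, h0 <= h y) ->
  (forall y, `|h y - h x - dotp v (y - x)| <= L / 2 * dotp (y - x) (y - x)) ->
  dotp v v <= 2 * L * (h x - h0).
Proof.
move=> L0 hmin hL; have := hL (x - L^-1 *: v).
have -> : x - L^-1 *: v - x = - (L^-1 *: v) by rewrite addrAC subrr add0r.
rewrite !dotpNr !dotpNl !dotpZr !dotpZl opprK => /ler_normlW.
have := hmin (x - L^-1 *: v); move: (h _) (h x) (dotp v v) => H hx D hH hl.
have e1 : L / 2 * (L^-1 * (L^-1 * D)) = L^-1 * D / 2.
  by field; rewrite gt_eqF.
rewrite opprK e1 in hl; have {}hl : L^-1 * D <= 2 * (hx - h0) by lra.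
have -> : D = L * (L^-1 * D) by rewrite mulVKf// gt_eqF.
by rewrite [2 * L]mulrC -mulrA ler_pM2l.
Qed.

Lemma jensen_average h v (N : nat) (z : 'I_N -> 'rV[R]_n) : (0 < N)%N ->
  let zbar := N%:R^-1 *: \sum_(k < N) z k in
  (forall y, h zbar + dotp v (y - zbar) <= h y) ->
  h zbar <= N%:R^-1 * \sum_(k < N) h (z k).
Proof.
move=> N0 zbar hz; have NR : 0 < N%:R :> R by rewrite ltr0n.
rewrite mulrC ler_pdivlMr//.
apply: le_trans (ler_sum _ (fun k _ => hz (z k))).
rewrite big_split/= sumr_const card_ord mulr_natr lerDl.
under eq_bigr do rewrite dotpBr.
rewrite sumrB sumr_const card_ord -[X in _ - X]mulr_natl.
have -> : \sum_(k < N) dotp v (z k) = N%:R * dotp v zbar.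
  rewrite /zbar dotpZr mulrA mulfV ?gt_eqF// mul1r [RHS]dotpC dotp_suml.
  by apply: eq_bigr => k _; rewrite dotpC.
by rewrite subrr.
Qed.

Lemma norm_le_norm2 x : `|x| <= norm2 x.
Proof.
rewrite [leLHS]/Num.Def.normr/= mx_normrE; apply: bigmax_le => [|[i j] _ /=].
  exact: norm2_ge0.
rewrite ord1 norm2E -sqrtr_sqr ler_wsqrtr//; exact: sqr_coord_le.
Qed.

Lemma norm2_le_norm x : norm2 x <= Num.sqrt n%:R * `|x|.
Proof.
rewrite norm2E -[`|x|]ger0_norm// -[`| `|x| |]sqrtr_sqr -sqrtrM//.
exact/ler_wsqrtr/dotp_le_sqr_norm.
Qed.

End gradient.

(** * Mirror descent step *)

Section prox.
Context {R : realType} {n : nat} (p : R) (p12 : 1 <= p <= 2).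
Variables (d : 'rV[R]_n -> R) (dprox : prox_function p d).
Implicit Types (x y z u c G : 'rV[R]_n).

Let dcont : continuous d. Proof. by case: dprox. Qed.
Let ddiff x : differentiable (d : 'rV[R]_n -> R^o) x.
Proof. by case: dprox. Qed.
Let dconv x y :
  normp p (y - x) ^+ 2 / 2 <= d y - d x - dotp (grad d x) (y - x).
Proof. by case: dprox. Qed.

Lemma bregman_ge_normp z x : normp p (x - z) ^+ 2 <= 2 * bregman d z x.
Proof. by rewrite mulrC -ler_pdivrMr// dconv. Qed.

Lemma dotp_le_sqr_normp x : dotp x x <= normp p x ^+ 2.
Proof.
rewrite -norm2_sqr lerXn2r ?nnegrE ?norm2_ge0 ?normp_ge0//.
exact: norm2_le_normp.
Qed.

Lemma bregman_ge z x : dotp (x - z) (x - z) <= 2 * bregman d z x.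
Proof. exact: le_trans (dotp_le_sqr_normp _) (bregman_ge_normp _ _). Qed.

Lemma bregman_ge0 z x : 0 <= bregman d z x.
Proof. by rewrite -(@pmulr_rge0 _ 2)//; apply: le_trans (bregman_ge z x); exact: dotp_ge0. Qed.

(** The gradient of a prox-function is onto, and its inverse is 1-Lipschitz. *)
Lemma grad_prox_onto c : exists z, grad d z = c.
Proof.
pose phi := fun y : 'rV[R]_n => d y - dotp c y.
have phic : continuous phi.
  move=> y; apply: continuousB; first exact: dcont.
  exact: continuous_dotp.
pose S := phi @^-1` [set r | r <= phi 0].
have S0 : S !=set0 by exists 0; rewrite /S /= lexx.
have Sclosed : closed S.
  by apply: preimage_closed; [move=> y _; exact: phic|exact: closed_le].
pose B := norm2 (grad d 0 - c).
have SB y : S y -> `|y| <= 2 * B.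
  rewrite /S /= /phi dotp0r subr0 => Sy.
  apply: le_trans (norm_le_norm2 y) _.
  have := dconv 0 y; rewrite subr0 => hy.
  have := dotp_le_sqr_normp y; rewrite -norm2_sqr => hn.
  have := normr_dotp_le (grad d 0 - c) y; rewrite -/B ler_norml => /andP[+ _].
  rewrite dotpBl => hB.
  have [//|Bn] := lerP (norm2 y) (2 * B).
  have V0 : 0 < norm2 y.
    by apply: le_lt_trans Bn; rewrite mulr_ge0// norm2_ge0.
  suff : norm2 y ^+ 2 <= 2 * B * norm2 y by rewrite expr2 ler_pM2r// leNgt Bn.
  move: hB hn hy Sy; rewrite -mulrA; move: (B * _) (norm2 y ^+ 2) (_ ^+ 2).
  by move: (dotp _ y) (dotp c y) (d y) (d 0) => *; lra.
have Scompact : compact S.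
  apply: bounded_closed_compact => //.
  exists (2 * B); split; first exact: num_real.
  by move=> M BM y Sy /=; apply: le_trans (SB _ Sy) (ltW BM).
have [z zS zmin] : exists2 z, z \in S & forall y, y \in S -> phi z <= phi y.
  by apply: EVT_min_rV => //; exact: continuous_subspaceT.
exists z; apply: grad_minimizer => // y.
have [yS|yS] := pselect (S y); first by apply: zmin; rewrite inE.
move: zS; rewrite inE => zS; apply: (le_trans zS); apply: ltW.
by rewrite ltNge; apply/negP.
Qed.

Lemma grad_prox_monotone x z :
  dotp (x - z) (x - z) <= dotp (grad d x - grad d z) (x - z).
Proof.
have h1 := le_trans (dotp_le_sqr_normp _) (bregman_ge_normp z x).
have h2 := le_trans (dotp_le_sqr_normp _) (bregman_ge_normp x z).
have zx : z - x = - (x - z) by rewrite opprB.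
move: h1 h2; rewrite /bregman zx; move: (x - z) (grad d x) (grad d z) => w a b.
rewrite !dotpNr dotpNl opprK dotpBl.
by move: (dotp w w) (dotp a w) (dotp b w) (d x) (d z) => *; lra.
Qed.

Lemma grad_prox_expansive x z : norm2 (x - z) <= norm2 (grad d x - grad d z).
Proof.
have := le_trans (grad_prox_monotone x z) (ler_norm _).
move=> /le_trans => /(_ _ (normr_dotp_le _ _)); rewrite -norm2_sqr.
have := norm2_ge0 (x - z); rewrite le_eqVlt => /predU1P[<-|h0].
  by move=> _; exact: norm2_ge0.
by rewrite expr2 ler_pM2r.
Qed.

(** The mirror map: the inverse of the gradient of the prox-function. *)
Definition mirror c : 'rV[R]_n := get [set z | grad d z = c].

Lemma mirrorK c : grad d (mirror c) = c.
Proof. by apply: (@getPex _ [set z | grad d z = c]); exact: grad_prox_onto. Qed.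

Lemma gradK z : mirror (grad d z) = z.
Proof.
apply/eqP; rewrite -subr_eq0; apply/eqP; apply: dotp_eq0.
apply/eqP; rewrite eq_le dotp_ge0 andbT.
by apply: le_trans (grad_prox_monotone _ _) _; rewrite mirrorK subrr dotp0l.
Qed.

Lemma mirror_continuous : continuous mirror.
Proof.
move=> c; apply/(@cvgrPdist_le R 'rV[R]_n 'rV[R]_n (nbhs c) (nbhs_filter c) mirror (mirror c)) => e e0.
pose K : R := Num.sqrt n%:R + 1.
have K0 : 0 < K by rewrite ltr_wpDl ?sqrtr_ge0.
near=> y; apply: le_trans (norm_le_norm2 _) _.
apply: le_trans (grad_prox_expansive _ _) _; rewrite !mirrorK.
apply: le_trans (norm2_le_norm _) _.
apply: (@le_trans _ _ (K * `|c - y|)); first by apply: ler_wpM2r => //; rewrite lerDl.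
rewrite -ler_pdivlMl//; near: y.
by apply: (cvgrPdist_le _ _).1 => //; rewrite mulr_gt0// invr_gt0.
Unshelve. all: by end_near. Qed.

Lemma mirror_stepE (a : R) G x z :
  is_minimizer (fun y => a * dotp G (y - x) + bregman d x y) z ->
  z = mirror (grad d x - a *: G).
Proof.
move=> zmin; rewrite -[z]gradK; congr mirror.
apply: grad_minimizer => // y; have := zmin y.
rewrite /bregman; move: (grad d x) => g; rewrite !dotpBr !dotpBl !dotpZl !mulrBr.
move: (a * dotp G y) (a * dotp G z) (a * dotp G x) (dotp g y) (dotp g z) (dotp g x).
by move: (d y) (d x) (d z) => *; lra.
Qed.

(** One step of mirror descent along G, when K bounds the squared dual norm of
    G. *)
Lemma mirror_step_bound (a K : R) G x u : 0 <= K ->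
  (forall w, dotp G w ^+ 2 <= K * normp p w ^+ 2) ->
  bregman d (mirror (grad d x - a *: G)) u + a * dotp G (x - u)
    <= bregman d x u + a ^+ 2 * K / 2.
Proof.
move=> K0 HK; set z := mirror _.
have zE : grad d z = grad d x - a *: G by exact: mirrorK.
have hV := bregman_ge_normp x z.
have hG : a * dotp G (x - z) <= (a ^+ 2 * K + normp p (z - x) ^+ 2) / 2.
  have := HK (x - z); rewrite -[x - z]opprB normpN opprB.
  move: (dotp G _) (normp p _) => D W hD.
  have h1 : (a * D) ^+ 2 <= (a ^+ 2 * K) * W ^+ 2.
    by rewrite exprMn -mulrA; apply: ler_wpM2l => //; exact: sqr_ge0.
  have h2 : 0 <= a ^+ 2 * K by rewrite mulr_ge0 ?sqr_ge0.
  have h3 : 0 <= W ^+ 2 by exact: sqr_ge0.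
  move: (a * D) (a ^+ 2 * K) (W ^+ 2) h1 h2 h3 => P Q S h1 h2 h3.
  have QS0 : 0 <= (Q + S) / 2 by rewrite divr_ge0 ?addr_ge0.
  have [P0|P0] := lerP 0 P; last by rewrite (le_trans (ltW P0)).
  rewrite -(@ler_pXn2r _ 2)//; apply: le_trans h1 _; rewrite -subr_ge0.
  have -> : ((Q + S) / 2) ^+ 2 - Q * S = ((Q - S) / 2) ^+ 2 by field.
  exact: sqr_ge0.
move: hV hG; rewrite /bregman zE; move: (grad d x) (normp _ _ ^+ 2) => g W.
rewrite !dotpBr !dotpBl !dotpZl !mulrBr.
move: (a * dotp G x) (a * dotp G z) (a * dotp G u) (a ^+ 2 * K).
by move: (dotp g x) (dotp g z) (dotp g u) (d x) (d z) (d u) => *; lra.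
Qed.

End prox.

(** * Borel measurability on R^n *)

Section borel_rV.
Context {R : realType} {n : nat}.

Lemma measurable_borel_continuous (f : 'rV[R]_n -> R) : continuous f ->
  measurable_fun setT (f : borel_space R n -> R).
Proof.
move=> cf; apply: (measurability _ (RGenOpens.measurableE R)).
move=> _ [_ [a [b ->] <-]]; rewrite setTI; apply: sub_sigma_algebra.
by apply: open_comp => [x _|]; [exact: cf|exact: interval_open].
Qed.

Lemma measurable_coord j :
  measurable_fun setT (fun v : borel_space R n => (v : 'rV[R]_n) 0 j).
Proof. by apply: measurable_borel_continuous => x; exact: coord_continuous. Qed.

(** R^n is second countable: an open set is the union of the rational boxes
    inside it. *)
Let box (b : 'rV[rat]_n * rat) : set 'rV[R]_n :=
  [set v | forall j, `|v 0 j - ratr (b.1 0 j)| < ratr b.2].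

Lemma open_rational_boxes (U : set 'rV[R]_n) : open U ->
  U = \bigcup_(b in [set b | box b `<=` U]) box b.
Proof.
move=> oU; apply/seteqP; split => [v Uv|v [b bU bv]]; last exact: bU.
have /nbhs_ballP[e e0 veU] : nbhs v U by exact: open_nbhs_nbhs.
have e20 : 0 < e / 2 :> R by rewrite divr_gt0.
have [r] := rat_in_itvoo e20; rewrite in_itv/= => /andP[r0 re].
have cP j : exists c : rat, `|v 0 j - ratr c| < ratr r.
  have vr : v 0 j - ratr r < v 0 j + ratr r by lra.
  have [c] := rat_in_itvoo vr; rewrite in_itv/= => /andP[c1 c2].
  by exists c; rewrite ltr_norml; apply/andP; lra.
have [c cE] := choice cP.
exists (\row_j c j, r) => [w wb|j]; last by rewrite /= mxE.
apply: veU; split => // i j; rewrite ord1 /ball/=.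
have := wb j; have := cE j; rewrite /= mxE => h1 h2.
rewrite (_ : v 0 j - w 0 j = v 0 j - ratr (c j) - (w 0 j - ratr (c j))); last by ring.
by apply: le_lt_trans (ler_normB _ _) _; lra.
Qed.

Lemma measurable_to_borel d (T : measurableType d) (X : T -> 'rV[R]_n) :
  (forall j, measurable_fun setT (fun w => X w 0 j)) ->
  measurable_fun setT (X : T -> borel_space R n).
Proof.
move=> mX; apply: (@measurability _ _ T (borel_space R n) setT X (@open 'rV[R]_n) erefl).
move=> _ [U oU <-]; rewrite setTI (open_rational_boxes oU) preimage_bigcup.
rewrite bigcup_mkcond; apply: countable_bigcupT_measurable => [|b].
  exact: countableP.
case: ifPn => // _.
have -> : X @^-1` box b = \bigcap_(j in [set: 'I_n])
    (fun w => X w 0 j) @^-1` [set y | `|y - ratr (b.1 0 j)| < ratr b.2].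
  by apply/seteqP; split => w h; [move=> j _; exact: h|move=> j; exact: h].
apply: fin_bigcap_measurable => // j _; rewrite -[X in measurable X]setTI.
apply: mX => //; apply: open_measurable.
rewrite (_ : mkset _ = ball (ratr (b.1 0 j) : R) (ratr b.2)); first exact: ball_open.
by apply/seteqP; split => y; rewrite /ball/= distrC.
Qed.

Lemma measurable_to_borelP d (T : measurableType d) (X : T -> borel_space R n) :
  measurable_fun setT X ->
  forall j, measurable_fun setT (fun w => (X w : 'rV[R]_n) 0 j).
Proof. by move=> mX j; exact: (measurableT_comp (measurable_coord j) mX). Qed.

End borel_rV.

(** * Independence *)

Section independence.
Local Open Scope ereal_scope.
Context {R : realType} {d : measure_display} {Omega : measurableType d}.
Variable Pr : probability Omega R.

(** Independence of two families of events. *)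
Definition independent (G H : set (set Omega)) : Prop :=
  forall A B, G A -> H B -> Pr (A `&` B) = Pr A * Pr B.

Lemma independentC G H : independent G H -> independent H G.
Proof. by move=> GH A B HA GB; rewrite setIC GH// muleC. Qed.

Let independent_sigma1 (G H : set (set Omega)) :
  G `<=` measurable -> H `<=` measurable -> setI_closed G ->
  independent G H -> independent <<s G >> H.
Proof.
move=> Gm Hm GI GH A B sA HB; move: A sA.
have mB : measurable B := Hm _ HB.
have sGm := smallest_sub (@sigma_algebra_measurable _ Omega) Gm.
have bfin := fin_num_measure Pr _ mB.
pose Q (A : set Omega) := Pr (A `&` B) = Pr A * Pr B.
have QC (A : set Omega) : measurable A -> Q A -> Q (~` A).
  move=> mA AB; rewrite /Q; have -> : ~` A `&` B = B `\` A by rewrite setDE setIC.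
  rewrite (measureD mB mA); last by rewrite -ge0_fin_numE ?fin_num_measure.
  rewrite (probability_setC _ mA).
  rewrite [X in _ - X](_ : _ = Pr A * Pr B); last by rewrite setIC; exact: AB.
  have key (a b : \bar R) : a \is a fin_num -> b \is a fin_num ->
      b - a * b = (1 - a) * b.
    move=> /fineK <- /fineK <-; rewrite -EFinM -!EFinB -EFinM.
    by congr EFin; ring.
  by apply: key => //; exact: fin_num_measure.
have QU (F : (set Omega)^nat) : (forall k, measurable (F k)) ->
    trivIset setT F -> (forall k, Q (F k)) -> Q (\bigcup_k F k).
  move=> mF tF FB; rewrite /Q setI_bigcupl.
  have mFB k : measurable (F k `&` B) by exact: measurableI.
  have mU : measurable (\bigcup_k F k) by exact: bigcup_measurable.
  have mUB : measurable (\bigcup_k (F k `&` B)) by exact: bigcup_measurable.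
  rewrite (measure_semi_bigcup _ mFB _ mUB); last exact: trivIset_setIr.
  rewrite (measure_semi_bigcup _ mF tF mU) -(fineK bfin) muleC -nneseriesZl//.
  by apply: eq_eseriesr => k _; rewrite muleC fineK//; exact: FB.
apply: (@dynkin_induction _ (g_sigma_algebraType G) G Q) => //.
- by rewrite /Q setTI probability_setT mul1e.
- by move=> A GA; exact: GH.
- by move=> A mA; apply: QC; exact: sGm.
- by move=> F mF tF QF; apply: QU => // k; exact: sGm (mF k).
Qed.

Lemma independent_sigma (G H : set (set Omega)) :
  G `<=` measurable -> H `<=` measurable -> setI_closed G -> setI_closed H ->
  independent G H -> independent <<s G >> <<s H >>.
Proof.
move=> Gm Hm GI HI GH; apply: independent_sigma1 => //.
  exact: smallest_sub (@sigma_algebra_measurable _ Omega) Hm.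
by apply: independentC; apply: independent_sigma1 => //; exact: independentC.
Qed.

Section blocks.
Context {I : finType} (S : I -> set (set Omega)).
Hypotheses (ST : forall i, S i setT) (SI : forall i, setI_closed (S i)).
Hypotheses (Sm : forall i, S i `<=` measurable).
Hypothesis indepS : mutually_independent Pr S.

(** The finite intersections of events of the families indexed by J. *)
Definition block (J : {set I}) : set (set Omega) :=
  [set A | exists2 F : I -> set Omega,
    forall i, i \in J -> S i (F i) & A = \bigcap_(i in [set` J]) F i].

Lemma sub_block (J : {set I}) i : i \in J -> S i `<=` block J.
Proof.
move=> iJ A SA; exists (fun k => if k == i then A else setT).
  by move=> k kJ; case: eqP => [->|].
apply/seteqP; split => [w Aw k _ /=|w h]; first by case: eqP.
by have := h i iJ; rewrite eqxx.
Qed.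

Lemma block_sub (J K : {set I}) : J \subset K -> block J `<=` block K.
Proof.
move=> /fintype.subsetP JK A [F SF ->]; exists (fun i => if i \in J then F i else setT).
  by move=> i _; case: ifPn => // /SF.
apply/seteqP; split => [w h i _ /=|w h i iJ].
  by case: ifPn => // iJ; exact: h.
by have := h i (JK _ iJ); rewrite (iJ : i \in J).
Qed.

Lemma block_measurable J : block J `<=` measurable.
Proof.
move=> _ [F SF ->]; apply: fin_bigcap_measurable => // i /= iJ.
exact: Sm (SF _ iJ).
Qed.

Lemma block_setI J : setI_closed (block J).
Proof.
move=> _ _ [F SF ->] [G SG ->]; exists (fun i => F i `&` G i).
  by move=> i iJ; apply: SI; [exact: SF|exact: SG].
by rewrite bigcapI.
Qed.

Lemma block_independent (J K : {set I}) : (forall i, i \in J -> i \notin K) ->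
  independent (block J) (block K).
Proof.
move=> JK A B [F SF ->] [G SG ->].
pose H i := if i \in J then F i else G i.
have HJ : \bigcap_(i in [set` J]) F i = \bigcap_(i in [set` J]) H i.
  by apply: eq_bigcapr => i /= iJ; rewrite /H iJ.
have HK : \bigcap_(i in [set` K]) G i = \bigcap_(i in [set` K]) H i.
  apply: eq_bigcapr => i /= iK; rewrite /H ifN//.
  by apply/negP => /JK; rewrite iK.
have SJ i : i \in J -> S i (H i) by move=> iJ; rewrite /H iJ; exact: SF.
have SK i : i \in K -> S i (H i).
  move=> iK; rewrite /H ifN; first exact: SG.
  by apply/negP => /JK; rewrite iK.
rewrite HJ HK (indepS SJ) (indepS SK) -bigcap_setU.
have -> : [set` J] `|` [set` K] = [set` (J :|: K)%SET].
  apply/seteqP; split => i /=; rewrite finset.in_setU; first by case=> ->; rewrite ?orbT.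
  by case/orP; [left|right].
rewrite indepS; last by move=> i; rewrite finset.in_setU => /orP[/SJ|/SK].
rewrite (eq_bigl [predU J & K]); last by move=> i; rewrite finset.in_setU.
rewrite bigU//; by rewrite disjoint_subset; apply/fintype.subsetP => i /JK; rewrite inE.
Qed.

Lemma sigma_block_independent (J K : {set I}) :
  (forall i, i \in J -> i \notin K) ->
  independent <<s block J >> <<s block K >>.
Proof.
move=> JK; apply: independent_sigma; rewrite /setI_closed.
- exact: block_measurable.
- exact: block_measurable.
- exact: block_setI.
- exact: block_setI.
- exact: block_independent.
Qed.

End blocks.

End independence.

(** * Expectations of independent variables *)

Section mean.
Context {R : realType} {d : measure_display} {T : measurableType d}.
Variable P : probability T R.
Implicit Types (X Y : T -> R) (a b c : R).

(** X is integrable with expectation a. *)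
Definition has_mean X a : Prop :=
  P.-integrable setT (EFin \o X) /\ (\int[P]_w (X w)%:E = a%:E)%E.

Lemma has_mean_measurable X a : has_mean X a -> measurable_fun setT X.
Proof. by case=> /integrableP[/measurable_EFinP]. Qed.

Lemma has_mean_unique X a b : has_mean X a -> has_mean X b -> a = b.
Proof. by case=> _ Xa [_ Xb]; move: Xb; rewrite Xa => -[]. Qed.

Lemma integrable_has_mean X : P.-integrable setT (EFin \o X) ->
  exists a, has_mean X a.
Proof.
move=> iX; exists (fine (\int[P]_w (X w)%:E)); split => //.
by rewrite fineK//; exact: integrable_fin_num.
Qed.

Lemma has_mean_cst a : has_mean (cst a) a.
Proof.
split; last first.
  transitivity (a%:E * P setT)%E; first exact: (integral_cst P measurableT a%:E).
  by rewrite probability_setT mule1.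
exact: finite_measure_integrable_cst.
Qed.

Lemma has_meanD X Y a b : has_mean X a -> has_mean Y b ->
  has_mean (fun w => X w + Y w) (a + b).
Proof.
move=> [iX Xa] [iY Yb]; split; last by rewrite integralD_EFin// Xa Yb.
by rewrite (_ : EFin \o _ = (EFin \o X) \+ (EFin \o Y))//; exact: integrableD.
Qed.

Lemma has_meanZ c X a : has_mean X a -> has_mean (fun w => c * X w) (c * a).
Proof.
move=> [iX Xa]; split.
  by rewrite (_ : EFin \o _ = (fun w => c%:E * (EFin \o X) w)%E)//; exact: integrableZl.
under eq_integral do rewrite EFinM.
by rewrite integralZl// Xa EFinM.
Qed.

Lemma has_meanB X Y a b : has_mean X a -> has_mean Y b ->
  has_mean (fun w => X w - Y w) (a - b).
Proof.
move=> Xa Yb; have := has_meanD Xa (has_meanZ (-1) Yb).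
by rewrite mulN1r; under [X in has_mean X]eq_fun do rewrite mulN1r.
Qed.

Lemma has_mean_sum (I : Type) (r : seq I) (X : I -> T -> R) (a : I -> R) :
  (forall i, has_mean (X i) (a i)) ->
  has_mean (fun w => \sum_(i <- r) X i w) (\sum_(i <- r) a i).
Proof.
move=> Xa; elim: r => [|i r ih].
  rewrite big_nil; under [X in has_mean X]eq_fun do rewrite big_nil.
  exact: has_mean_cst.
rewrite big_cons; under [X in has_mean X]eq_fun do rewrite big_cons.
exact: has_meanD.
Qed.

Lemma has_mean_ae_ge0 X a : {ae P, forall w, 0 <= X w} -> has_mean X a -> 0 <= a.
Proof.
move=> X0 [iX Xa]; rewrite -lee_fin -Xa.
have /measurable_EFinP mX := measurable_int _ iX.
have mX0 : measurable_fun setT (fun w => Num.max (X w) 0).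
  by apply: measurable_funrpos.
rewrite (@ae_eq_integral _ _ _ P setT (fun w => (Num.max (X w) 0)%:E)) //.
- by apply: integral_ge0 => w _; rewrite lee_fin le_max lexx orbT.
- exact/measurable_EFinP.
- exact/measurable_EFinP.
- by apply: filterS X0 => w Xw _; rewrite max_l.
Qed.

Lemma has_mean_le X Y a b : {ae P, forall w, X w <= Y w} ->
  has_mean X a -> has_mean Y b -> a <= b.
Proof.
move=> XY Xa Yb; rewrite -subr_ge0; apply: has_mean_ae_ge0 (has_meanB Yb Xa).
by apply: filterS XY => w; rewrite subr_ge0.
Qed.

Lemma has_mean_ge0 X : measurable_fun setT X -> (forall w, 0 <= X w) ->
  (\int[P]_w (X w)%:E < +oo)%E ->
  has_mean X (fine (\int[P]_w (X w)%:E)).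
Proof.
move=> mX X0 Xoo; split.
  apply/integrableP; split; first exact/measurable_EFinP.
  by under eq_integral do rewrite /= ger0_norm//.
by rewrite fineK// ge0_fin_numE// integral_ge0// => w _; rewrite lee_fin.
Qed.

Lemma has_mean_dominated X Y b : measurable_fun setT X ->
  {ae P, forall w, `|X w| <= Y w} -> has_mean Y b -> exists a, has_mean X a.
Proof.
move=> mX XY [/integrableP[mY iY] _]; apply: integrable_has_mean.
apply/integrableP; split; first exact/measurable_EFinP.
apply: le_lt_trans iY; apply: ae_ge0_le_integral => //.
- by apply: measurableT_comp => //; exact/measurable_EFinP.
- exact: measurableT_comp.
- apply: filterS XY => w XYw _ /=; rewrite lee_fin.
  by apply: le_trans XYw _; exact: ler_norm.
Qed.

Lemma has_mean_bounded X c : measurable_fun setT X ->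
  {ae P, forall w, `|X w| <= c} -> exists a, has_mean X a.
Proof. by move=> mX Xc; exact: has_mean_dominated mX Xc (has_mean_cst c). Qed.

Lemma has_mean_ae_eq X Y a : measurable_fun setT Y ->
  {ae P, forall w, X w = Y w} -> has_mean X a -> has_mean Y a.
Proof.
move=> mY XY Xa; have [iX _] := Xa.
have [b Yb] : exists b, has_mean Y b.
  have [c Xc] : exists c, has_mean (fun w => `|X w|) c.
    by apply: integrable_has_mean; exact: (integrable_norm iX).
  by apply: has_mean_dominated Xc => //; apply: filterS XY => w ->.
suff -> : a = b by [].
apply/eqP; rewrite eq_le (has_mean_le _ Xa Yb) ?(has_mean_le _ Yb Xa)//.
  by apply: filterS XY => w ->.
by apply: filterS XY => w ->.
Qed.

Lemma maxr_sub0 (x : R) : Num.max x 0 - Num.max (- x) 0 = x.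
Proof. by rewrite /Num.max; case: ifP; case: ifP; lra. Qed.

Lemma has_mean_posneg X a : has_mean X a -> exists a1 a2,
  [/\ has_mean (fun w => Num.max (X w) 0) a1,
    has_mean (fun w => Num.max (- X w) 0) a2 & a = a1 - a2].
Proof.
move=> Xa; have mX := has_mean_measurable Xa.
have [c Xc] : exists c, has_mean (fun w => `|X w|) c.
  by apply: integrable_has_mean; have [iX _] := Xa; exact: (integrable_norm iX).
have [a1 X1] : exists a1, has_mean (fun w => Num.max (X w) 0) a1.
  apply: has_mean_dominated Xc; first exact: measurable_funrpos.
  apply: aeW => w; rewrite ger0_norm ?le_max ?lexx ?orbT//.
  by rewrite ge_max normr_ge0 ler_norm.
have [a2 X2] : exists a2, has_mean (fun w => Num.max (- X w) 0) a2.
  apply: has_mean_dominated Xc; first exact: measurable_funrneg.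
  apply: aeW => w; rewrite ger0_norm ?le_max ?lexx ?orbT//.
  by rewrite ge_max normr_ge0 -normrN ler_norm.
exists a1, a2; split => //; apply: has_mean_unique Xa _.
have := has_meanB X1 X2; congr (has_mean _ _).
by apply/funext => w; rewrite maxr_sub0.
Qed.

End mean.

Section transfer.
Context {R : realType} {d d' : measure_display}.
Context {T : measurableType d} {T' : measurableType d'}.
Variables (P : probability T R) (P' : probability T' R).
Variables (Z : T -> T') (Zlaw : has_law P Z P').

Let integral_law (h : T' -> \bar R) : measurable_fun setT h ->
  (forall y, 0 <= h y)%E -> (\int[P']_y h y = \int[P]_w h (Z w))%E.
Proof.
move=> mh h0; have [mZ ZP] := Zlaw.
have := @ge0_integral_pushforward _ _ _ _ R Z mZ P setT h measurableT mh (fun y _ => h0 y).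
rewrite preimage_setT => <-; apply: eq_measure_integral => A mA _.
exact: esym (ZP A mA).
Qed.

Lemma has_mean_law (X : T' -> R) a :
  has_mean P' X a -> has_mean P (X \o Z) a.
Proof.
move=> [iX Xa]; have [mZ ZP] := Zlaw.
have /measurable_EFinP mX := measurable_int _ iX.
have mXZ : measurable_fun setT (X \o Z) by exact: measurableT_comp.
have iXZ : P.-integrable setT (EFin \o (X \o Z)).
  apply/integrableP; split; first exact/measurable_EFinP.
  have /integrableP[_] := iX; rewrite integral_law//.
  by apply: measurableT_comp => //; exact/measurable_EFinP.
split => //; rewrite -Xa.
have := @integral_pushforward _ _ _ _ R Z mZ P setT (EFin \o X) (measurable_int _ iX).
rewrite preimage_setT => /(_ iXZ measurableT) <-.
by apply: eq_measure_integral => A mA _; exact: ZP A mA.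
Qed.

Lemma ae_law (Q : T' -> Prop) : {ae P', forall y, Q y} -> {ae P, forall w, Q (Z w)}.
Proof.
have [mZ ZP] := Zlaw; move=> [N [mN N0 QN]]; exists (Z @^-1` N); split.
- by rewrite -[_ @^-1` _]setTI; exact: mZ.
- by rewrite ZP.
- by move=> w Qw; apply: QN.
Qed.

End transfer.

Section fubini_independent.
Local Open Scope ereal_scope.
Context {R : realType} {d d1 d2 : measure_display}.
Context {Omega : measurableType d} {T1 : measurableType d1} {T2 : measurableType d2}.
Variable Pr : probability Omega R.
Variables (Y : Omega -> T1) (Z : Omega -> T2).
Hypotheses (mY : measurable_fun setT Y) (mZ : measurable_fun setT Z).
Hypothesis YZ : forall A B, measurable A -> measurable B ->
  Pr (Y @^-1` A `&` Z @^-1` B) = Pr (Y @^-1` A) * Pr (Z @^-1` B).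

Let Yf : {mfun Omega >-> T1} := HB.pack Y (isMeasurableFun.Build _ _ _ _ _ mY).
Let Zf : {mfun Omega >-> T2} := HB.pack Z (isMeasurableFun.Build _ _ _ _ _ mZ).
Let mYZ : measurable_fun setT (fun w => (Y w, Z w)).
Proof. exact: measurable_fun_pair. Qed.
Let YZf : {mfun Omega >-> (T1 * T2)%type} :=
  HB.pack (fun w => (Y w, Z w)) (isMeasurableFun.Build _ _ _ _ _ mYZ).

Let joint_law A : measurable A ->
  (distribution Pr Yf \x distribution Pr Zf) A = distribution Pr YZf A.
Proof.
by move=> mA; apply: product_measure_unique.
Qed.

(** The expectation of a function of two independent variables is an iterated
    one, the second variable being drawn afresh. *)
Lemma integral_independent (phi : T1 * T2 -> \bar R) :
  measurable_fun setT phi -> (forall z, 0 <= phi z) ->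
  \int[Pr]_w phi (Y w, Z w) = \int[Pr]_w \int[Pr]_w' phi (Y w, Z w').
Proof.
move=> mphi phi0.
transitivity (\int[distribution Pr YZf]_z phi z).
  by rewrite ge0_integral_distribution.
transitivity (\int[distribution Pr Yf \x distribution Pr Zf]_z phi z).
  by apply: eq_measure_integral => A mA _; exact: esym (joint_law mA).
rewrite fubini_tonelli1// ge0_integral_distribution//; last 2 first.
- exact: measurable_fun_fubini_tonelli_F.
- by move=> y; apply: integral_ge0.
apply: eq_integral => w _; rewrite /= /fubini_F ge0_integral_distribution//.
exact: measurable_fun_pair2.
Qed.

Let has_mean_mul_ge0 (u : T1 -> R) (v : T2 -> R) a b :
  measurable_fun setT u -> measurable_fun setT v ->
  (forall y, 0 <= u y)%R -> (forall z, 0 <= v z)%R ->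
  has_mean Pr (u \o Y) a -> has_mean Pr (v \o Z) b ->
  has_mean Pr (fun w => u (Y w) * v (Z w))%R (a * b)%R.
Proof.
move=> mu mv u0 v0 Ya Zb.
have mp : measurable_fun setT (fun z : T1 * T2 => (u z.1 * v z.2)%:E).
  apply/measurable_EFinP; apply: measurable_funM.
    exact: (measurableT_comp mu measurable_fst).
  exact: (measurableT_comp mv measurable_snd).
have E : \int[Pr]_w (u (Y w) * v (Z w))%:E = (a * b)%:E.
  rewrite (integral_independent mp); last by move=> z; rewrite lee_fin mulr_ge0.
  transitivity (\int[Pr]_w (b * u (Y w))%:E).
    apply: eq_integral => w _ /=.
    by have [_ ->] := has_meanZ (u (Y w)) Zb; rewrite mulrC.
  by have [_ ->] := has_meanZ b Ya; rewrite mulrC.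
have mX : measurable_fun setT (fun w => u (Y w) * v (Z w))%R.
  by apply: measurable_funM; exact: measurableT_comp.
have := has_mean_ge0 (P := Pr) mX (fun w => mulr_ge0 (u0 _) (v0 _)).
by rewrite E ltry /=; exact.
Qed.

Lemma has_mean_mul_comp (u : T1 -> R) (v : T2 -> R) a b :
  measurable_fun setT u -> measurable_fun setT v ->
  has_mean Pr (u \o Y) a -> has_mean Pr (v \o Z) b ->
  has_mean Pr (fun w => u (Y w) * v (Z w))%R (a * b)%R.
Proof.
move=> mu mv Ya Zb.
have [a1 [a2 [Ya1 Ya2 aE]]] := has_mean_posneg Ya.
have [b1 [b2 [Zb1 Zb2 bE]]] := has_mean_posneg Zb.
have mu1 : measurable_fun setT (fun y => Num.max (u y) 0)%R.
  exact: measurable_funrpos.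
have mu2 : measurable_fun setT (fun y => Num.max (- u y) 0)%R.
  exact: measurable_funrneg.
have mv1 : measurable_fun setT (fun y => Num.max (v y) 0)%R.
  exact: measurable_funrpos.
have mv2 : measurable_fun setT (fun y => Num.max (- v y) 0)%R.
  exact: measurable_funrneg.
have p0 (S : Type) (h : S -> R) y : (0 <= Num.max (h y) 0)%R.
  by rewrite le_max lexx orbT.
have H11 := has_mean_mul_ge0 mu1 mv1 (p0 _ _) (p0 _ _) Ya1 Zb1.
have H12 := has_mean_mul_ge0 mu1 mv2 (p0 _ _) (p0 _ _) Ya1 Zb2.
have H21 := has_mean_mul_ge0 mu2 mv1 (p0 _ _) (p0 _ _) Ya2 Zb1.
have H22 := has_mean_mul_ge0 mu2 mv2 (p0 _ _) (p0 _ _) Ya2 Zb2.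
have := has_meanD (has_meanB H11 H12) (has_meanB H22 H21).
have -> : (a1 * b1 - a1 * b2 + (a2 * b2 - a2 * b1) = a * b)%R.
  by rewrite aE bE; ring.
congr (has_mean _ _ _); apply/funext => w.
rewrite -[in RHS](maxr_sub0 (u (Y w))) -[in RHS](maxr_sub0 (v (Z w))).
by rewrite /=; ring.
Qed.

End fubini_independent.

(** The mean of a product of two independent variables. *)
Lemma has_mean_mul (R : realType) (d : measure_display) (Omega : measurableType d)
    (Pr : probability Omega R) (G H : set (set Omega)) (X Y : Omega -> R) a b :
  independent Pr <<s G>> <<s H>> ->
  measurable_fun setT (X : g_sigma_algebraType G -> R) ->
  measurable_fun setT (Y : g_sigma_algebraType H -> R) ->
  has_mean Pr X a -> has_mean Pr Y b -> has_mean Pr (fun w => X w * Y w) (a * b).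
Proof.
move=> GH mX mY Xa Yb.
apply: (@has_mean_mul_comp _ _ _ _ _ _ _ Pr X Y _ _ _ idfun idfun) => //.
- exact: has_mean_measurable Xa.
- exact: has_mean_measurable Yb.
- move=> A B mA mB; apply: GH.
    by have := mX measurableT _ mA; rewrite setTI.
  by have := mY measurableT _ mB; rewrite setTI.
- exact: measurable_id.
- exact: measurable_id.
Qed.

(** * The uniform distribution on the sphere *)

Section reflection.
Context {R : realType} {n : nat}.
Implicit Types u v a b : 'rV[R]_n.

Lemma mulmx_tr_dotp u v : u *m v^T = (dotp u v)%:M.
Proof.
apply/matrixP => i j; rewrite !ord1 !mxE eqxx mulr1n dotpE.
by apply: eq_bigr => k _; rewrite mxE.
Qed.

(** The matrix of the reflection in the hyperplane orthogonal to u. *)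
Definition reflection u : 'M[R]_n := 1%:M - (2 / dotp u u) *: (u^T *m u).

Lemma mul_reflection v u :
  v *m reflection u = v - (2 / dotp u u * dotp v u) *: u.
Proof.
rewrite mulmxBr mulmx1 -scalemxAr mulmxA mulmx_tr_dotp mul_scalar_mx.
by rewrite scalerA.
Qed.

Lemma reflection_orthogonal u : u != 0 ->
  reflection u *m (reflection u)^T = 1%:M.
Proof.
move=> u0; have s0 : dotp u u != 0 by apply: contra_neq u0; exact: dotp_eq0.
have -> : (reflection u)^T = reflection u.
  by rewrite /reflection linearB linearZ /= trmx_mul trmxK trmx1.
rewrite {2}/reflection mulmxBr mulmx1 -scalemxAr mulmxA.
have -> : reflection u *m u^T = - u^T.
  rewrite mulmxBl mul1mx -scalemxAl -mulmxA mulmx_tr_dotp mul_mx_scalar scalerA.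
  by rewrite divfK// scaler_nat mulr2n opprD addrA subrr add0r.
by rewrite mulNmx scalerN opprK subrK.
Qed.

Lemma dotp_mul_reflection v u a : dotp (v *m reflection u) a =
  dotp v a - 2 / dotp u u * dotp v u * dotp u a.
Proof. by rewrite mul_reflection dotpBl dotpZl. Qed.

(** Vectors of equal length are exchanged by a reflection. *)
Lemma dotp_reflection v a b : dotp a a = dotp b b ->
  dotp (v *m reflection (a - b)) a = dotp v b.
Proof.
move=> ab; rewrite dotp_mul_reflection.
have [ab0|ab0] := eqVneq (a - b) 0.
  have -> : b = a by apply/eqP; rewrite eq_sym -subr_eq0; apply/eqP.
  by rewrite subrr !dotp0l mulr0 subr0.
have s0 : dotp (a - b) (a - b) != 0 by apply: contra_neq ab0; exact: dotp_eq0.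
have sE : dotp (a - b) a = dotp (a - b) (a - b) / 2.
  by rewrite !dotpBr !dotpBl -ab (dotpC b a); field.
rewrite sE; move: s0; move: (dotp (a - b) (a - b)) => s s0.
have -> : 2 / s * dotp v (a - b) * (s / 2) = dotp v (a - b) by field.
by rewrite dotpBr; lra.
Qed.

End reflection.

Lemma poly_horner_inj (R : realDomainType) (p q : {poly R}) :
  (forall x, p.[x] = q.[x]) -> p = q.
Proof.
move=> pq; apply/eqP; rewrite -subr_eq0; apply/negP => /negP pq0.
pose rs : seq R := [seq i%:R | i <- iota 0 (size (p - q))].
have : (size rs < size (p - q)%R)%N.
  apply: max_poly_roots => //.
    by apply/allP => x _; rewrite rootE !hornerE pq subrr.
  by rewrite map_inj_uniq ?iota_uniq// => i j /eqP; rewrite eqr_nat => /eqP.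
by rewrite size_map size_iota ltnn.
Qed.

Lemma coef2_expr1DX2 (R : comNzRingType) (m : nat) :
  ((1 + 'X^2 : {poly R}) ^+ m)`_2 = m%:R.
Proof.
suff [//] : ((1 + 'X^2 : {poly R}) ^+ m)`_2 = m%:R /\
    ((1 + 'X^2 : {poly R}) ^+ m)`_0 = 1.
elim: m => [|m [ih2 ih0]]; first by rewrite expr0 !coefC.
rewrite exprS mulrDl mul1r !coefD !coefXnM/= subnn ih2 ih0.
by rewrite addr0 -natr1.
Qed.

Section measurable_vectors.
Context {R : realType} {n : nat} {d : measure_display} {T : measurableType d}.
Implicit Types X Y : T -> borel_space R n.

Lemma measurable_dotp X Y : measurable_fun setT X -> measurable_fun setT Y ->
  measurable_fun setT (fun w => dotp (X w) (Y w)).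
Proof.
move=> mX mY; under eq_fun do rewrite dotpE.
apply: measurable_sum => j.
by apply: measurable_funM; exact: measurable_to_borelP.
Qed.

Lemma measurable_addv X Y : measurable_fun setT X -> measurable_fun setT Y ->
  measurable_fun setT (fun w => (X w : 'rV[R]_n) + (Y w : 'rV[R]_n) : borel_space R n).
Proof.
move=> mX mY; apply: measurable_to_borel => j.
under eq_fun do rewrite mxE.
by apply: measurable_funD; exact: measurable_to_borelP.
Qed.

Lemma measurable_scalev (c : T -> R) X : measurable_fun setT c ->
  measurable_fun setT X ->
  measurable_fun setT (fun w => c w *: (X w : 'rV[R]_n) : borel_space R n).
Proof.
move=> mc mX; apply: measurable_to_borel => j.
under eq_fun do rewrite mxE.
by apply: measurable_funM => //; exact: measurable_to_borelP.
Qed.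

Lemma measurable_mulmx X (O : 'M[R]_n) : measurable_fun setT X ->
  measurable_fun setT (fun w => (X w : 'rV[R]_n) *m O : borel_space R n).
Proof.
move=> mX; apply: measurable_to_borel => j.
under eq_fun do rewrite mxE.
apply: measurable_sum => k; apply: measurable_funM; last exact: measurable_cst.
exact: measurable_to_borelP.
Qed.

End measurable_vectors.

Section sphere.
Context {R : realType} {n : nat} {d : measure_display} {Omega : measurableType d}.
Variables (Pr : probability Omega R) (e : Omega -> borel_space R n).
Hypotheses (me : measurable_fun setT e).
Hypothesis ue : uniform_on_sphere (pushforward Pr e).
Implicit Types (h : borel_space R n -> R) (a b u v : 'rV[R]_n).

Lemma sphere_norm_ae : {ae Pr, forall w, dotp (e w) (e w) = 1}.
Proof.
have [eS _] := ue.
pose S := [set v : borel_space R n | dotp v v = 1].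
have SE : S = [set v : borel_space R n | norm2 v = 1].
  apply/seteqP; split => v; rewrite /S /= -norm2_sqr.
    move/eqP; rewrite -subr_eq0 subr_sqr_1 mulf_eq0 subr_eq0 => /orP[/eqP//|].
    by rewrite addr_eq0 => /eqP E; have := norm2_ge0 v; rewrite E oppr_ge0 ler10.
  by move=> ->; rewrite expr1n.
have mS : measurable S.
  have mh : measurable_fun setT (fun v : borel_space R n => dotp v v).
    by apply: measurable_dotp; exact: measurable_id.
  by rewrite -[S]setTI; exact: (mh measurableT [set 1]).
exists (e @^-1` ~` S); split.
- by rewrite -[X in measurable X]setTI; apply: me => //; exact: measurableC.
- have meS : measurable (e @^-1` S) by rewrite -[X in measurable X]setTI; exact: me.
  have e1 : Pr (e @^-1` S) = 1%E by rewrite SE.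
  have := probability_setC Pr meS; rewrite e1 subee//.
- by move=> w.
Qed.

Lemma sphere_has_mean h (c : R) : measurable_fun setT h ->
  (forall v : 'rV[R]_n, dotp v v = 1 -> `|h v| <= c) ->
  exists m, has_mean Pr (fun w => h (e w)) m.
Proof.
move=> mh hc; apply: (has_mean_bounded (c := c)).
  exact: measurableT_comp.
by apply: filterS sphere_norm_ae => w; exact: hc.
Qed.

(** Invariance of means under orthogonal transformations. *)
Lemma sphere_mean_orthogonal h (O : 'M[R]_n) m : O *m O^T = 1%:M ->
  measurable_fun setT h ->
  has_mean Pr (fun w => h (e w)) m ->
  has_mean Pr (fun w => h ((e w : 'rV[R]_n) *m O)) m.
Proof.
move=> OO mh hm.
pose ef : {mfun Omega >-> borel_space R n} :=
  HB.pack e (isMeasurableFun.Build _ _ _ _ _ me).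
pose Q : probability (borel_space R n) R := distribution Pr ef.
have Qm : has_mean Q h m.
  have [iX Xm] := hm; have mh' : measurable_fun setT (EFin \o h).
    exact/measurable_EFinP.
  have i1 : (Q : {measure set _ -> \bar R}).-integrable setT (EFin \o h).
    by apply: (@integrable_pushforward _ _ _ _ R e me Pr setT).
  split => //; rewrite -Xm.
  by rewrite (integral_distribution (X := ef)).
have mO : measurable_fun setT (fun w => (e w : 'rV[R]_n) *m O : borel_space R n).
  exact: measurable_mulmx.
have lawO : has_law Pr (fun w => (e w : 'rV[R]_n) *m O : borel_space R n) Q.
  by split=> // A mA; have [_ inv] := ue; rewrite -[RHS](inv O OO A mA).
exact: (has_mean_law lawO Qm).
Qed.

Let me_coord j : measurable_fun setT (fun v : borel_space R n => (v : 'rV[R]_n) 0 j).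
Proof. exact: measurable_coord. Qed.

(** The law of the component along a depends on the length of a only. *)
Lemma sphere_mean_dotp (N : nat) a b m : dotp a a = dotp b b ->
  has_mean Pr (fun w => dotp (e w) a ^+ N) m ->
  has_mean Pr (fun w => dotp (e w) b ^+ N) m.
Proof.
move=> ab am; have [<-//|ab0] := eqVneq a b.
have O1 : reflection (a - b) *m (reflection (a - b))^T = 1%:M.
  by apply: reflection_orthogonal; rewrite subr_eq0.
have mh : measurable_fun setT (fun v : borel_space R n => dotp v a ^+ N).
  apply: measurable_funX; apply: measurable_dotp; first exact: measurable_id.
  exact: measurable_cst.
have := sphere_mean_orthogonal O1 mh am; congr (has_mean _ _ _).
by apply/funext => w; rewrite dotp_reflection.
Qed.

Let delta j : 'rV[R]_n := delta_mx 0 j.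

Let dotp_deltal j v : dotp (delta j) v = v 0 j.
Proof. by rewrite dotpC dotp_delta. Qed.

Let dotp_delta2 i j : dotp (delta i) (delta j) = (i == j)%:R.
Proof. by rewrite dotp_deltal mxE eqxx. Qed.

Let delta_neq0 i : delta i != 0.
Proof.
by apply/eqP => /matrixP/(_ 0 i)/eqP; rewrite !mxE !eqxx/= oner_eq0.
Qed.

Let sphere_coord_le1 (v : 'rV[R]_n) j : dotp v v = 1 -> `|v 0 j| <= 1.
Proof.
move=> v1; rewrite -(@ler_pXn2r _ 2) ?nnegrE// expr1n real_normK ?num_real//.
by rewrite -v1 sqr_coord_le.
Qed.

(** Functions on the sphere that do not see the reflections in coordinate
    hyperplanes nor the exchange of two coordinates. *)
Definition coord_symmetric h : Prop :=
  (forall i (v : 'rV[R]_n), h (v *m reflection (delta_mx 0 i)) = h v) /\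
  (forall i j (v : 'rV[R]_n), i != j ->
     h (v *m reflection (delta_mx 0 i - delta_mx 0 j)) = h v).

Let flipE (v : 'rV[R]_n) i j :
  (v *m reflection (delta i)) 0 j = if j == i then - v 0 j else v 0 j.
Proof.
rewrite -[LHS]dotp_delta dotp_mul_reflection !dotp_delta2 !dotp_delta eqxx.
by case: eqVneq => [->|_]; rewrite ?mulr0 ?subr0// ?divr1 ?mulr1; lra.
Qed.

Let swapE (v : 'rV[R]_n) i j k : i != j ->
  (v *m reflection (delta i - delta j)) 0 k = v 0 (tperm i j k).
Proof.
move=> ij; rewrite -[LHS]dotp_delta dotp_mul_reflection.
have -> : dotp (delta i - delta j) (delta i - delta j) = 2.
  rewrite !dotpBr !dotpBl !dotp_delta2 !eqxx [j == i]eq_sym (negbTE ij).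
  by rewrite subr0 sub0r opprK.
rewrite divff// mul1r dotpBr !dotpBl !dotp_delta2 !dotp_delta.
case: tpermP => [->|->|/eqP ik /eqP jk].
- by rewrite eqxx [j == i]eq_sym (negbTE ij) subr0 mulr1; lra.
- by rewrite eqxx (negbTE ij) sub0r mulrN1; lra.
- by rewrite [i == k]eq_sym [j == k]eq_sym (negbTE ik) (negbTE jk) subrr mulr0 subr0.
Qed.

(** Reflections in coordinate hyperplanes make the mixed moments vanish, swaps
    of coordinates make the pure ones equal, and these add up to kappa. *)
Lemma sphere_second_moments h (c kappa : R) : measurable_fun setT h ->
  (forall v : 'rV[R]_n, dotp v v = 1 -> `|h v| <= c) -> coord_symmetric h ->
  has_mean Pr (fun w => h (e w)) kappa ->
  forall i j, has_mean Pr
    (fun w => (e w : 'rV[R]_n) 0 i * (e w : 'rV[R]_n) 0 j * h (e w))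
    ((i == j)%:R * (kappa / n%:R)).
Proof.
move=> mh hc [hflip hswap] hk.
pose g i j (v : borel_space R n) := (v : 'rV[R]_n) 0 i * (v : 'rV[R]_n) 0 j * h v.
have mg i j : measurable_fun setT (g i j).
  by apply: measurable_funM => //; exact: measurable_funM.
have gP i j : exists m, has_mean Pr (fun w => g i j (e w)) m.
  apply: (@sphere_has_mean _ c) => // v v1; rewrite /g 2!normrM.
  apply: le_trans (hc v v1); rewrite ler_piMl// -[leRHS]mulr1.
  by apply: ler_pM => //; exact: sphere_coord_le1.
have g0 i j : i != j -> has_mean Pr (fun w => g i j (e w)) 0.
  move=> ij; have [m gm] := gP i j.
  have gm' := sphere_mean_orthogonal (reflection_orthogonal (delta_neq0 i)) (mg i j) gm.
  suff m0 : m = 0 by rewrite -m0.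
  have : has_mean Pr (fun w => g i j (e w)) (- m).
    rewrite -mulN1r; have := has_meanZ (-1) gm'; congr (has_mean _ _ _).
    apply/funext => w; rewrite /g hflip !flipE eqxx eq_sym (negbTE ij).
    by rewrite mulN1r !mulNr opprK.
  by move=> /(has_mean_unique gm) => /eqP; rewrite -addr_eq0 -mulr2n mulrn_eq0 => /eqP.
have gii i j m : has_mean Pr (fun w => g i i (e w)) m ->
    has_mean Pr (fun w => g j j (e w)) m.
  have [<-//|ij] := eqVneq i j => gm.
  have dij : delta i - delta j != 0.
    apply/eqP => /matrixP/(_ 0 i)/eqP; rewrite !mxE !eqxx (negbTE ij)/= subr0.
    by rewrite oner_eq0.
  have := sphere_mean_orthogonal (reflection_orthogonal dij) (mg i i) gm.
  congr (has_mean _ _ _); apply/funext => w.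
  by rewrite /g hswap// !swapE// tpermL.
move=> i j; case: eqVneq => [<-|ij]; last by rewrite mul0r; exact: g0.
rewrite mul1r; have [m gm] := gP i i.
have sm : has_mean Pr (fun w => \sum_(j < n) g j j (e w)) (\sum_(j < n) m).
  by apply: has_mean_sum => k; exact: gii gm.
have : has_mean Pr (fun w => h (e w)) (\sum_(j < n) m).
  apply: has_mean_ae_eq sm; first exact: measurableT_comp.
  apply: filterS sphere_norm_ae => w w1.
  by rewrite /g -mulr_suml -dotpE w1 mul1r.
move=> /(has_mean_unique hk) ->.
rewrite sumr_const card_ord -[_ *+ n]mulr_natr mulfK// pnatr_eq0.
by rewrite -lt0n; exact: leq_ltn_trans (leq0n i) (ltn_ord i).
Qed.

Lemma sphere_moment_exists (k : nat) i : exists m,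
  has_mean Pr (fun w => (e w : 'rV[R]_n) 0 i ^+ k) m.
Proof.
apply: (@sphere_has_mean (fun v : borel_space R n => (v : 'rV[R]_n) 0 i ^+ k) 1).
  exact: measurable_funX.
by move=> v v1; rewrite normrX exprn_ile1// sphere_coord_le1.
Qed.

(** The law of e_i + theta e_j is that of e_i scaled by sqrt(1 + theta^2); the
    coefficients of theta^2 in the moments of order 2k + 2 give a relation
    between the moments of e_i and of (e_i, e_j). *)
Lemma sphere_moment_mixed (k : nat) i j m M : i != j ->
  has_mean Pr (fun w => (e w : 'rV[R]_n) 0 i ^+ (2 * k) *
    (e w : 'rV[R]_n) 0 j ^+ 2) m ->
  has_mean Pr (fun w => (e w : 'rV[R]_n) 0 i ^+ (2 * k.+1)) M ->
  (2 * k + 1)%:R * m = M.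
Proof.
move=> ij mP MP; pose N := (2 * k.+1)%N.
have cE l : exists c, has_mean Pr
    (fun w => (e w : 'rV[R]_n) 0 i ^+ (N - l) * (e w : 'rV[R]_n) 0 j ^+ l) c.
  apply: (@sphere_has_mean (fun v : borel_space R n =>
    (v : 'rV[R]_n) 0 i ^+ (N - l) * (v : 'rV[R]_n) 0 j ^+ l) 1).
    by apply: measurable_funM; exact: measurable_funX.
  move=> v v1; rewrite normrM !normrX -[leRHS]mulr1; apply: ler_pM.
  - by rewrite exprn_ge0.
  - by rewrite exprn_ge0.
  - by rewrite exprn_ile1// sphere_coord_le1.
  - by rewrite exprn_ile1// sphere_coord_le1.
have [c cP] := choice cE.
pose p : {poly R} := \poly_(l < N.+1) (c l *+ 'C(N, l)).
pose q : {poly R} := M *: (1 + 'X^2) ^+ k.+1.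
have pq : p = q.
  apply: poly_horner_inj => th.
  have expand : has_mean Pr
      (fun w => dotp (e w) (delta i + th *: delta j) ^+ N) p.[th].
    rewrite horner_poly.
    have : has_mean Pr (fun w => \sum_(l < N.+1)
        (th ^+ l *+ 'C(N, l)) * ((e w : 'rV[R]_n) 0 i ^+ (N - l) *
          (e w : 'rV[R]_n) 0 j ^+ l))
        (\sum_(l < N.+1) (th ^+ l *+ 'C(N, l)) * c l).
      by apply: has_mean_sum => l; exact: has_meanZ.
    congr (has_mean _ _ _).
      apply/funext => w; rewrite dotpDr dotpZr !dotp_delta exprDn.
      apply: eq_bigr => l _; rewrite exprMn mulrnAl; congr (_ *+ _); ring.
    by apply: eq_bigr => l _; rewrite !mulrnAl mulrC.
  have th0 : 0 <= 1 + th ^+ 2 by rewrite addr_ge0// sqr_ge0.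
  have : has_mean Pr (fun w => dotp (e w) (delta i + th *: delta j) ^+ N)
      (Num.sqrt (1 + th ^+ 2) ^+ N * M).
    apply: (@sphere_mean_dotp N (Num.sqrt (1 + th ^+ 2) *: delta i)).
      rewrite dotpZl dotpZr mulrA -expr2 sqr_sqrtr// !dotpDl !dotpDr.
      rewrite !dotpZl !dotpZr !dotp_delta2 !eqxx [j == i]eq_sym (negbTE ij)/=; ring.
    have := has_meanZ (Num.sqrt (1 + th ^+ 2) ^+ N) MP; congr (has_mean _ _ _).
    by apply/funext => w; rewrite dotpZr dotp_delta exprMn.
  move=> /(has_mean_unique expand) ->.
  rewrite /q hornerZ horner_exp !hornerE /N exprM sqr_sqrtr//.
  by rewrite mulrC.
have : p`_2 = q`_2 by rewrite pq.
rewrite coef_poly coefZ coef2_expr1DX2 /N.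
have -> : (2 < (2 * k.+1).+1)%N by rewrite mulnS.
have -> : c 2%N = m.
  apply: has_mean_unique (cP 2%N) _; move: mP; rewrite /N mulnS addKn.
  exact.
have -> : 'C(2 * k.+1, 2) = (k.+1 * (2 * k + 1))%N.
  by rewrite bin2 -divn2 mulnS -pred_Sn -mulnS addn1 -mulnA mulKn.
rewrite -[m *+ _]mulr_natr natrM => E.
apply: (@mulfI _ k.+1%:R); first by rewrite pnatr_eq0.
by rewrite mulrA mulrC E mulrC.
Qed.

(** Summing the mixed moments over the second coordinate, whose squares add up
    to 1, compares consecutive even moments. *)
Lemma sphere_moment_step (k : nat) i m M : 
  has_mean Pr (fun w => (e w : 'rV[R]_n) 0 i ^+ (2 * k)) m ->
  has_mean Pr (fun w => (e w : 'rV[R]_n) 0 i ^+ (2 * k.+1)) M ->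
  n%:R * M <= (2 * k + 1)%:R * m.
Proof.
move=> mP MP.
pose c j := if j == i then M else M / (2 * k + 1)%:R.
have cP j : has_mean Pr (fun w => (e w : 'rV[R]_n) 0 i ^+ (2 * k) *
    (e w : 'rV[R]_n) 0 j ^+ 2) (c j).
  rewrite /c; case: eqVneq => [->|ji].
    by move: MP; rewrite mulnS addnC; under eq_fun do rewrite exprD.
  have [z zP] : exists z, has_mean Pr (fun w => (e w : 'rV[R]_n) 0 i ^+ (2 * k) *
    (e w : 'rV[R]_n) 0 j ^+ 2) z.
    apply: (@sphere_has_mean (fun v : borel_space R n =>
      (v : 'rV[R]_n) 0 i ^+ (2 * k) * (v : 'rV[R]_n) 0 j ^+ 2) 1).
      by apply: measurable_funM; exact: measurable_funX.
    move=> v v1; rewrite normrM !normrX -[leRHS]mulr1; apply: ler_pM.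
    - by rewrite exprn_ge0.
    - by rewrite exprn_ge0.
    - by rewrite exprn_ile1// sphere_coord_le1.
    - by rewrite exprn_ile1// sphere_coord_le1.
  rewrite -(sphere_moment_mixed _ zP MP) 1?eq_sym//.
  by rewrite mulrC mulKf// pnatr_eq0 addn1.
have : has_mean Pr (fun w => (e w : 'rV[R]_n) 0 i ^+ (2 * k)) (\sum_(j < n) c j).
  apply: has_mean_ae_eq (has_mean_sum (index_enum 'I_n) cP).
    by apply: measurable_funX; exact: (measurableT_comp (me_coord i) me).
  apply: filterS sphere_norm_ae => w w1; rewrite -mulr_sumr.
  suff -> : \sum_(j < n) (e w : 'rV[R]_n) 0 j ^+ 2 = 1 by rewrite mulr1.
  by rewrite -w1 dotpE; apply: eq_bigr => j _; rewrite expr2.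
move=> /(has_mean_unique mP) ->.
have M0 : 0 <= M.
  apply: has_mean_ae_ge0 MP; apply: aeW => w.
  by rewrite exprM exprn_ge0// sqr_ge0.
have k0 : 0 < (2 * k + 1)%:R :> R by rewrite ltr0n addn1.
apply: (@le_trans _ _ ((2 * k + 1)%:R * (\sum_(j < n) M / (2 * k + 1)%:R))).
  rewrite sumr_const card_ord -[_ *+ n]mulr_natl.
  by apply: eq_ler; field; rewrite gt_eqF.
rewrite ler_pM2l//; apply: ler_sum => j _; rewrite /c; case: eqP => // _.
by rewrite ler_pdivrMr// ler_peMr// ler1n addn1.
Qed.

(** The even moments of a coordinate. The exact value is the product of the
    (2l+1)/(n+2l) for l < k; each factor is bounded by (2k-1)/n. *)
Lemma sphere_moment_le (k : nat) i M : (0 < n)%N ->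
  has_mean Pr (fun w => (e w : 'rV[R]_n) 0 i ^+ (2 * k)) M ->
  M <= ((2 * k).-1%:R / n%:R) ^+ k.
Proof.
move=> n0; have nR : 0 < n%:R :> R by rewrite ltr0n.
suff H l : (l <= k)%N -> forall M,
    has_mean Pr (fun w => (e w : 'rV[R]_n) 0 i ^+ (2 * l)) M ->
    M <= ((2 * k).-1%:R / n%:R) ^+ l by exact: H.
elim: l => [_ {}M MP|l ih lk {}M MP].
  suff -> : M = 1 by rewrite expr0.
  by apply: has_mean_unique MP _; rewrite muln0; exact: (has_mean_cst Pr 1).
have [m mP] := sphere_moment_exists (2 * l) i.
have step := sphere_moment_step mP MP.
have m0 : 0 <= m.
  apply: has_mean_ae_ge0 mP; apply: aeW => w.
  by rewrite exprM exprn_ge0// sqr_ge0.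
rewrite exprS.
apply: (@le_trans _ _ ((2 * k).-1%:R / n%:R * m)).
  rewrite mulrAC ler_pdivlMr// mulrC; apply: le_trans step _.
  rewrite ler_wpM2r// ler_nat.
  by case: k lk {ih} => // k lk; rewrite mulnS addn1 /= ltnS leq_mul2l.
apply: ler_wpM2l; first by rewrite divr_ge0.
by apply: ih => //; exact: ltnW.
Qed.

(** The polynomials that bound the squared dual norm. *)
Definition power_sum (A B : R) (k : nat) (v : 'rV[R]_n) : R :=
  A + B * \sum_(j < n) v 0 j ^+ (2 * k).

Lemma measurable_power_sum A B k :
  measurable_fun setT (power_sum A B k : borel_space R n -> R).
Proof.
apply: measurable_funD; first exact: measurable_cst.
apply: measurable_funM; first exact: measurable_cst.
by apply: measurable_sum => j; exact: measurable_funX.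
Qed.

Lemma power_sum_symmetric A B k : coord_symmetric (power_sum A B k).
Proof.
split=> [i v|i j v ij]; rewrite /power_sum; congr (_ + _ * _).
  apply: eq_bigr => l _; rewrite flipE; case: eqP => // _.
  by rewrite exprM sqrrN -exprM.
rewrite [RHS](reindex_inj (@perm_inj _ (tperm i j))).
by apply: eq_bigr => l _; rewrite swapE.
Qed.

Lemma power_sum_ge0 A B k v : 0 <= A -> 0 <= B -> 0 <= power_sum A B k v.
Proof.
move=> A0 B0; rewrite addr_ge0// mulr_ge0// sumr_ge0// => j _.
by rewrite exprM exprn_ge0// sqr_ge0.
Qed.

Lemma power_sum_bounded A B k (v : 'rV[R]_n) : 0 <= A -> 0 <= B ->
  dotp v v = 1 -> `|power_sum A B k v| <= A + B * n%:R.
Proof.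
move=> A0 B0 v1; rewrite ger0_norm ?power_sum_ge0// lerD2l ler_wpM2l//.
rewrite -[n in leRHS]card_ord -sumr_const; apply: ler_sum => j _.
apply: (le_trans (ler_norm _)).
by rewrite normrX exprn_ile1// sphere_coord_le1.
Qed.

Lemma power_sum_mean A B k : (0 < n)%N -> 0 <= A -> 0 <= B ->
  exists2 kappa, has_mean Pr (fun w => power_sum A B k (e w)) kappa &
    kappa <= A + B * (n%:R * ((2 * k).-1%:R / n%:R) ^+ k).
Proof.
move=> n0 A0 B0.
have [M MP] := choice (sphere_moment_exists (2 * k)).
exists (A + B * \sum_(j < n) M j).
  apply: has_meanD; first exact: has_mean_cst.
  by apply: has_meanZ; exact: has_mean_sum.
rewrite lerD2l ler_wpM2l//.
apply: (@le_trans _ _ (\sum_(j < n) ((2 * k).-1%:R / n%:R) ^+ k)).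
  by apply: ler_sum => j _; exact: sphere_moment_le (MP j).
by apply: eq_ler; rewrite sumr_const card_ord [RHS]mulr_natl.
Qed.

(** Independence of direction and length: the covariance of the direction,
    weighted by a symmetric function of mean kappa, is kappa / n times the
    identity. *)
Lemma sphere_bilinear h (c kappa : R) u v : measurable_fun setT h ->
  (forall v : 'rV[R]_n, dotp v v = 1 -> `|h v| <= c) -> coord_symmetric h ->
  has_mean Pr (fun w => h (e w)) kappa ->
  has_mean Pr (fun w => dotp u (e w) * dotp v (e w) * h (e w))
    (dotp u v * (kappa / n%:R)).
Proof.
move=> mh hc hs hk.
have H := sphere_second_moments mh hc hs hk.
have : has_mean Pr (fun w => \sum_(i < n) \sum_(j < n)
    (u 0 i * v 0 j) * ((e w : 'rV[R]_n) 0 i * (e w : 'rV[R]_n) 0 j * h (e w)))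
    (\sum_(i < n) \sum_(j < n) (u 0 i * v 0 j) * ((i == j)%:R * (kappa / n%:R))).
  by apply: has_mean_sum => i; apply: has_mean_sum => j; exact: has_meanZ.
congr (has_mean _ _ _).
  apply/funext => w; rewrite !dotpE mulr_suml mulr_suml; apply: eq_bigr => i _.
  rewrite mulr_sumr mulr_suml; apply: eq_bigr => j _; ring.
rewrite dotpE mulr_suml; apply: eq_bigr => i _.
rewrite (bigD1 i)//= eqxx mul1r big1 ?addr0// => j ij.
by rewrite eq_sym (negbTE ij) mul0r mulr0.
Qed.

End sphere.

(** * The stochastic objective *)

Section objective.
Context {R : realType} {n : nat} {dX : measure_display} {X : measurableType dX}.
Variable P : probability X R.
Variables (F : 'rV[R]_n -> X -> R) (f : 'rV[R]_n -> R).
Variables (g : 'rV[R]_n -> X -> 'rV[R]_n) (L : X -> R) (L2 sigma : R).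
Hypothesis F_int : forall x, P.-integrable setT (fun s => (F x s)%:E).
Hypothesis f_def : forall x, ((f x)%:E = 'E_P[F x])%E.
Hypothesis g_meas : measurable_fun setT
  (fun z : borel_space R n * X => g z.1 z.2 : borel_space R n).
Hypothesis L_meas : measurable_fun setT L.
Hypothesis g_grad : {ae P, forall s,
   (forall x, has_grad (F ^~ s) x (g x s)) /\
   (forall x y, norm2 (g x s - g y s) <= L s * norm2 (x - y))}.
Hypothesis L2_gt0 : 0 < L2.
Hypothesis L_bound : (sqrte 'E_P[fun s => (L s ^+ 2)%R] <= L2%:E)%E.
Hypothesis g_var : forall x,
  ('E_P[fun s => (norm2 (g x s - grad f x) ^+ 2)%R] <= (sigma ^+ 2)%:E)%E.

Lemma objective_mean x : has_mean P (F x) (f x).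
Proof.
split; first exact: F_int.
by rewrite f_def unlock.
Qed.

Let expectation_finite (Y : X -> R) (c : R) : measurable_fun setT Y ->
  (forall s, 0 <= Y s) -> ('E_P[Y] <= c%:E)%E ->
  exists2 a, has_mean P Y a & a <= c.
Proof.
rewrite unlock => mY Y0 Yc; have Yoo := le_lt_trans Yc (ltry c).
have YP := has_mean_ge0 mY Y0 Yoo; eexists; first exact: YP.
by have [_ E] := YP; rewrite -lee_fin -E.
Qed.

(** Smoothness of a realization. *)
Lemma realization_smooth : {ae P, forall s x y,
  `|F y s - F x s - dotp (g x s) (y - x)| <= L s / 2 * dotp (y - x) (y - x)}.
Proof.
apply: filterS g_grad => s [hg hL] x y; have [_ <-] := hg x.
apply: (descent_lemma (h := F ^~ s)) => [z|u v]; first by have [] := hg z.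
by have [_ ->] := hg u; have [_ ->] := hg v.
Qed.

Lemma L2_mean : exists2 l, has_mean P (fun s => L s ^+ 2) l & l <= L2 ^+ 2.
Proof.
apply: expectation_finite => [|s|]; first exact: measurable_funX.
  exact: sqr_ge0.
have E0 : (0 <= 'E_P[fun s => (L s ^+ 2)%R])%E.
  by apply: expectation_ge0 => s; exact: sqr_ge0.
move: L_bound E0; case: ('E_P[_])%E => [r||]//=; rewrite !lee_fin => rL r0.
rewrite -(sqr_sqrtr r0) lerXn2r ?nnegrE ?sqrtr_ge0//.
exact: ltW.
Qed.

Lemma L_mean : exists2 l, has_mean P L l & l <= L2.
Proof.
have [l lP lL] := L2_mean.
have [l1 l1P] : exists l1, has_mean P L l1.
  apply: (has_mean_dominated L_meas _ (has_meanD (has_mean_cst P 1) lP)).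
  apply: aeW => s /=; rewrite -[L s ^+ 2]real_normK ?num_real//.
  by move: (`|L s|) => y; nra.
exists l1 => //.
have : l1 <= L2^-1 / 2 * l + L2 / 2.
  apply: has_mean_le l1P (has_meanD (has_meanZ _ lP) (has_mean_cst P _)).
  apply: aeW => s /=; rewrite -subr_ge0.
  have -> : L2^-1 / 2 * L s ^+ 2 + L2 / 2 - L s = L2^-1 / 2 * (L s - L2) ^+ 2.
    by field; rewrite gt_eqF.
  by rewrite mulr_ge0 ?sqr_ge0// divr_ge0// invr_ge0 ltW.
move=> /le_trans; apply; apply: (@le_trans _ _ (L2^-1 / 2 * L2 ^+ 2 + L2 / 2)).
  by rewrite lerD2r ler_wpM2l// divr_ge0// invr_ge0 ltW.
by apply: eq_ler; field; rewrite gt_eqF.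
Qed.

Lemma g_measurable x : measurable_fun setT (g x : X -> borel_space R n).
Proof. exact: (measurableT_comp g_meas (@pair1_measurable _ _ (borel_space R n) X x)). Qed.

Let gbarP x j : exists a, has_mean P (fun s => g x s 0 j) a.
Proof.
have [l lP _] := L_mean.
have [c1 c1P] := integrable_has_mean (integrable_norm (F_int (x + delta_mx 0 j))).
have [c2 c2P] := integrable_has_mean (integrable_norm (F_int x)).
apply: has_mean_dominated (has_meanD (has_meanD c1P c2P) (has_meanZ 2^-1 lP)).
  exact: (measurable_to_borelP (g_measurable x)).
apply: filterS realization_smooth => s /(_ x (x + delta_mx 0 j)).
rewrite [x + _]addrC addrK !dotp_delta mxE !eqxx mulr1 => hs /=.
move: hs; rewrite !ler_norml.
have := ler_norm (F (delta_mx 0 j + x) s); have := ler_norm (F x s).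
have := ler_norm (- F (delta_mx 0 j + x) s); have := ler_norm (- F x s).
rewrite !normrN; move: (F _ s) (F x s) (g x s 0 j) => a b c.
by move=> h1 h2 h3 h4 /andP[h5 h6]; apply/andP; lra.
Qed.

(** The mean of the stochastic gradient is the gradient of the objective. *)
Lemma objective_gradient x :
  (forall j, has_mean P (fun s => g x s 0 j) (grad f x 0 j)) /\
  (forall y, `|f y - f x - dotp (grad f x) (y - x)| <= L2 / 2 * dotp (y - x) (y - x)).
Proof.
have [gb gbP] := choice (gbarP x); have [l lP lL] := L_mean.
pose v : 'rV[R]_n := \row_j gb j.
have vP w : has_mean P (fun s => dotp (g x s) w) (dotp v w).
  have : has_mean P (fun s => \sum_(j < n) w 0 j * g x s 0 j)
      (\sum_(j < n) w 0 j * gb j).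
    by apply: has_mean_sum => j; exact: has_meanZ.
  congr (has_mean _ _ _).
    by apply/funext => s; rewrite dotpE; apply: eq_bigr => j _; rewrite mulrC.
  by rewrite dotpE; apply: eq_bigr => j _; rewrite mxE mulrC.
have quad y : `|f y - f x - dotp v (y - x)| <= L2 / 2 * dotp (y - x) (y - x).
  have h := has_meanB (has_meanB (objective_mean y) (objective_mean x)) (vP (y - x)).
  have hq := has_meanZ (dotp (y - x) (y - x) / 2) lP.
  have qL : dotp (y - x) (y - x) / 2 * l <= L2 / 2 * dotp (y - x) (y - x).
    have d0 : 0 <= dotp (y - x) (y - x) by exact: dotp_ge0.
    by move: (dotp _ _) d0 => D D0; nra.
  rewrite ler_norml lerNl; apply/andP; split; apply: le_trans qL.
    rewrite -mulN1r; apply: has_mean_le (has_meanZ (-1) h) hq.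
    apply: filterS realization_smooth => s /(_ x y); rewrite mulN1r.
    have -> : dotp (y - x) (y - x) / 2 * L s = L s / 2 * dotp (y - x) (y - x).
      by ring.
    move=> hs; by apply: le_trans hs; rewrite -normrN ler_norm.
  apply: has_mean_le h hq; apply: filterS realization_smooth => s /(_ x y) hs.
  have -> : dotp (y - x) (y - x) / 2 * L s = L s / 2 * dotp (y - x) (y - x).
    by ring.
  by apply: le_trans hs; rewrite ler_norm.
have [_ gv] : has_grad f x v.
  by apply: (quadratic_bound_grad (c := L2 / 2)) => //; rewrite divr_ge0// ltW.
by rewrite gv; split => // j; rewrite mxE.
Qed.

(** The second moments of the noise of the stochastic gradient. *)
Lemma gradient_noise x : exists v : 'I_n -> 'I_n -> R,
  (forall i j, has_mean P
    (fun s => (g x s - grad f x) 0 i * (g x s - grad f x) 0 j) (v i j)) /\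
  \sum_(j < n) v j j <= sigma ^+ 2.
Proof.
pose h s := g x s - grad f x.
have mh : measurable_fun setT (h : X -> borel_space R n).
  apply: measurable_addv; [exact: g_measurable|exact: measurable_cst].
have mhj j : measurable_fun setT (fun s => h s 0 j).
  exact: (measurable_to_borelP mh).
have [V VP VL] : exists2 V, has_mean P (fun s => norm2 (h s) ^+ 2) V & V <= sigma ^+ 2.
  apply: expectation_finite; [|by move=> s; exact: sqr_ge0|exact: g_var].
  under eq_fun do rewrite norm2_sqr.
  exact: measurable_dotp.
have vE i j : exists v, has_mean P (fun s => h s 0 i * h s 0 j) v.
  apply: (has_mean_dominated _ _ VP); first exact: measurable_funM.
  apply: aeW => s; rewrite norm2_sqr; have := sqr_coord_le (h s) i.
  have := sqr_coord_le (h s) j; rewrite normrM.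
  rewrite -[h s 0 i ^+ 2]real_normK ?num_real// -[h s 0 j ^+ 2]real_normK ?num_real//.
  move: (`|h s 0 i|) (`|h s 0 j|) (dotp _ _) => a b D aD bD.
  have := sqr_ge0 (a - b); rewrite sqrrB; lra.
have vE2 i : exists v, forall j, has_mean P (fun s => h s 0 i * h s 0 j) (v j).
  by have [v vP] := choice (vE i); exists v.
have [v vP] := choice vE2.
exists v; split => //; apply: le_trans VL; apply: eq_ler.
apply: has_mean_unique VP; have := has_mean_sum (index_enum 'I_n) (fun j => vP j j).
congr (has_mean _ _ _); apply/funext => s; rewrite norm2_sqr dotpE.
by [].
Qed.

End objective.

(** * One step of the method *)

Lemma sqr_average_le (R : realType) (m : nat) (u : 'I_m -> R) : (0 < m)%N ->
  (m%:R^-1 * \sum_(i < m) u i) ^+ 2 <= m%:R^-1 * \sum_(i < m) u i ^+ 2.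
Proof.
move=> m0; have mR : 0 < m%:R :> R by rewrite ltr0n.
have := sqr_dotp_le (\row_i u i) (const_mx 1).
have -> : dotp (\row_i u i) (const_mx 1) = \sum_(i < m) u i.
  by rewrite dotpE; apply: eq_bigr => i _; rewrite !mxE mulr1.
have -> : dotp (\row_i u i) (\row_i u i) = \sum_(i < m) u i ^+ 2.
  by rewrite dotpE; apply: eq_bigr => i _; rewrite !mxE expr2.
have -> : dotp (const_mx 1 : 'rV[R]_m) (const_mx 1) = m%:R.
  rewrite dotpE (eq_bigr (fun=> 1)); last by move=> i _; rewrite !mxE mulr1.
  by rewrite sumr_const card_ord.
move: (\sum_(i < m) _) (\sum_(i < m) _) => S Q SQ.
rewrite exprMn exprVn expr2 invfM -mulrA ler_pM2l ?invr_gt0//.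
by rewrite ler_pdivrMl// mulrC.
Qed.

(** The pointwise estimate behind the step: y, s, H, b stand for the component
    of the displacement along the direction, and for the three parts of the
    finite difference (gradient, noise, error). *)
Lemma step_pointwise (R : realFieldType) (a lam D K V y s H b beta c : R) :
  0 < lam -> 0 <= K -> b ^+ 2 <= beta -> c = s + H + b ->
  V + a * (c * y) <= D + a ^+ 2 * (c ^+ 2 * K) / 2 ->
  V <= D + 2 * a ^+ 2 * (s * s * K) + 2 * a ^+ 2 * (H * H * K)
       + a ^+ 2 * (beta * K) - a * (s * y) - a * (H * y)
       + lam / 2 * (y * y) + a ^+ 2 / (2 * lam) * beta.
Proof.
move=> lam0 K0 bbeta -> HV.
have h1 : (s + H + b) ^+ 2 * K <= (4 * (s * s) + 4 * (H * H) + 2 * beta) * K.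
  apply: ler_wpM2r => //.
  have := sqr_ge0 (s - H); have := sqr_ge0 (s + H - b).
  by rewrite !expr2 in bbeta *; nra.
have h2 : - (a * (b * y)) <= lam / 2 * (y * y) + a ^+ 2 / (2 * lam) * beta.
  apply: (@le_trans _ _ (lam / 2 * (y * y) + a ^+ 2 / (2 * lam) * b ^+ 2)).
    rewrite -subr_ge0.
    have -> : lam / 2 * (y * y) + a ^+ 2 / (2 * lam) * b ^+ 2 - - (a * (b * y))
      = (lam * y + a * b) ^+ 2 / (2 * lam) by field; rewrite gt_eqF.
    by rewrite divr_ge0 ?sqr_ge0// mulr_ge0// ltW.
  rewrite lerD2l ler_wpM2l// divr_ge0 ?sqr_ge0// mulr_ge0//; exact: ltW.
have h3 : a ^+ 2 * ((s + H + b) ^+ 2 * K) / 2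
    <= a ^+ 2 * ((4 * (s * s) + 4 * (H * H) + 2 * beta) * K) / 2.
  by rewrite ler_wpM2r// ler_wpM2l// sqr_ge0.
have e1 : a ^+ 2 * ((4 * (s * s) + 4 * (H * H) + 2 * beta) * K) / 2 =
  2 * a ^+ 2 * (s * s * K) + 2 * a ^+ 2 * (H * H * K) + a ^+ 2 * (beta * K).
  by field.
have e2 : a * ((s + H + b) * y) = a * (s * y) + a * (H * y) + a * (b * y) by ring.
move: HV h2 h3; rewrite e1 e2.
move: (a ^+ 2 * ((s + H + b) ^+ 2 * K) / 2) (2 * a ^+ 2 * (s * s * K)).
move: (2 * a ^+ 2 * (H * H * K)) (a ^+ 2 * (beta * K)) (a * (s * y)) (a * (H * y)).
move: (a * (b * y)) (lam / 2 * (y * y)) (a ^+ 2 / (2 * lam) * beta) => *.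
lra.
Qed.

(** The expected step in an abstract form. The direction e is measurable for
    the sigma-algebra generated by He, the noises h i of the m sample gradients
    and the bounds u i of the m errors for the one generated by Hx, which is
    independent of it; the h i are moreover pairwise independent, h i being
    measurable for the sigma-algebra generated by Hi i. The matrix v holds the
    second moments of the noises, and b0 is the mean of the squares of the u i. *)
Section one_step.
Context {R : realType} {n m : nat} {d : measure_display} {Omega : measurableType d}.
Hypotheses (n0 : (0 < n)%N) (m0 : (0 < m)%N).
Variable Pr : probability Omega R.
Variables (He Hx : set (set Omega)) (Hi : 'I_m -> set (set Omega)).
Hypothesis indep_ex : independent Pr <<s Hx >> <<s He >>.
Hypothesis indep_ii : forall i j, i != j ->
  independent Pr <<s Hi i >> <<s Hi j >>.
Variable e : Omega -> borel_space R n.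
Hypothesis me : measurable_fun setT e.
Hypothesis meH : measurable_fun setT (e : g_sigma_algebraType He -> borel_space R n).
Hypothesis ue : uniform_on_sphere (pushforward Pr e).
Variables (h : 'I_m -> Omega -> borel_space R n) (u : 'I_m -> Omega -> R).
Hypothesis mhx : forall i,
  measurable_fun setT (h i : g_sigma_algebraType Hx -> borel_space R n).
Hypothesis mhi : forall i,
  measurable_fun setT (h i : g_sigma_algebraType (Hi i) -> borel_space R n).
Hypothesis mux : forall i, measurable_fun setT (u i : g_sigma_algebraType Hx -> R).
Variable v : 'I_n -> 'I_n -> R.
Hypothesis h_mean : forall i j, has_mean Pr (fun w => (h i w : 'rV[R]_n) 0 j) 0.
Hypothesis h_cov : forall i j k, has_mean Pr
  (fun w => (h i w : 'rV[R]_n) 0 j * (h i w : 'rV[R]_n) 0 k) (v j k).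
Variable b0 : R.
Hypothesis u_mean : forall i, has_mean Pr (fun w => u i w ^+ 2) b0.

Let H w := m%:R^-1 * \sum_(i < m) dotp (h i w) (e w).
Let beta w := m%:R^-1 * \sum_(i < m) u i w ^+ 2.

Let beta_mean : has_mean Pr beta b0.
Proof.
have := has_meanZ m%:R^-1 (has_mean_sum (index_enum 'I_m) u_mean).
rewrite sumr_const card_ord -[b0 *+ m]mulr_natl mulKf// pnatr_eq0 -lt0n.
exact.
Qed.

Let mbeta : measurable_fun setT (beta : g_sigma_algebraType Hx -> R).
Proof.
apply: measurable_funM; first exact: measurable_cst.
by apply: measurable_sum => i; exact: measurable_funX.
Qed.

Let mej j : measurable_fun setT
  ((fun w => (e w : 'rV[R]_n) 0 j) : g_sigma_algebraType He -> R).
Proof. exact: (measurable_to_borelP meH). Qed.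

Let mhxj i j : measurable_fun setT
  ((fun w => (h i w : 'rV[R]_n) 0 j) : g_sigma_algebraType Hx -> R).
Proof. exact: (measurable_to_borelP (mhx i)). Qed.

Let mhij i j : measurable_fun setT
  ((fun w => (h i w : 'rV[R]_n) 0 j) : g_sigma_algebraType (Hi i) -> R).
Proof.
exact: (measurable_to_borelP (@mhi i)).
Qed.

Variables (A0 B0 : R) (k : nat) (kappa : R).
Hypotheses (A0_ge0 : 0 <= A0) (B0_ge0 : 0 <= B0).
Let K := power_sum A0 B0 k : 'rV[R]_n -> R.
Hypothesis K_mean : has_mean Pr (fun w => K (e w)) kappa.

Let mKe : measurable_fun setT ((fun w => K (e w)) : g_sigma_algebraType He -> R).
Proof.
exact: (measurableT_comp (measurable_power_sum A0 B0 k) meH).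
Qed.

Let e_bilinear gr w0 : has_mean Pr (fun w => dotp gr (e w) * dotp w0 (e w) * K (e w))
  (dotp gr w0 * (kappa / n%:R)).
Proof.
apply: (@sphere_bilinear _ _ _ _ Pr e me ue K (A0 + B0 * n%:R) kappa) => //.
  exact: measurable_power_sum.
  by move=> z; exact: power_sum_bounded.
exact: power_sum_symmetric.
Qed.

Let e_bilinear1 gr w0 : has_mean Pr (fun w => dotp gr (e w) * dotp w0 (e w))
  (dotp gr w0 / n%:R).
Proof.
have := @sphere_bilinear _ _ _ _ Pr e me ue (cst 1) 1 1 gr w0 (measurable_cst _).
rewrite mul1r; under [X in _ -> _ -> _ -> has_mean _ X _]eq_fun do rewrite mulr1.
by apply => // [z _|]; [rewrite normr1|exact: has_mean_cst].
Qed.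

Let noise_linear w0 : has_mean Pr (fun w => H w * dotp w0 (e w)) 0.
Proof.
have term i j : has_mean Pr (fun w => (h i w : 'rV[R]_n) 0 j *
    (dotp (delta_mx 0 j) (e w) * dotp w0 (e w))) 0.
  rewrite -(mul0r (dotp (delta_mx 0 j) w0 / n%:R)).
  apply: (has_mean_mul indep_ex) => //.
  apply: measurable_funM; apply: measurable_dotp => //; exact: measurable_cst.
have := has_meanZ m%:R^-1 (has_mean_sum (index_enum 'I_m) (fun i =>
  has_mean_sum (index_enum 'I_n) (term i))).
rewrite big1 ?mulr0; last by move=> i _; rewrite big1.
congr (has_mean _ _ _); apply/funext => w; rewrite /H -mulrA; congr (_ * _).
rewrite mulr_suml; apply: eq_bigr => i _; rewrite [in RHS]dotpE mulr_suml.
by apply: eq_bigr => j _; rewrite dotpC dotp_delta mulrA.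
Qed.

Let h_mean2 i i' j j' : exists2 z, has_mean Pr
    (fun w => (h i w : 'rV[R]_n) 0 j * (h i' w : 'rV[R]_n) 0 j') z &
  z = if i == i' then v j j' else 0.
Proof.
case: eqVneq => [<-|ii]; first by exists (v j j').
exists (0 * 0); last by rewrite mul0r.
by apply: (has_mean_mul (indep_ii ii)).
Qed.

(* Only the terms with i = i' and j = j' contribute: the noises are centred
   and pairwise independent, and the second moments of e weighted by K are
   diagonal. *)
Let noise_quadratic : has_mean Pr (fun w => H w * H w * K (e w))
  ((\sum_(j < n) v j j) * kappa / (n%:R * m%:R)).
Proof.
pose c (i i' : 'I_m) (j j' : 'I_n) : R :=
  (if i == i' then v j j' else 0) * ((j == j')%:R * (kappa / n%:R)).
have term i i' j j' : has_mean Pr (fun w => (h i w : 'rV[R]_n) 0 j *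
    (h i' w : 'rV[R]_n) 0 j' * (dotp (delta_mx 0 j) (e w) *
    dotp (delta_mx 0 j') (e w) * K (e w))) (c i i' j j').
  have [z zP zE] := h_mean2 i i' j j'.
  rewrite /c -zE; apply: (has_mean_mul indep_ex) => //.
  - exact: measurable_funM.
  - apply: measurable_funM => //.
    by apply: measurable_funM; apply: measurable_dotp => //; exact: measurable_cst.
  - have := e_bilinear (delta_mx 0 j) (delta_mx 0 j').
    by rewrite dotp_delta mxE eqxx eq_sym.
have := has_meanZ (m%:R^-1 * m%:R^-1) (has_mean_sum (index_enum 'I_m) (fun i =>
  has_mean_sum (index_enum 'I_m) (fun i' => has_mean_sum (index_enum 'I_n)
  (fun j => has_mean_sum (index_enum 'I_n) (term i i' j))))).
congr (has_mean _ _ _).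
  apply/funext => w; rewrite /H.
  have -> : \sum_(i < m) \sum_(i' < m) \sum_(j < n) \sum_(j' < n)
      (h i w : 'rV[R]_n) 0 j * (h i' w : 'rV[R]_n) 0 j' *
      (dotp (delta_mx 0 j) (e w) * dotp (delta_mx 0 j') (e w) * K (e w)) =
    (\sum_(i < m) dotp (h i w) (e w)) * (\sum_(i < m) dotp (h i w) (e w)) * K (e w).
    rewrite mulr_suml mulr_suml; apply: eq_bigr => i _.
    rewrite mulr_sumr mulr_suml; apply: eq_bigr => i' _.
    rewrite !dotpE mulr_suml mulr_suml; apply: eq_bigr => j _.
    rewrite mulr_sumr mulr_suml; apply: eq_bigr => j' _.
    by rewrite ![dotp (delta_mx _ _) _]dotpC !dotp_delta; ring.
  by ring.
have mR : m%:R != 0 :> R by rewrite pnatr_eq0 -lt0n.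
have nR : n%:R != 0 :> R by rewrite pnatr_eq0 -lt0n.
have -> : \sum_(i < m) \sum_(i' < m) \sum_(j < n) \sum_(j' < n) c i i' j j' =
    \sum_(i < m) (\sum_(j < n) v j j) * (kappa / n%:R).
  apply: eq_bigr => i _; rewrite (bigD1 i)//= [X in _ + X]big1 ?addr0.
    rewrite mulr_suml; apply: eq_bigr => j _.
    rewrite (bigD1 j)//= big1 ?addr0; first by rewrite /c !eqxx mul1r.
    by move=> j' jj; rewrite /c [j == j']eq_sym (negbTE jj) mul0r mulr0.
  move=> i' ii; rewrite big1// => j _; rewrite big1// => j' _.
  by rewrite /c [i == i']eq_sym (negbTE ii) mul0r.
rewrite sumr_const card_ord -[_ *+ m]mulr_natl.
by field; rewrite mR nR.
Qed.

(** V is the divergence after the step, D the one before it, w0 the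
    displacement from the minimizer, gr the gradient at the current point, and
    c the average of the finite difference quotients. *)
Lemma step_mean (gr w0 : 'rV[R]_n) (a lam D : R) (c V : Omega -> R) :
  0 < lam -> measurable_fun setT V -> (forall w, 0 <= V w) ->
  {ae Pr, forall w,
    `|c w - dotp gr (e w) - H w| <= m%:R^-1 * \sum_(i < m) u i w} ->
  (forall w, V w + a * (c w * dotp w0 (e w))
     <= D + a ^+ 2 * (c w ^+ 2 * K (e w)) / 2) ->
  exists2 z, has_mean Pr V z &
    z + a * (dotp gr w0 / n%:R) <=
      D + lam / 2 * (dotp w0 w0 / n%:R) + a ^+ 2 / (2 * lam) * b0
      + 2 * a ^+ 2 * (dotp gr gr * (kappa / n%:R))
      + 2 * a ^+ 2 * ((\sum_(j < n) v j j) * kappa / (n%:R * m%:R))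
      + a ^+ 2 * (b0 * kappa).
Proof.
move=> lam0 mV V0 cH cV.
have K0 w : 0 <= K (e w) by exact: power_sum_ge0.
have pieces : has_mean Pr (fun w =>
    D + 2 * a ^+ 2 * (dotp gr (e w) * dotp gr (e w) * K (e w))
    + 2 * a ^+ 2 * (H w * H w * K (e w)) + a ^+ 2 * (beta w * K (e w))
    - a * (dotp gr (e w) * dotp w0 (e w)) - a * (H w * dotp w0 (e w))
    + lam / 2 * (dotp w0 (e w) * dotp w0 (e w)) + a ^+ 2 / (2 * lam) * beta w)
    (D + 2 * a ^+ 2 * (dotp gr gr * (kappa / n%:R))
     + 2 * a ^+ 2 * ((\sum_(j < n) v j j) * kappa / (n%:R * m%:R))
     + a ^+ 2 * (b0 * kappa) - a * (dotp gr w0 / n%:R) - a * 0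
     + lam / 2 * (dotp w0 w0 / n%:R) + a ^+ 2 / (2 * lam) * b0).
  apply: has_meanD; last exact: has_meanZ.
  apply: has_meanD; last exact: has_meanZ.
  apply: has_meanB; last exact: has_meanZ.
  apply: has_meanB; last exact: has_meanZ.
  apply: has_meanD; last first.
    by apply: has_meanZ; exact: (has_mean_mul indep_ex).
  apply: has_meanD; last exact: has_meanZ.
  apply: has_meanD; last exact: has_meanZ.
  exact: has_mean_cst.
have le_pieces : {ae Pr, forall w, V w <=
    D + 2 * a ^+ 2 * (dotp gr (e w) * dotp gr (e w) * K (e w))
    + 2 * a ^+ 2 * (H w * H w * K (e w)) + a ^+ 2 * (beta w * K (e w))
    - a * (dotp gr (e w) * dotp w0 (e w)) - a * (H w * dotp w0 (e w))
    + lam / 2 * (dotp w0 (e w) * dotp w0 (e w)) + a ^+ 2 / (2 * lam) * beta w}.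
  apply: filterS cH => w cHw.
  apply: (@step_pointwise _ a lam D (K (e w)) (V w) (dotp w0 (e w)) (dotp gr (e w))
    (H w) (c w - dotp gr (e w) - H w) (beta w) (c w)) => //.
    apply: le_trans (sqr_average_le (u ^~ w) m0).
    rewrite -[leLHS]real_normK ?num_real// lerXn2r ?nnegrE//.
    exact: le_trans (normr_ge0 _) cHw.
  by ring.
have [z zP] : exists z, has_mean Pr V z.
  apply: has_mean_dominated mV _ pieces.
  by apply: filterS le_pieces => w; rewrite ger0_norm.
exists z => //; have := has_mean_le le_pieces zP pieces.
rewrite mulr0 subr0.
move: (a * _) (2 * a ^+ 2 * _) (2 * a ^+ 2 * _) (a ^+ 2 * _) (lam / 2 * _) (_ * b0).
by move=> *; lra.
Qed.

End one_step.

(** * Measurability of the iterates *)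

(** The average of the finite difference quotients along e. *)
Definition average_quotient {R : realType} {n : nat} {X : Type}
    (ftil : 'rV[R]_n -> X -> R) (t : R) (m : nat) (e : 'rV[R]_n)
    (xi : 'I_m -> X) (x : 'rV[R]_n) : R :=
  m%:R^-1 * \sum_(i < m) (ftil (x + t *: e) (xi i) - ftil x (xi i)) / t.

Lemma grad_estimateE (R : realType) (n : nat) (X : Type)
    (ftil : 'rV[R]_n -> X -> R) (t : R) (m : nat) (e : 'rV[R]_n)
    (xi : 'I_m -> X) (x : 'rV[R]_n) :
  grad_estimate ftil t e xi x = average_quotient ftil t e xi x *: e.
Proof. by rewrite /grad_estimate -scaler_suml scalerA. Qed.

Section measurable_step.
Context {R : realType} {n : nat} (p : R) (p12 : 1 <= p <= 2).
Variables (d : 'rV[R]_n -> R) (dprox : prox_function p d).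

(** The partial derivatives are limits of continuous difference quotients. *)
Lemma measurable_grad :
  measurable_fun setT (grad d : borel_space R n -> borel_space R n).
Proof.
have [dcont ddiff _ _] := dprox.
apply: measurable_to_borel => j.
pose q (N : nat) : borel_space R n -> R := fun x =>
  (harmonic N : R)^-1 * (d ((x : 'rV[R]_n) + (harmonic N : R) *: delta_mx 0 j) - d x).
apply: (@measurable_fun_cvg _ _ _ setT q).
  move=> N; apply: measurable_funM; first exact: measurable_cst.
  apply: measurable_funB; last exact: measurable_borel_continuous.
  apply: (@measurableT_comp _ _ _ _ _ _ (d : borel_space R n -> R)).
    exact: measurable_borel_continuous.
  apply: (@measurable_addv _ _ _ _ id (cst _)); first exact: measurable_id.
  exact: measurable_cst.
move=> x _.
have D : is_derive (0 : R) 1 (fun r : R => d (x + r *: delta_mx 0 j) : R^o)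
    (dotp (grad d (x + (0 : R) *: delta_mx 0 j)) (delta_mx 0 j)).
  by apply: is_derive_line.
rewrite scale0r addr0 dotp_delta in D.
have [D1 D2] := D.
have := D1; rewrite /derivable => /cvg_ex[l Hl].
have E : l = grad d x 0 j by rewrite -D2; apply/esym/cvg_lim.
rewrite E in Hl; move/cvgr_dnbhsP : Hl => /(_ harmonic) Hl.
have {}Hl := Hl (conj (fun N => lt0r_neq0 (harmonic_gt0 N)) cvg_harmonic).
apply: cvg_trans Hl; apply: near_eq_cvg; near=> N.
rewrite /q /= /shift /= scale0r !addr0 -[X in X%:A]/(harmonic N : R).
by rewrite [_%:A]mulr1.
Unshelve. all: by end_near.
Qed.

Lemma measurable_mirror :
  measurable_fun setT (mirror d : borel_space R n -> borel_space R n).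
Proof.
apply: measurable_to_borel => j.
apply: (measurable_borel_continuous (f := fun x => mirror d x 0 j)) => x.
apply: (@continuous_comp _ _ _ (mirror d) (fun v : 'rV[R]_n => v 0 j)).
  exact: (mirror_continuous p12 dprox).
exact: coord_continuous.
Qed.

Lemma measurable_bregman u :
  measurable_fun setT (fun z : borel_space R n => bregman d z u).
Proof.
have [dcont _ _ _] := dprox.
apply: measurable_funB; last first.
  apply: measurable_dotp; first exact: measurable_grad.
  have -> : (fun z : borel_space R n => u - z)
      = (fun z : borel_space R n => (cst u z : 'rV[R]_n) + (-1) *: (z : 'rV[R]_n)).
    by apply/funext => z /=; rewrite scaleN1r.
  apply: measurable_addv; first exact: measurable_cst.
  by apply: (@measurable_scalev _ _ _ _ (cst _) id).
apply: measurable_funB; first exact: measurable_cst.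
exact: measurable_borel_continuous.
Qed.

Context {dX dT : measure_display} {X : measurableType dX} {T : measurableType dT}.
Variable ftil : 'rV[R]_n -> X -> R.
Hypothesis mftil : measurable_fun setT (fun z : borel_space R n * X => ftil z.1 z.2).

Lemma measurable_average_quotient (m : nat) (t : R) (x e : T -> borel_space R n)
    (xi : 'I_m -> T -> X) :
  measurable_fun setT x -> measurable_fun setT e ->
  (forall i, measurable_fun setT (xi i)) ->
  measurable_fun setT
    (fun w => average_quotient ftil t (e w) (fun i => xi i w) (x w)).
Proof.
move=> mx me mxi; apply: measurable_funM; first exact: measurable_cst.
apply: measurable_sum => i.
apply: measurable_funM; last exact: measurable_cst.
apply: measurable_funB.
  apply: (measurableT_comp mftil (g := fun w => (_, xi i w))).
  apply: measurable_fun_pair => //; apply: measurable_addv => //.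
  by apply: (@measurable_scalev _ _ _ _ (cst _)).
apply: (measurableT_comp mftil (g := fun w => (x w, xi i w))).
exact: measurable_fun_pair.
Qed.

Lemma measurable_iterate (m : nat) (t a : R) (x e : T -> borel_space R n)
    (xi : 'I_m -> T -> X) :
  measurable_fun setT x -> measurable_fun setT e ->
  (forall i, measurable_fun setT (xi i)) ->
  measurable_fun setT (fun w => mirror d (grad d (x w) -
    a *: grad_estimate ftil t (e w) (fun i => xi i w) (x w)) : borel_space R n).
Proof.
move=> mx me mxi.
apply: (@measurableT_comp _ _ _ _ _ _ (mirror d : borel_space R n -> borel_space R n)).
  exact: measurable_mirror.
under eq_fun do rewrite grad_estimateE scalerA -scaleNr.
apply: measurable_addv.
  apply: (@measurableT_comp _ _ _ _ _ _ (grad d : borel_space R n -> borel_space R n)) => //.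
  exact: measurable_grad.
apply: measurable_scalev => //.
apply: measurableT_comp => //; apply: measurable_funM; first exact: measurable_cst.
exact: measurable_average_quotient.
Qed.

End measurable_step.

(** * The expected decrease in one step *)

Section step.
Context {R : realType} {n m : nat} (n8 : (8 <= n)%N) (m0 : (0 < m)%N).
Variables (p : R) (q : \bar R).
Hypotheses (p12 : 1 <= p <= 2) (q2 : (2%:E <= q)%E).
Hypothesis pq : ((p%:E)^-1 + q^-1 = 1)%E.
Context {dX : measure_display} {X : measurableType dX}.
Variable P : probability X R.
Variables (F eta : 'rV[R]_n -> X -> R) (f : 'rV[R]_n -> R).
Variables (g : 'rV[R]_n -> X -> 'rV[R]_n) (L : X -> R) (L2 sigma Delta : R).
Hypothesis F_meas : measurable_fun setT (fun z : borel_space R n * X => F z.1 z.2).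
Hypothesis F_int : forall x, P.-integrable setT (fun s => (F x s)%:E).
Hypothesis f_def : forall x, ((f x)%:E = 'E_P[F x])%E.
Hypothesis f_convex : convex_function [set: 'rV[R]_n] f.
Variable xstar : 'rV[R]_n.
Hypothesis xstar_min : is_minimizer f xstar.
Hypothesis g_meas : measurable_fun setT
  (fun z : borel_space R n * X => g z.1 z.2 : borel_space R n).
Hypothesis L_meas : measurable_fun setT L.
Hypothesis g_grad : {ae P, forall s,
   (forall x, has_grad (F ^~ s) x (g x s)) /\
   (forall x y, norm2 (g x s - g y s) <= L s * norm2 (x - y))}.
Hypothesis L2_gt0 : 0 < L2.
Hypothesis L_bound : (sqrte 'E_P[fun s => (L s ^+ 2)%R] <= L2%:E)%E.
Hypothesis g_var : forall x,
  ('E_P[fun s => (norm2 (g x s - grad f x) ^+ 2)%R] <= (sigma ^+ 2)%:E)%E.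
Hypothesis eta_meas : measurable_fun setT
  (fun z : borel_space R n * X => eta z.1 z.2).
Hypothesis eta_bound : {ae P, forall s, forall x, `|eta x s| <= Delta}.
Variables (d : 'rV[R]_n -> R) (dprox : prox_function p d).
Variables (t : R) (t0 : 0 < t).

Context {dO : measure_display} {Omega : measurableType dO}.
Variable Pr : probability Omega R.
Variables (e : Omega -> borel_space R n) (xi : 'I_m -> Omega -> X).
Hypothesis me : measurable_fun setT e.
Hypothesis ue : uniform_on_sphere (pushforward Pr e).
Hypothesis xi_law : forall i, has_law Pr (xi i) P.
Variables (He Hx : set (set Omega)) (Hi : 'I_m -> set (set Omega)).
Hypothesis indep_ex : independent Pr <<s Hx >> <<s He >>.
Hypothesis indep_ii : forall i j, i != j ->
  independent Pr <<s Hi i >> <<s Hi j >>.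
Hypothesis meH : measurable_fun setT (e : g_sigma_algebraType He -> borel_space R n).
Hypothesis mxix : forall i,
  measurable_fun setT (xi i : g_sigma_algebraType Hx -> X).
Hypothesis mxii : forall i,
  measurable_fun setT (xi i : g_sigma_algebraType (Hi i) -> X).

Let ftil y s := F y s + eta y s.

Let mftil : measurable_fun setT (fun z : borel_space R n * X => ftil z.1 z.2).
Proof. exact: measurable_funD. Qed.

(** The bound for the mean square of the error of a finite difference. *)
Let err : R := L2 ^+ 2 * t ^+ 2 / 2 + 8 * Delta ^+ 2 / t ^+ 2.

Let quotient_error (s : X) (x v : 'rV[R]_n) :
  dotp v v = 1 ->
  (forall y, `|F y s - F x s - dotp (g x s) (y - x)| <= L s / 2 * dotp (y - x) (y - x)) ->
  (forall y, `|eta y s| <= Delta) ->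
  `|(ftil (x + t *: v) s - ftil x s) / t - dotp (g x s) v|
    <= L s * t / 2 + 2 * Delta / t.
Proof.
move=> v1 hF heta.
have := hF (x + t *: v); have := heta (x + t *: v); have := heta x.
rewrite (addrC x) addrK dotpZr dotpZl dotpZr v1 mulr1.
rewrite /ftil (addrC _ x); move: (F _ s) (F x s) (eta _ s) (eta x s) (dotp _ _) => a b r1 r2 z.
move=> h2 h1 h.
have -> : (a + r1 - (b + r2)) / t - z = ((a - b - t * z) + (r1 - r2)) / t.
  by field; rewrite gt_eqF.
have -> : L s * t / 2 + 2 * Delta / t = (L s / 2 * (t * t) + 2 * Delta) / t.
  by field; rewrite gt_eqF.
rewrite normrM [`|t^-1|]ger0_norm ?invr_ge0 ?(ltW t0)//.
rewrite ler_pM2r ?invr_gt0//.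
apply: le_trans (ler_normD _ _) _; apply: lerD => //.
by apply: le_trans (ler_normB _ _) _; lra.
Qed.

Let average_error (w : Omega) (x gr : 'rV[R]_n) :
  dotp (e w) (e w) = 1 ->
  (forall i y, `|F y (xi i w) - F x (xi i w) - dotp (g x (xi i w)) (y - x)|
     <= L (xi i w) / 2 * dotp (y - x) (y - x)) ->
  (forall i y, `|eta y (xi i w)| <= Delta) ->
  `|average_quotient ftil t (e w) (fun i => xi i w) x - dotp gr (e w)
     - m%:R^-1 * \sum_(i < m) dotp (g x (xi i w) - gr) (e w)|
  <= m%:R^-1 * \sum_(i < m) (L (xi i w) * t / 2 + 2 * Delta / t).
Proof.
move=> e1 hF heta.
have mR : m%:R != 0 :> R by rewrite pnatr_eq0 -lt0n.
have -> : dotp gr (e w) = m%:R^-1 * \sum_(i < m) dotp gr (e w).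
  by rewrite sumr_const card_ord -[X in _ * X]mulr_natl mulKf.
rewrite /average_quotient -!mulrBr -!sumrB normrM ger0_norm ?invr_ge0 ?ler0n//.
rewrite ler_wpM2l ?invr_ge0 ?ler0n//.
apply: le_trans (ler_norm_sum _ _ _) _; apply: ler_sum => i _.
rewrite dotpBl opprB addrA subrK.
exact: quotient_error.
Qed.

Let mirror_scaled_step (a c K : R) (v x : 'rV[R]_n) : 0 <= K ->
  (forall y, dotp v y ^+ 2 <= K * normp p y ^+ 2) ->
  bregman d (mirror d (grad d x - a *: (c *: v))) xstar + a * (c * dotp (x - xstar) v)
    <= bregman d x xstar + a ^+ 2 * (c ^+ 2 * K) / 2.
Proof.
move=> K0 HK.
have H y : dotp (c *: v) y ^+ 2 <= (c ^+ 2 * K) * normp p y ^+ 2.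
  by rewrite dotpZl exprMn -mulrA ler_wpM2l ?sqr_ge0.
have := mirror_step_bound p12 dprox a x xstar (mulr_ge0 (sqr_ge0 c) K0) H.
by rewrite dotpZl [dotp v _]dotpC.
Qed.

Let u i w := L (xi i w) * t / 2 + 2 * Delta / t.

Let error_mean : exists2 b, forall i, has_mean Pr (fun w => u i w ^+ 2) b & b <= err.
Proof.
have [l2 l2P l2L] := L2_mean L_meas L2_gt0 L_bound.
have [l lP lL] := L_mean L_meas L2_gt0 L_bound.
pose U s := L s * t / 2 + 2 * Delta / t.
have UP : has_mean P (fun s => U s ^+ 2)
    (t ^+ 2 / 4 * l2 + (2 * Delta * l + 4 * Delta ^+ 2 / t ^+ 2)).
  have -> : (fun s => U s ^+ 2)
      = (fun s => t ^+ 2 / 4 * L s ^+ 2 + (2 * Delta * L s + 4 * Delta ^+ 2 / t ^+ 2)).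
    by apply/funext => s; rewrite /U; field; rewrite gt_eqF.
  apply: has_meanD; first exact: has_meanZ.
  by apply: has_meanD; [exact: has_meanZ|exact: has_mean_cst].
exists (t ^+ 2 / 4 * l2 + (2 * Delta * l + 4 * Delta ^+ 2 / t ^+ 2)).
  by move=> i; exact: (has_mean_law (xi_law i) UP).
apply: (@le_trans _ _ (t ^+ 2 / 2 * l2 + 8 * Delta ^+ 2 / t ^+ 2)).
  apply: (has_mean_le _ UP); last first.
    apply: has_meanD; [exact: has_meanZ l2P|exact: has_mean_cst].
  apply: filterE => s.
  have -> : t ^+ 2 / 2 * L s ^+ 2 + 8 * Delta ^+ 2 / t ^+ 2
      = U s ^+ 2 + (L s * t / 2 - 2 * Delta / t) ^+ 2.
    by rewrite /U; field; rewrite gt_eqF.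
  by rewrite lerDl sqr_ge0.
rewrite /err lerD2r [leRHS](_ : _ = t ^+ 2 / 2 * L2 ^+ 2); last by ring.
by rewrite ler_wpM2l// divr_ge0// sqr_ge0.
Qed.

(** The choice of the step size a makes the term in the squared gradient at most
    a quarter of the decrease. *)
Let step_arithmetic (nR mR r M lam a D z delta G W b0 B gg kappa S s2 : R) :
  0 < nR -> 0 < mR -> 0 < r -> 0 < M -> 0 < lam -> a = (48 * nR * r * M)^-1 ->
  0 <= delta -> delta <= G -> W <= 2 * D -> 0 <= b0 -> b0 <= B ->
  0 <= gg -> gg <= 2 * M * delta -> 0 <= kappa -> kappa <= 3 * r ->
  0 <= S -> S <= s2 ->
  z + a * nR * (G / nR) <= D + lam * nR / 2 * (W / nR)
    + (a * nR) ^+ 2 / (2 * (lam * nR)) * b0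
    + 2 * (a * nR) ^+ 2 * (gg * (kappa / nR))
    + 2 * (a * nR) ^+ 2 * (S * kappa / (nR * mR))
    + (a * nR) ^+ 2 * (b0 * kappa) ->
  z + 3 / 4 * a * delta <= (1 + lam) * D + (a ^+ 2 * nR * B / (2 * lam)
    + 6 * a ^+ 2 * nR * r * s2 / mR + 3 * a ^+ 2 * nR ^+ 2 * r * B).
Proof.
move=> n0 mR0 r0 M0 lam0 aE d0 dG WD b00 bB gg0 ggd k0 kr S0 Ss.
have a0 : 0 < a by rewrite aE invr_gt0 !mulr_gt0.
have -> : a * nR * (G / nR) = a * G by field; rewrite gt_eqF.
have -> : lam * nR / 2 * (W / nR) = lam / 2 * W by field; rewrite gt_eqF.
have -> : (a * nR) ^+ 2 / (2 * (lam * nR)) * b0 = a ^+ 2 * nR / (2 * lam) * b0.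
  by field; rewrite !gt_eqF.
have -> : 2 * (a * nR) ^+ 2 * (gg * (kappa / nR)) = 2 * a ^+ 2 * nR * (gg * kappa).
  by field; rewrite gt_eqF.
have -> : 2 * (a * nR) ^+ 2 * (S * kappa / (nR * mR)) = 2 * a ^+ 2 * nR / mR * (S * kappa).
  by field; rewrite !gt_eqF.
have -> : a ^+ 2 * nR * B / (2 * lam) = a ^+ 2 * nR / (2 * lam) * B by field; rewrite gt_eqF.
have t1 : lam / 2 * W <= lam * D.
  by rewrite (_ : lam * D = lam / 2 * (2 * D)); [rewrite ler_pM2l// divr_gt0|field].
have t2 : a ^+ 2 * nR / (2 * lam) * b0 <= a ^+ 2 * nR / (2 * lam) * B.
  by rewrite ler_pM2l// divr_gt0 ?mulr_gt0 ?exprn_gt0.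
have t3 : 2 * a ^+ 2 * nR * (gg * kappa) <= a * delta / 4.
  have -> : a * delta / 4 = 2 * a ^+ 2 * nR * ((2 * M * delta) * (3 * r)).
    by rewrite aE; field; rewrite !gt_eqF.
  by rewrite ler_pM2l ?mulr_gt0 ?exprn_gt0//; exact: ler_pM.
have t4 : 2 * a ^+ 2 * nR / mR * (S * kappa) <= 6 * a ^+ 2 * nR * r * s2 / mR.
  have -> : 6 * a ^+ 2 * nR * r * s2 / mR = 2 * a ^+ 2 * nR / mR * (s2 * (3 * r)).
    by field; rewrite gt_eqF.
  by rewrite ler_pM2l ?divr_gt0 ?mulr_gt0 ?exprn_gt0//; exact: ler_pM.
have t5 : (a * nR) ^+ 2 * (b0 * kappa) <= 3 * a ^+ 2 * nR ^+ 2 * r * B.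
  have -> : 3 * a ^+ 2 * nR ^+ 2 * r * B = (a * nR) ^+ 2 * (B * (3 * r)) by ring.
  by rewrite ler_pM2l ?exprn_gt0 ?mulr_gt0//; exact: ler_pM.
have t6 : a * delta <= a * G by rewrite ler_pM2l.
lra.
Qed.

Let alpha : R := (48 * n%:R * rho n q * L2)^-1.

(** The constant of one step; lam is the rate at which the divergence is
    allowed to grow. *)
Definition step_constant (lam : R) : R :=
  alpha ^+ 2 * n%:R * err / (2 * lam)
  + 6 * alpha ^+ 2 * n%:R * rho n q * sigma ^+ 2 / m%:R
  + 3 * alpha ^+ 2 * n%:R ^+ 2 * rho n q * err.

(** The decrease from a fixed point x. The families He, Hx and Hi i generate
    sigma-algebras that carry the direction, the samples, and the i-th sample. *)
Lemma step_decrease (lam : R) x : 0 < lam ->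
  exists2 z, has_mean Pr (fun w => bregman d
    (mirror d (grad d x - (alpha * n%:R) *:
       grad_estimate ftil t (e w) (fun i => xi i w) x)) xstar) z &
    z + 3 / 4 * alpha * (f x - f xstar)
      <= (1 + lam) * bregman d x xstar + step_constant lam.
Proof.
move=> lam0.
have n0 : (0 < n)%N by exact: leq_trans n8.
have [k [A [B [k0 A0 B0 KP Krho]]]] := dual_norm_poly_bound n8 p12 q2 pq.
have [kappa kappaP kapparho] := power_sum_mean me ue k n0 A0 B0.
have {kapparho} kapparho := le_trans kapparho Krho.
have [b0 b0P b0err] := error_mean.
have [gmean gquad] := objective_gradient F_int f_def g_meas L_meas g_grad L2_gt0 L_bound x.
have [v [vP vsigma]] := gradient_noise g_meas g_var x.
have noise_mean i j : has_mean Pr (fun w => (g x (xi i w) - grad f x) 0 j) 0.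
  apply: (has_mean_law (xi_law i) (X := fun s => (g x s - grad f x) 0 j)).
  rewrite -(subrr (grad f x 0 j)).
  have -> : (fun s => (g x s - grad f x) 0 j) = (fun s => g x s 0 j - grad f x 0 j).
    by move: (grad f x) => gr; apply/funext => s; rewrite !mxE.
  by apply: has_meanB; [exact: gmean|exact: has_mean_cst].
have noise_cov i j l : has_mean Pr (fun w =>
    (g x (xi i w) - grad f x) 0 j * (g x (xi i w) - grad f x) 0 l) (v j l).
  exact: (has_mean_law (xi_law i) (vP j l)).
have mnoise : measurable_fun setT
    (fun s => (g x s : 'rV[R]_n) + (-1) *: (grad f x : 'rV[R]_n) : borel_space R n).
  apply: measurable_addv; first exact: g_measurable.
  exact: measurable_cst.
have {}mnoise : measurable_fun setT (fun s => g x s - grad f x : borel_space R n).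
  by under eq_fun do rewrite -scaleN1r.
have lamn : 0 < lam * n%:R by rewrite mulr_gt0// ltr0n.
have mU : measurable_fun setT (fun s => L s * t / 2 + 2 * Delta / t).
  apply: measurable_funD; last exact: measurable_cst.
  apply: measurable_funM; last exact: measurable_cst.
  by apply: measurable_funM => //; exact: measurable_cst.
pose V w := bregman d (mirror d (grad d x - (alpha * n%:R) *:
  grad_estimate ftil t (e w) (fun i => xi i w) x)) xstar.
have mV : measurable_fun setT V.
  apply: (@measurableT_comp _ _ _ _ _ _
    (fun z : borel_space R n => bregman d z xstar)).
    exact: measurable_bregman dprox _.
  apply: (measurable_iterate p12 dprox mftil t _ (x := cst x)) me _ => [|i].
    exact: measurable_cst.
  by have [] := xi_law i.
have V0 w : 0 <= V w by rewrite /V; move: (mirror _ _) => z; exact: (bregman_ge0 p12 dprox).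
pose h i w : 'rV[R]_n := g x (xi i w) - grad f x.
have mhx i : measurable_fun setT (h i : g_sigma_algebraType Hx -> borel_space R n).
  exact: (measurableT_comp mnoise (mxix i)).
have mhi i : measurable_fun setT (h i : g_sigma_algebraType (Hi i) -> borel_space R n).
  exact: (measurableT_comp mnoise (@mxii i)).
have mux i : measurable_fun setT (u i : g_sigma_algebraType Hx -> R).
  exact: (measurableT_comp mU (mxix i)).
have step := @step_mean _ _ _ _ _ n0 m0 Pr He Hx Hi indep_ex indep_ii e me meH ue h u
  mhx mhi mux v noise_mean noise_cov b0 b0P A B k kappa A0 B0 kappaP (grad f x) (x - xstar)
  (alpha * n%:R) (lam * n%:R) (bregman d x xstar)
  (fun w => average_quotient ftil t (e w) (fun i => xi i w) x) V lamn mV V0.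
have {step} [||z zV zle] := step.
- have smooth : {ae Pr, forall w, forall i y,
      `|F y (xi i w) - F x (xi i w) - dotp (g x (xi i w)) (y - x)|
      <= L (xi i w) / 2 * dotp (y - x) (y - x)}.
    apply: filter_forall => i.
    have hs : {ae P, forall s, forall y, `|F y s - F x s - dotp (g x s) (y - x)|
        <= L s / 2 * dotp (y - x) (y - x)}.
      by apply: filterS (realization_smooth g_grad) => s H y; exact: H.
    exact: (ae_law (xi_law i) hs).
  have small : {ae Pr, forall w, forall i y, `|eta y (xi i w)| <= Delta}.
    by apply: filter_forall => i; exact: (ae_law (xi_law i) eta_bound).
  have := sphere_norm_ae me ue.
  apply: filterS3 smooth small => w hs hsm e1.
  exact: average_error.
- move=> w; rewrite /V grad_estimateE.
  by apply: mirror_scaled_step => [|y]; [exact: power_sum_ge0|exact: KP].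
exists z => //.
have [convex_gap gap] : f x - f xstar <= dotp (grad f x) (x - xstar) /\
    dotp (grad f x) (grad f x) <= 2 * L2 * (f x - f xstar).
  split; last exact: sqr_grad_le_gap gquad.
  have := convex_ge_tangent f_convex _ gquad xstar.
  rewrite -(opprB x) dotpNr; move: (dotp _ _) => G /(_ (divr_ge0 (ltW L2_gt0) (ler0n _ 2))).
  by lra.
have kappa0 : 0 <= kappa.
  by apply: has_mean_ae_ge0 kappaP; apply: filterE => w; exact: power_sum_ge0.
have b00 : 0 <= b0.
  apply: has_mean_ae_ge0 (b0P (Ordinal m0)).
  by apply: filterE => w; exact: sqr_ge0.
have v0 : 0 <= \sum_(j < n) v j j.
  apply: sumr_ge0 => j _; apply: has_mean_ae_ge0 (vP j j).
  by apply: filterE => s; rewrite -expr2 sqr_ge0.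
have dist : dotp (x - xstar) (x - xstar) <= 2 * bregman d x xstar.
  have := bregman_ge p12 dprox x xstar.
  by rewrite -(opprB x) dotpNl dotpNr opprK.
have gr0 := dotp_ge0 (grad f x).
have xmin : 0 <= f x - f xstar by rewrite subr_ge0 xstar_min.
have r0 := rho_gt0 n8 q2.
move: zle gr0 convex_gap gap dist.
move: (dotp (grad f x) (grad f x)) (dotp (grad f x) _) (dotp (x - xstar) _) => gg G W.
move=> zle gg0 dG ggd WD.
have nR : 0 < n%:R :> R by rewrite ltr0n.
have mR : 0 < m%:R :> R by rewrite ltr0n.
exact: (step_arithmetic nR mR r0 L2_gt0 lam0 erefl xmin dG WD b00 b0err gg0 ggd
  kappa0 kapparho v0 vsigma zle).
Qed.
End step.

(** * Past and present *)

Section sigma_of.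
Context {d d' : measure_display} {Omega : measurableType d} {T : measurableType d'}.
Variable Y : Omega -> T.

Lemma sigma_ofT : sigma_of Y setT.
Proof. by exists setT => //; rewrite preimage_setT setTI. Qed.

Lemma sigma_of_setI : setI_closed (sigma_of Y).
Proof.
move=> _ _ [A mA <-] [B mB <-]; exists (A `&` B); first exact: measurableI.
by rewrite !setTI preimage_setI.
Qed.

Lemma sigma_of_measurable : measurable_fun setT Y -> sigma_of Y `<=` measurable.
Proof. by move=> mY _ [A mA <-]; exact: mY. Qed.

(** A variable is measurable for any sigma-algebra containing its own. *)
Lemma measurable_sigma_of (G : set (set Omega)) : sigma_of Y `<=` <<s G >> ->
  measurable_fun setT (Y : g_sigma_algebraType G -> T).
Proof. by move=> YG _ A mA; apply: YG; exists A. Qed.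

Lemma measurable_fun_sub (G G' : set (set Omega)) : G `<=` G' ->
  measurable_fun setT (Y : g_sigma_algebraType G -> T) ->
  measurable_fun setT (Y : g_sigma_algebraType G' -> T).
Proof.
move=> GG' mY _ A mA; have := mY measurableT A mA.
by apply: sub_smallest2r.
Qed.

Lemma measurable_fun_sigma (G : set (set Omega)) : G `<=` measurable ->
  measurable_fun setT (Y : g_sigma_algebraType G -> T) -> measurable_fun setT Y.
Proof.
move=> Gm mY _ A mA; have := mY measurableT A mA.
by apply: smallest_sub; [exact: sigma_algebra_measurable|].
Qed.

End sigma_of.

(** An inequality between means that holds when the past is fixed and the
    present is drawn afresh holds for the joint draw. *)
Lemma mean_fresh (R : realType) (d : measure_display) (Omega : measurableType d)
    (Pr : probability Omega R) (G H : set (set Omega))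
    (Psi : g_sigma_algebraType G * g_sigma_algebraType H -> R)
    (A B : Omega -> R) (b : R) :
  G `<=` measurable -> H `<=` measurable -> independent Pr <<s G >> <<s H >> ->
  measurable_fun setT Psi -> (forall z, 0 <= Psi z) ->
  measurable_fun setT A -> (forall w, 0 <= A w) -> has_mean Pr B b ->
  (forall w, exists2 z, has_mean Pr (fun w' => Psi (w, w')) z & z + A w <= B w) ->
  exists v a, [/\ has_mean Pr (fun w => Psi (w, w)) v, has_mean Pr A a & v + a <= b].
Proof.
move=> Gm Hm GH mPsi Psi0 mA A0 Bb HPsi.
have HPsi' w : exists z, has_mean Pr (fun w' => Psi (w, w')) z /\ z + A w <= B w.
  by have [z ? ?] := HPsi w; exists z.
have {HPsi HPsi'} [z zP] := choice HPsi'.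
have z0 w : 0 <= z w.
  by apply: has_mean_ae_ge0 (zP w).1; apply: filterE => w'; exact: Psi0.
have [a Aa] : exists a, has_mean Pr A a.
  apply: has_mean_dominated mA _ Bb; apply: filterE => w.
  by rewrite ger0_norm//; apply: le_trans (zP w).2; rewrite lerDr.
have mid K : K `<=` measurable -> measurable_fun setT (idfun : Omega -> g_sigma_algebraType K).
  by move=> Km; apply: measurable_fun_sigma Km _ => //; exact: measurable_id.
have mdiag : measurable_fun setT (fun w : Omega => Psi (w, w)).
  apply: (@measurableT_comp _ _ _ Omega
    (g_sigma_algebraType G * g_sigma_algebraType H)%type R Psi _ (fun w => (w, w)) mPsi).
  by apply: measurable_fun_pair; exact: mid.
have I1 : (\int[Pr]_w (Psi (w, w))%:E = \int[Pr]_w (z w)%:E)%E.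
  rewrite (@integral_independent _ _ _ _ _ _ _ Pr _ _ (mid _ Gm) (mid _ Hm) _ (EFin \o Psi)).
  - by apply: eq_integral => w _; exact: (zP w).1.2.
  - by move=> C D mC mD; exact: GH.
  - exact/measurable_EFinP.
  - by move=> y; rewrite lee_fin.
have BA := has_meanB Bb Aa.
pose idH : {mfun Omega >-> g_sigma_algebraType H} :=
  HB.pack (idfun : Omega -> g_sigma_algebraType H)
    (isMeasurableFun.Build _ _ _ _ _ (mid _ Hm)).
have mz : measurable_fun setT (EFin \o z : Omega -> \bar R).
  apply: (measurable_fun_sigma Gm).
  have -> : EFin \o z = fubini_F (distribution Pr idH) (EFin \o Psi).
    apply/funext => w; rewrite /fubini_F ge0_integral_distribution//.
    - exact: esym (zP w).1.2.
    - by apply: (measurableT_comp _ (measurable_pair1 w)); exact/measurable_EFinP.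
    - by move=> y; rewrite lee_fin.
  apply: measurable_fun_fubini_tonelli_F; first exact/measurable_EFinP.
  by move=> y; rewrite lee_fin.
have I2 : (\int[Pr]_w (z w)%:E <= (b - a)%:E)%E.
  rewrite -BA.2; apply: ge0_le_integral => //.
  - by move=> w _; rewrite lee_fin.
  - exact/measurable_EFinP/(has_mean_measurable BA).
  - by move=> w _; rewrite lee_fin lerBrDr; exact: (zP w).2.
have fin : (\int[Pr]_w (Psi (w, w))%:E < +oo)%E by rewrite I1 (le_lt_trans I2)// ltry.
have vP := has_mean_ge0 mdiag (fun w => Psi0 _) fin.
exists (fine (\int[Pr]_w (Psi (w, w))%:E)), a; split => //.
by rewrite -lerBrDr -lee_fin -(vP.2) I1.
Qed.

(** * The run of the method *)

Lemma difference_error_ge0 (R : realType) (M t D : R) :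
  0 <= M ^+ 2 * t ^+ 2 / 2 + 8 * D ^+ 2 / t ^+ 2.
Proof.
apply: addr_ge0; apply: mulr_ge0; rewrite ?invr_ge0 ?sqr_ge0 ?ler0n//.
  by apply: mulr_ge0; exact: sqr_ge0.
by apply: mulr_ge0; rewrite ?ler0n ?sqr_ge0.
Qed.

(** The bound that comes out of the argument implies the announced one. *)
Lemma weaker_bound (R : realType) (n N m r M T S D t root : R) :
  0 < n -> 0 < N -> 0 < m -> 0 < r -> 0 < M -> 0 <= T -> 0 <= D -> 0 < t -> 0 <= root ->
  128 * n * r * M * T / N + S ^+ 2 / (3 * M * m)
    + (n / (6 * M) + N / (18 * M * r)) * (M ^+ 2 * t ^+ 2 / 2 + 8 * D ^+ 2 / t ^+ 2)
  <= 384 * n * r * M * T / N + 2 * S ^+ 2 / (M * m)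
    + (n / (6 * M) + N / (3 * M * r)) * (M ^+ 2 * t ^+ 2 / 2 + 8 * D ^+ 2 / t ^+ 2)
    + 8 * root / N * (M * t / 2 + 2 * D / t).
Proof.
move=> n0 N0 m0 r0 M0 T0 D0 t0 root0.
have B0 := difference_error_ge0 M t D.
move: (M ^+ 2 * t ^+ 2 / 2 + 8 * D ^+ 2 / t ^+ 2) B0 => B B0.
have h1 : 0 <= 8 * root / N * (M * t / 2 + 2 * D / t).
  have [N1 M1 t1] : [/\ 0 <= N, 0 <= M & 0 <= t] by split; exact: ltW.
  by rewrite mulr_ge0 ?divr_ge0 ?mulr_ge0 ?addr_ge0 ?divr_ge0 ?mulr_ge0.
have h2 : 0 <= n * r * M * T / N.
  by rewrite divr_ge0 ?mulr_ge0// ltW.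
have h3 : 0 <= S ^+ 2 / (3 * M * m).
  by rewrite divr_ge0 ?sqr_ge0// !mulr_ge0// ltW.
have h4 : 0 <= N / (18 * M * r) * B by rewrite mulr_ge0// divr_ge0 ?mulr_ge0 ?ltW.
have -> : 384 * n * r * M * T / N = 3 * (128 * n * r * M * T / N) by ring.
have -> : 128 * n * r * M * T / N = 128 * (n * r * M * T / N) by ring.
have -> : 2 * S ^+ 2 / (M * m) = 6 * (S ^+ 2 / (3 * M * m)) by field; rewrite !gt_eqF.
have -> : N / (3 * M * r) = 6 * (N / (18 * M * r)) by field; rewrite !gt_eqF.
move: (n / (6 * M)) (N / (18 * M * r)) h4 => a b h4.
have -> : (a + 6 * b) * B = (a + b) * B + 5 * (b * B) by ring.
move: (8 * root / N * _) (n * r * M * T / N) (S ^+ 2 / _) ((a + b) * B) (b * B) h1 h2 h3 h4.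
by intros; lra.
Qed.

Section run.
Context {R : realType} {n : nat} (hn : (8 <= n)%N).
Variables (p : R) (q : \bar R).
Hypotheses (hp : 1 <= p <= 2) (hq : (2%:E <= q)%E).
Hypothesis hpq : ((p%:E)^-1 + q^-1 = 1)%E.
Context {dX : measure_display} {X : measurableType dX}.
Variable P : probability X R.
Variables (F eta : 'rV[R]_n -> X -> R) (f : 'rV[R]_n -> R).
Variables (g : 'rV[R]_n -> X -> 'rV[R]_n) (L : X -> R) (L2 sigma Delta : R).
Hypothesis F_meas : measurable_fun setT (fun z : borel_space R n * X => F z.1 z.2).
Hypothesis F_int : forall x, P.-integrable setT (fun s => (F x s)%:E).
Hypothesis f_def : forall x, ((f x)%:E = 'E_P[F x])%E.
Hypothesis f_convex : convex_function [set: 'rV[R]_n] f.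
Variable xstar : 'rV[R]_n.
Hypothesis xstar_min : is_minimizer f xstar.
Hypothesis g_meas : measurable_fun setT
  (fun z : borel_space R n * X => g z.1 z.2 : borel_space R n).
Hypothesis L_meas : measurable_fun setT L.
Hypothesis g_grad : {ae P, forall s,
   (forall x, has_grad (F ^~ s) x (g x s)) /\
   (forall x y, norm2 (g x s - g y s) <= L s * norm2 (x - y))}.
Hypothesis L2_gt0 : 0 < L2.
Hypothesis L_bound : (sqrte 'E_P[fun s => (L s ^+ 2)%R] <= L2%:E)%E.
Hypothesis g_var : forall x,
  ('E_P[fun s => (norm2 (g x s - grad f x) ^+ 2)%R] <= (sigma ^+ 2)%:E)%E.
Hypothesis eta_meas : measurable_fun setT
  (fun z : borel_space R n * X => eta z.1 z.2).
Hypothesis eta_bound : {ae P, forall s, forall x, `|eta x s| <= Delta}.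
Variables (d : 'rV[R]_n -> R) (d_prox : prox_function p d).
Variables (N m : nat) (hN : (1 <= N)%N) (hm : (1 <= m)%N) (t : R) (ht : 0 < t).
Variable x0 : 'rV[R]_n.
Context {dO : measure_display} {Omega : measurableType dO}.
Variable Pr : probability Omega R.
Variables (e : 'I_N -> Omega -> borel_space R n) (xi : 'I_N -> 'I_m -> Omega -> X).
Hypothesis e_meas : forall k, measurable_fun setT (e k).
Hypothesis e_unif : forall k, uniform_on_sphere (pushforward Pr (e k)).
Hypothesis xi_law : forall k i, has_law Pr (xi k i) P.

Let S (j : 'I_N + 'I_N * 'I_m) : set (set Omega) :=
  match j with
  | inl k => sigma_of (e k)
  | inr (k, i) => sigma_of (xi k i)
  end.
Hypothesis indep : mutually_independent Pr S.
Variable x : nat -> Omega -> 'rV[R]_n.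
Let ftil y s := F y s + eta y s.
Let alpha : R := (48 * n%:R * rho n q * L2)^-1.
Hypothesis x_run : forall w, rdfds_run ftil d t alpha x0
  (fun k => e k w) (fun k i => xi k i w) (fun k => x k w).

Let alpha0 : 0 < alpha.
Proof.
have n0 : 0 < n%:R :> R by rewrite ltr0n (leq_trans _ hn).
have r0 := rho_gt0 hn hq.
by rewrite /alpha invr_gt0 mulr_gt0// mulr_gt0// mulr_gt0.
Qed.

Let mftil : measurable_fun setT (fun z : borel_space R n * X => ftil z.1 z.2).
Proof. exact: measurable_funD. Qed.

Let ST j : S j setT.
Proof. by case: j => [k|[k i]]; exact: sigma_ofT. Qed.

Let SI j : setI_closed (S j).
Proof. by case: j => [k|[k i]]; exact: sigma_of_setI. Qed.

Let mxi k i : measurable_fun setT (xi k i).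
Proof. by have [] := xi_law k i. Qed.

Let Sm j : S j `<=` measurable.
Proof. by case: j => [k|[k i]]; apply: sigma_of_measurable. Qed.

Let block_m J : block S J `<=` measurable := block_measurable Sm (J := J).

Let sub_sigma_block j (J : {set 'I_N + 'I_N * 'I_m}) : j \in J ->
  S j `<=` <<s block S J >>.
Proof.
by move=> jJ A SA; apply: sub_sigma_algebra; exact: (sub_block ST jJ).
Qed.

Let me_block k (J : {set 'I_N + 'I_N * 'I_m}) : inl k \in J ->
  measurable_fun setT (e k : g_sigma_algebraType (block S J) -> borel_space R n).
Proof. by move=> /sub_sigma_block; exact: measurable_sigma_of. Qed.

Let mxi_block k i (J : {set 'I_N + 'I_N * 'I_m}) : inr (k, i) \in J ->
  measurable_fun setT (xi k i : g_sigma_algebraType (block S J) -> X).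
Proof. by move=> /sub_sigma_block; exact: measurable_sigma_of. Qed.

(* The step at which a draw is made. *)
Let time_of (j : 'I_N + 'I_N * 'I_m) : nat :=
  match j with inl k => k | inr (k, _) => k end.

Let past (k : nat) : {set 'I_N + 'I_N * 'I_m} := finset (fun j => (time_of j < k)%N).
Let present (k : nat) : {set 'I_N + 'I_N * 'I_m} := finset (fun j => time_of j == k).

(* The iterate after step k, when it is y before that step. *)
Let next (k : 'I_N) (w : Omega) (y : 'rV[R]_n) : 'rV[R]_n :=
  mirror d (grad d y - (alpha * n%:R) *:
    grad_estimate ftil t (e k w) (fun i => xi k i w) y).

Let x_next (k : 'I_N) w : x k.+1 w = next k w (x k w).
Proof. by have [_ xk] := x_run w; apply: (mirror_stepE hp d_prox); exact: xk. Qed.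

(* x k is a function of the draws made before step k. *)
Let x_past k : (k <= N)%N -> measurable_fun setT
  (x k : g_sigma_algebraType (block S (past k)) -> borel_space R n).
Proof.
elim: k => [|k ih] kN.
  have -> : x 0 = cst x0 by apply/funext => w; have [] := x_run w.
  exact: measurable_cst.
have -> : x k.+1 = (fun w => next (Ordinal kN) w (x k w)).
  by apply/funext => w; rewrite -x_next.
apply: (measurable_iterate hp d_prox mftil).
- apply: measurable_fun_sub (ih (ltnW kN)); apply: (block_sub ST).
  by apply/fintype.subsetP => j; rewrite !inE => /ltnW.
- by apply: me_block; rewrite inE.
- by move=> i; apply: mxi_block; rewrite inE.
Qed.

Let mx k : (k <= N)%N -> measurable_fun setT (x k : Omega -> borel_space R n).
Proof. by move=> kN; apply: measurable_fun_sigma (x_past kN); exact: block_m. Qed.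

Let f_smooth y : forall z,
  `|f z - f y - dotp (grad f y) (z - y)| <= L2 / 2 * dotp (z - y) (z - y).
Proof.
by have [] := objective_gradient F_int f_def g_meas L_meas g_grad L2_gt0 L_bound y.
Qed.

Let mf : measurable_fun setT (f : borel_space R n -> R).
Proof.
apply: measurable_borel_continuous => y.
apply: (@differentiable_continuous _ _ R^o).
have c0 : 0 <= L2 / 2 by rewrite divr_ge0// ltW.
by have [] := quadratic_bound_grad c0 (f_smooth y).
Qed.

Let gap k w := f (x k w) - f xstar.

Let gap_ge0 k w : 0 <= gap k w.
Proof. by rewrite subr_ge0; exact: xstar_min. Qed.

Let C (lam : R) := step_constant (n := n) (m := m) q L2 sigma Delta t lam.

Let fresh_step (k : 'I_N) (lam : R) (y : 'rV[R]_n) : 0 < lam ->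
  exists2 z, has_mean Pr (fun w => bregman d (next k w y) xstar) z &
    z + 3 / 4 * alpha * (f y - f xstar) <= (1 + lam) * bregman d y xstar + C lam.
Proof.
move=> lam0.
pose Je : {set 'I_N + 'I_N * 'I_m} := finset (fun j => j == inl k).
pose Jx : {set 'I_N + 'I_N * 'I_m} := finset (fun j => if j is inr _ then true else false).
pose Ji i : {set 'I_N + 'I_N * 'I_m} := finset (fun j => j == inr (k, i)).
apply: (@step_decrease _ _ _ hn hm _ _ hp hq hpq _ _ P F eta f g L L2 sigma Delta F_meas
  F_int f_def f_convex xstar xstar_min g_meas L_meas g_grad L2_gt0 L_bound g_var eta_meas
  eta_bound d d_prox t ht _ _ Pr (e k) (xi k) (e_meas k) (e_unif k) (xi_law k)
  (block S Je) (block S Jx) (fun i => block S (Ji i))) => //.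
- refine (sigma_block_independent SI Sm indep _) => j.
  by rewrite !inE; case: j.
- move=> i j ij; refine (sigma_block_independent SI Sm indep _) => l.
  rewrite !inE => /eqP ->; apply: contra ij => /eqP[->]//.
- have kJ : inl k \in Je by rewrite inE eqxx.
  exact: (me_block kJ).
- move=> i; have kJ : inr (k, i) \in Jx by rewrite inE.
  exact: (mxi_block kJ).
- move=> i; have kJ : inr (k, i) \in Ji i by rewrite inE eqxx.
  exact: (mxi_block kJ).
Qed.

(* The inequality for a fixed point holds in the mean at the random point x k,
   which is independent of the draws of step k. *)
Let recursion (k : 'I_N) (lam v : R) : 0 < lam ->
  has_mean Pr (fun w => bregman d (x k w) xstar) v ->
  exists v' a, [/\ has_mean Pr (fun w => bregman d (x k.+1 w) xstar) v',
    has_mean Pr (gap k) a & v' + 3 / 4 * alpha * a <= (1 + lam) * v + C lam].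
Proof.
move=> lam0 vP.

have c0 : 0 < 3 / 4 * alpha by rewrite mulr_gt0// divr_gt0.
have mgap : measurable_fun setT (gap k).
  apply: measurable_funB; last exact: measurable_cst.
  exact: measurableT_comp mf (mx (ltnW (ltn_ord k))).
pose G := block S (past k); pose H := block S (present k).
pose Psi (z : g_sigma_algebraType G * g_sigma_algebraType H) :=
  bregman d (next k z.2 (x k z.1)) xstar.
have mPsi : measurable_fun setT Psi.
  apply: (@measurableT_comp _ _ _ _ _ _ (fun z : borel_space R n => bregman d z xstar)).
    exact: (measurable_bregman d_prox).
  apply: (measurable_iterate hp d_prox mftil).
  - exact: measurableT_comp (x_past (ltnW (ltn_ord k))) measurable_fst.
  - have kJ : inl k \in present k by rewrite inE eqxx.
    exact: measurableT_comp (me_block kJ) measurable_snd.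
  - move=> i; have kJ : inr (k, i) \in present k by rewrite inE eqxx.
    exact: measurableT_comp (mxi_block kJ) measurable_snd.
have Psi0 z : 0 <= Psi z by exact: (bregman_ge0 hp d_prox).
have Bb : has_mean Pr (fun w => (1 + lam) * bregman d (x k w) xstar + C lam)
    ((1 + lam) * v + C lam).
  by apply: has_meanD; [exact: has_meanZ|exact: has_mean_cst].
have GH : independent Pr <<s G >> <<s H >>.
  refine (sigma_block_independent SI Sm indep _) => j.
  by rewrite !inE => jk; rewrite (ltn_eqF jk).
have mA : measurable_fun setT (fun w => 3 / 4 * alpha * gap k w).
  by apply: measurable_funM.
have A0 w : 0 <= 3 / 4 * alpha * gap k w by rewrite mulr_ge0// ltW.
have HPsi w : exists2 z, has_mean Pr (fun w' => Psi (w, w')) z &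
    z + 3 / 4 * alpha * gap k w <= (1 + lam) * bregman d (x k w) xstar + C lam.
  exact: (fresh_step k (x k w) lam0).
have [v' [a [v'P aP le]]] :=
  mean_fresh (@block_m (past k)) (@block_m (present k)) GH mPsi Psi0 mA A0 Bb HPsi.
exists v', ((3 / 4 * alpha)^-1 * a); split.
- by under eq_fun do rewrite x_next.
- have -> : gap k = fun w => (3 / 4 * alpha)^-1 * (3 / 4 * alpha * gap k w).
    by apply/funext => w; rewrite mulKf ?gt_eqF.
  exact: has_meanZ.
- by rewrite mulVKf ?gt_eqF.
Qed.

Let err : R := L2 ^+ 2 * t ^+ 2 / 2 + 8 * Delta ^+ 2 / t ^+ 2.

Let err_ge0 : 0 <= err := difference_error_ge0 L2 t Delta.

Let C_ge0 lam : 0 < lam -> 0 <= C lam.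
Proof.
move=> lam0; have nonneg (a r B : R) : 0 <= r -> 0 <= B ->
    0 <= a ^+ 2 * n%:R * B / (2 * lam) + 6 * a ^+ 2 * n%:R * r * sigma ^+ 2 / m%:R
      + 3 * a ^+ 2 * n%:R ^+ 2 * r * B.
  move=> r0 B0; have a0 := sqr_ge0 a; have s0 := sqr_ge0 sigma; have l0 := ltW lam0.
  apply: addr_ge0; first apply: addr_ge0.
  - by apply: divr_ge0; apply: mulr_ge0 => //; exact: mulr_ge0.
  - by apply: divr_ge0 => //; do 4! [apply: mulr_ge0 => //].
  - by do 4! [apply: mulr_ge0 => //]; exact: exprn_ge0.
have r0 := ltW (rho_gt0 hn hq).
exact: nonneg r0 err_ge0.
Qed.

Let telescope_step (lam K v v' s a D c Q l : R) : 0 < lam -> 1 <= (1 + lam) * Q ->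
  0 <= c -> 0 <= K * s -> v + K * s <= Q * (D + l * c) ->
  v' + K * a <= (1 + lam) * v + c ->
  v' + K * (s + a) <= (1 + lam) * Q * (D + (l + 1) * c).
Proof.
move=> lam0 q1 c0 s0 h1 h2.
have h3 := ler_peMl c0 q1.
have l1 : 0 <= 1 + lam by rewrite addr_ge0 ?ltW.
have h5 := ler_wpM2l l1 h1; rewrite [X in X <= _]mulrDr in h5.
have h4 : K * s <= (1 + lam) * (K * s) by rewrite ler_peMl// lerDl ltW.
have -> : (1 + lam) * Q * (D + (l + 1) * c)
  = (1 + lam) * (Q * (D + l * c)) + (1 + lam) * Q * c by ring.
apply: le_trans (lerD h5 h3); rewrite mulrDr addrA -addrA (addrC (K * s)).
rewrite addrA addrAC -addrA; move: h2 h4.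
move: ((1 + lam) * v) ((1 + lam) * (K * s)) (K * a) (K * s).
by intros; lra.
Qed.

Let telescoping lam k : 0 < lam -> (k <= N)%N -> exists v s,
  [/\ has_mean Pr (fun w => bregman d (x k w) xstar) v,
    has_mean Pr (fun w => \sum_(j < k) gap j w) s &
    v + 3 / 4 * alpha * s <= (1 + lam) ^+ k * (bregman d x0 xstar + k%:R * C lam)].
Proof.
move=> lam0; elim: k => [_|k ih kN].
  exists (bregman d x0 xstar), 0; split.
  - rewrite (_ : (fun _ => _) = cst (bregman d x0 xstar)); first exact: has_mean_cst.
    by apply/funext => w; have [-> _] := x_run w.
  - under eq_fun do rewrite big_ord0.
    exact: has_mean_cst.
  - by rewrite expr0 mul1r mul0r addr0 mulr0 addr0.
have [v [s [vP sP le]]] := ih (ltnW kN).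
have [v' [a [v'P aP le']]] := recursion (k := Ordinal kN) lam0 vP.
exists v', (s + a); split => //.
  by under eq_fun do rewrite big_ord_recr; exact: has_meanD.
have s0 : 0 <= s.
  apply: has_mean_ae_ge0 sP; apply: filterE => w.
  by apply: sumr_ge0 => j _; exact: gap_ge0.
have c0 := C_ge0 lam0.
have q1 : 1 <= (1 + lam) ^+ k.+1 by rewrite exprn_ege1// lerDl ltW.
have c34 : 0 <= 3 / 4 * alpha by rewrite mulr_ge0// ltW.
rewrite exprS -[k.+1%:R]natr1; rewrite exprS in q1.
exact: (telescope_step lam0 q1 c0 (mulr_ge0 c34 s0) le le').
Qed.

Let mean_gap lam : 0 < lam -> exists s,
  has_mean Pr (fun w => \sum_(j < N) gap j w) s /\
  3 / 4 * alpha * s <= (1 + lam) ^+ N * (bregman d x0 xstar + N%:R * C lam).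
Proof.
move=> lam0; have [v [s [vP sP le]]] := telescoping lam0 (leqnn N).
exists s; split => //; apply: le_trans le; rewrite lerDr.
by apply: has_mean_ae_ge0 vP; apply: filterE => w; exact: (bregman_ge0 hp d_prox).
Qed.

Let xbar w : 'rV[R]_n := N%:R^-1 *: \sum_(k < N) x k w.

Let gap_average w : f (xbar w) - f xstar <= N%:R^-1 * \sum_(j < N) gap j w.
Proof.
have c0 : 0 <= L2 / 2 by rewrite divr_ge0// ltW.
have := @jensen_average _ _ f _ _ (fun k : 'I_N => x k w) hN
  (convex_ge_tangent f_convex c0 (f_smooth (xbar w))).
rewrite -/(xbar w) sumrB sumr_const card_ord -[f xstar *+ _]mulr_natl mulrBr.
have NR : N%:R != 0 :> R by rewrite pnatr_eq0 -lt0n.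
by rewrite (mulKf NR) lerD2r.
Qed.

Let mxbar : measurable_fun setT (xbar : Omega -> borel_space R n).
Proof.
apply: measurable_to_borel => j; under eq_fun do rewrite mxE summxE.
apply: measurable_funM; first exact: measurable_cst.
by apply: measurable_sum => k; apply: measurable_to_borelP; exact: mx (ltnW (ltn_ord k)).
Qed.

Let growth : (1 + (2 * N%:R)^-1) ^+ N <= 2 :> R.
Proof.
have NR : 0 < N%:R :> R by rewrite ltr0n.
have l0 : 0 < (2 * N%:R)^-1 :> R by rewrite invr_gt0 mulr_gt0.
have l1 : 0 < 1 + (2 * N%:R)^-1 :> R by rewrite addr_gt0.
have v0 : 0 <= (1 + (2 * N%:R)^-1)^-1 :> R by rewrite invr_ge0 ltW.
have := bernoulli N v0; rewrite exprVn.
have -> : 1 + N%:R * ((1 + (2 * N%:R)^-1)^-1 - 1) = (N%:R + 1) / (2 * N%:R + 1) :> R.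
  by field; rewrite !gt_eqF//; lra.
move=> h; rewrite -lef_pV2 ?posrE ?exprn_gt0//; apply: le_trans h.
by rewrite ler_pdivlMr; lra.
Qed.

Let expected_gap_value (Theta : R) :
  8 / (3 * alpha * N%:R) * Theta + 8 / (3 * alpha) * C (2 * N%:R)^-1
    = 128 * n%:R * rho n q * L2 * Theta / N%:R + sigma ^+ 2 / (3 * L2 * m%:R)
      + (n%:R / (6 * L2) + N%:R / (18 * L2 * rho n q)) * err.
Proof.
rewrite /C /step_constant -/err /alpha.
have NR : 0 < N%:R :> R by rewrite ltr0n.
have mR : 0 < m%:R :> R by rewrite ltr0n.
have nR : 0 < n%:R :> R by rewrite ltr0n (leq_trans _ hn).
have r0 := rho_gt0 hn hq.
move: (N%:R) (m%:R) (n%:R) (rho n q) err NR mR nR r0 => N' m' n' r B NR mR nR r0.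
by field; rewrite !gt_eqF.
Qed.

(** With the growth rate 1/(2N) of the divergence, the factor (1 + 1/(2N))^N
    accumulated over the run is at most 2. *)
Lemma expected_gap (Theta : R) : bregman d x0 xstar <= Theta ->
  exists2 a, has_mean Pr (fun w => f (xbar w)) a &
    a - f xstar <= 128 * n%:R * rho n q * L2 * Theta / N%:R
      + sigma ^+ 2 / (3 * L2 * m%:R)
      + (n%:R / (6 * L2) + N%:R / (18 * L2 * rho n q))
        * (L2 ^+ 2 * t ^+ 2 / 2 + 8 * Delta ^+ 2 / t ^+ 2).
Proof.
move=> Dle; rewrite -expected_gap_value.
have NR : 0 < N%:R :> R by rewrite ltr0n.
have l0 : 0 < (2 * N%:R)^-1 :> R by rewrite invr_gt0 mulr_gt0.
have [s [sP sle]] := mean_gap l0.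
have avgP := has_meanZ N%:R^-1 sP.
pose h w := f (xbar w) - f xstar.
have h0 w : 0 <= h w by rewrite subr_ge0; exact: xstar_min.
have mh : measurable_fun setT h.
  apply: measurable_funB; last exact: measurable_cst.
  exact: measurableT_comp mf mxbar.
have [a aP] : exists a, has_mean Pr h a.
  apply: has_mean_dominated mh _ avgP; apply: filterE => w.
  by rewrite ger0_norm//; exact: gap_average.
have as_ : a <= N%:R^-1 * s.
  by apply: has_mean_le aP avgP; apply: filterE => w; exact: gap_average.
exists (a + f xstar).
  have -> : (fun w => f (xbar w)) = (fun w => h w + f xstar).
    by apply/funext => w; rewrite subrK.
  by apply: has_meanD aP _; exact: has_mean_cst.
rewrite addrK; apply: le_trans as_ _.
have le2 : 3 / 4 * alpha * s <= 2 * (Theta + N%:R * C (2 * N%:R)^-1).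
  apply: le_trans sle _; apply: ler_pM growth _; first by rewrite exprn_ge0// addr_ge0// ltW.
    by rewrite addr_ge0 ?(bregman_ge0 hp d_prox)// mulr_ge0// ?C_ge0// ltW.
  by rewrite lerD2r.
have -> : N%:R^-1 * s = 4 / (3 * alpha * N%:R) * (3 / 4 * alpha * s).
  by field; rewrite !gt_eqF.
have -> : 8 / (3 * alpha * N%:R) * Theta + 8 / (3 * alpha) * C (2 * N%:R)^-1
    = 4 / (3 * alpha * N%:R) * (2 * (Theta + N%:R * C (2 * N%:R)^-1)).
  by field; rewrite !gt_eqF.
have c0 : 0 < 4 / (3 * alpha * N%:R) by rewrite divr_gt0// mulr_gt0// mulr_gt0.
by rewrite ler_pM2l.
Qed.

(** A bound of the absolute value that holds almost surely on a probability
    space is nonnegative. *)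
Lemma Delta_ge0 : 0 <= Delta.
Proof.
have : {ae P, forall s, 0 <= cst Delta s}.
  by apply: filterS eta_bound => s /(_ 0); exact: le_trans.
move/has_mean_ae_ge0; apply; exact: has_mean_cst.
Qed.

End run.

Theorem theorem2p9 (R : realType) (n : nat) (hn : (8 <= n)%N)
  (p : R) (hp : 1 <= p <= 2) (q : \bar R) (hq : (2%:E <= q)%E)
  (hpq : ((p%:E)^-1 + q^-1 = 1)%E)
  (dX : measure_display) (X : measurableType dX) (P : probability X R)
  (F : 'rV[R]_n -> X -> R)
  (F_meas : measurable_fun setT (fun z : borel_space R n * X => F z.1 z.2))
  (F_int : forall x, P.-integrable setT (fun s => (F x s)%:E))
  (f : 'rV[R]_n -> R) (f_def : forall x, ((f x)%:E = 'E_P[F x])%E)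
  (f_closed : closed_function f)
  (f_convex : convex_function [set: 'rV[R]_n] f)
  (xstar : 'rV[R]_n) (xstar_min : is_minimizer f xstar)
  (g : 'rV[R]_n -> X -> 'rV[R]_n)
  (g_meas : measurable_fun setT
     (fun z : borel_space R n * X => g z.1 z.2 : borel_space R n))
  (L : X -> R) (L_meas : measurable_fun setT L)
  (g_grad : {ae P, forall s,
     (forall x, has_grad (F ^~ s) x (g x s)) /\
     (forall x y, norm2 (g x s - g y s) <= L s * norm2 (x - y))})
  (L2 : R) (L2_gt0 : 0 < L2)
  (L_bound : (sqrte 'E_P[fun s => (L s ^+ 2)%R] <= L2%:E)%E)
  (sigma : R)
  (g_var : forall x,
     ('E_P[fun s => (norm2 (g x s - grad f x) ^+ 2)%R] <= (sigma ^+ 2)%:E)%E)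
  (eta : 'rV[R]_n -> X -> R)
  (eta_meas : measurable_fun setT
     (fun z : borel_space R n * X => eta z.1 z.2))
  (Delta : R)
  (eta_bound : {ae P, forall s, forall x, `|eta x s| <= Delta})
  (d : 'rV[R]_n -> R) (d_prox : prox_function p d)
  (N m : nat) (hN : (1 <= N)%N) (hm : (1 <= m)%N) (t : R) (ht : 0 < t)
  (x0 : 'rV[R]_n)
  (dO : measure_display) (Omega : measurableType dO) (Pr : probability Omega R)
  (e : 'I_N -> Omega -> borel_space R n) (xi : 'I_N -> 'I_m -> Omega -> X)
  (e_meas : forall k, measurable_fun setT (e k))
  (e_unif : forall k, uniform_on_sphere (pushforward Pr (e k)))
  (xi_law : forall k i, has_law Pr (xi k i) P)
  (indep : mutually_independent Pr
     (fun j : 'I_N + 'I_N * 'I_m =>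
        match j with
        | inl k => sigma_of (e k)
        | inr (k, i) => sigma_of (xi k i)
        end))
  (x : nat -> Omega -> 'rV[R]_n)
  (x_run : forall w, rdfds_run (fun y s => F y s + eta y s) d t
     (48 * n%:R * rho n q * L2)^-1 x0
     (fun k => e k w) (fun k i => xi k i w) (fun k => x k w))
  (Theta : R) (hTheta : bregman d x0 xstar <= Theta) :
  ('E_Pr[fun w => f (N%:R^-1 *: \sum_(k < N) x k w)%R] - (f xstar)%:E
   <= (384 * n%:R * rho n q * L2 * Theta / N%:R
       + 2 * sigma ^+ 2 / (L2 * m%:R)
       + (n%:R / (6 * L2) + N%:R / (3 * L2 * rho n q))
         * (L2 ^+ 2 * t ^+ 2 / 2 + 8 * Delta ^+ 2 / t ^+ 2)
       + 8 * Num.sqrt (2 * n%:R * Theta) / N%:R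
         * (L2 * t / 2 + 2 * Delta / t))%:E)%E.
Proof.
have [a aP ale] := expected_gap hn hp hq hpq F_meas F_int f_def f_convex xstar_min g_meas
  L_meas g_grad L2_gt0 L_bound g_var eta_meas eta_bound d_prox hN hm ht e_meas e_unif
  xi_law indep x_run hTheta.
have Delta0 := Delta_ge0 eta_bound.
have Theta0 : 0 <= Theta by apply: le_trans hTheta; exact: (bregman_ge0 hp d_prox).
have -> : ('E_Pr[fun w => f (N%:R^-1 *: \sum_(k < N) x k w)%R] = a%:E)%E.
  by rewrite unlock; exact: aP.2.
rewrite -EFinB lee_fin; apply: le_trans ale _.
have NR : 0 < N%:R :> R by rewrite ltr0n.
have mR : 0 < m%:R :> R by rewrite ltr0n.
have nR : 0 < n%:R :> R by rewrite ltr0n (leq_trans _ hn).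
have r0 := rho_gt0 hn hq.
have root0 := sqrtr_ge0 (2 * n%:R * Theta).
move: (Num.sqrt _) root0 => root root0.
exact: (weaker_bound sigma nR NR mR r0 L2_gt0 Theta0 Delta0 ht root0).
Qed.
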